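(* Let $M$ be a smooth complex affine variety satisfying: (a) the special automorphism group $\mathrm{SAut}(M)$ acts transitively on $M$, and (b) there is a nontrivial algebraic $\mathrm{SL}_2(\mathbb{C})$-action on $M$ for which $A_1\neq\{0\}$ or $A_2\neq\{0\}$, where $A_d=\ker D\cap\mathbb{C}[M]_d$. Then $M$ has the algebraic density property.
   Context: $\mathbb{C}[M]$ is the ring of regular functions on $M$. An algebraic $\mathrm{SL}_2(\mathbb{C})$-action on $M$ induces a fundamental pair $(D,U)$ of locally nilpotent $\mathbb{C}$-derivations of $\mathbb{C}[M]$ (the infinitesimal generators of the two opposite unipotent one-parameter root subgroups of $\mathrm{SL}_2$), i.e. with $E=[D,U]$ one has $[D,E]=-2D$ and $[U,E]=2U$. The induced torus action gives the $\mathbb{Z}$-grading $\mathbb{C}[M]=\bigoplus_{d\in\mathbb{Z}}\mathbb{C}[M]_d$ with $\mathbb{C}[M]_d=\ker(E-d\cdot I)$. $\mathrm{SAut}(M)$ is the subgroup of the group of algebraic automorphisms of $M$ generated by all algebraic one-parameter unipotent subgroups (equivalently, by the flows of all locally nilpotent derivations of $\mathbb{C}[M]$). A smooth affine variety $M$ over $\mathbb{C}$ has the algebraic density property if the Lie algebra generated by the ($\mathbb{C}$-)complete algebraic (polynomial) vector fields on $M$ coincides with the Lie algebra of all algebraic vector fields on $M$; a vector field is complete if its flow exists for all complex times from every initial point. *)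

(* Defs.v *)
From HB Require Import structures.
From mathcomp Require Import all_boot all_order all_algebra.
(* The notations of mpoly clash with those of MathComp-Analysis. *)
From mathcomp Require Import -(notations) mpoly.
From mathcomp Require Import complex.
From mathcomp Require Import boolp classical_sets functions reals topology.
From mathcomp Require Import normedtype derive.

Set Implicit Arguments.
Unset Strict Implicit.
Unset Printing Implicit Defensive.

Import GRing.Theory.
Import numFieldNormedType.Exports.

Local Open Scope classical_set_scope.
Local Open Scope ring_scope.

(* The field of complex numbers is R[i] for an arbitrary R : realType; a point
   of the affine space A^n is a row vector, and the polynomial P is evaluated
   at the point z as mpoly.meval (z 0) P. *)

Section ZariskiTopology.
Context {R : realType} {n : nat}.
Local Notation C := R[i].
Implicit Types (S : set (mpoly.mpoly n C)) (X : set 'rV[C]_n).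

Definition zero_locus S : set 'rV[C]_n :=
  [set z | forall P, S P -> mpoly.meval (z 0) P = 0].

Definition vanishing_ideal X : set (mpoly.mpoly n C) :=
  [set P | forall z, X z -> mpoly.meval (z 0) P = 0].

Definition zariski_closed X := exists S, X = zero_locus S.

Definition irreducible X :=
  X !=set0 /\
  forall Y Z : set 'rV[C]_n, zariski_closed Y -> zariski_closed Z ->
    X `<=` Y `|` Z -> X `<=` Y \/ X `<=` Z.

Definition affine_variety X := zariski_closed X /\ irreducible X.

(* A strictly increasing chain of length d of irreducible closed subsets. *)
Definition irreducible_chain X (d : nat) (Z : nat -> set 'rV[C]_n) :=
  (forall i, (i <= d)%N -> affine_variety (Z i) /\ Z i `<=` X) /\
  (forall i, (i < d)%N -> Z i `<` Z i.+1).

Definition has_dimension X (d : nat) :=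
  (exists Z, irreducible_chain X d Z) /\
  (forall e Z, irreducible_chain X e Z -> (e <= d)%N).

Definition tangent_space X (z : 'rV[C]_n) : set 'rV[C]_n :=
  [set v | forall P, vanishing_ideal X P ->
     \sum_(j < n) mpoly.meval (z 0) (mpoly.mderiv j P) * v 0 j = 0].

(* For an irreducible X, whose local dimension is the same at all points. *)
Definition smooth X := exists d, has_dimension X d /\
  forall z, X z -> exists U : {vspace 'rV[C]_n},
    [set` U] = tangent_space X z /\ \dim U = d.

End ZariskiTopology.

(* A type T of points equipped with coordinates iota : T -> A^m is treated as
   the subset iota(T) of A^m. This is applied to M, to C x M and to SL_2 x M. *)
Definition regular (R : realType) (m : nat) (T : Type) (iota : T -> 'rV[R[i]]_m)
    (f : T -> R[i]) :=
  exists P : mpoly.mpoly m R[i], forall t, f t = mpoly.meval (iota t 0) P.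

Definition is_morphism (R : realType) (m n : nat) (T : Type)
    (iota : T -> 'rV[R[i]]_m) (M : set 'rV[R[i]]_n) (phi : T -> M) :=
  forall j, regular iota (fun t => val (phi t) 0 j).

Section CoordinateRing.
Context {R : realType} {n : nat}.
Variable M : set 'rV[R[i]]_n.

Definition regular_pred : {pred M -> R[i]} :=
  fun f => `[< regular (val : M -> 'rV[R[i]]_n) f >].

Fact regular_subring : subring_closed regular_pred.
Proof.
split.
- by apply/asboolP; exists 1 => x; rewrite mpoly.meval1.
- move=> f g /asboolP[P hP] /asboolP[Q hQ]; apply/asboolP; exists (P - Q) => x.
  by rewrite mpoly.mevalB -hP -hQ.
- move=> f g /asboolP[P hP] /asboolP[Q hQ]; apply/asboolP; exists (P * Q) => x.
  by rewrite mpoly.mevalM -hP -hQ.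
Qed.

Fact regular_scaler : GRing.scaler_closed regular_pred.
Proof.
move=> c f /asboolP[P hP]; apply/asboolP; exists (c *: P) => x.
by rewrite mpoly.mevalZ -hP.
Qed.

HB.instance Definition _ :=
  GRing.isSubringClosed.Build _ regular_pred regular_subring.
HB.instance Definition _ :=
  GRing.isScaleClosed.Build _ _ regular_pred regular_scaler.

(* The ring C[M] of regular functions on M, with pointwise operations. *)
Record coord_ring :=
  CoordRing { regular_fun :> M -> R[i]; _ : regular_fun \in regular_pred }.

HB.instance Definition _ := [isSub for regular_fun].
HB.instance Definition _ := [Choice of coord_ring by <:].
HB.instance Definition _ :=
  GRing.SubChoice_isSubComPzRing.Build _ _ coord_ring regular_subring.
HB.instance Definition _ := [SubZmodule_isSubLmodule of coord_ring by <:].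

End CoordinateRing.

Section VectorFields.
Context {R : realType} {n : nat} {M : set 'rV[R[i]]_n}.
Local Notation C := R[i].
Local Notation CM := (coord_ring M).
Implicit Types (V W : CM -> CM) (L : set (CM -> CM)).

(* Algebraic vector fields on M are the C-derivations of C[M]. *)
Definition vector_field V :=
  linear V /\ forall f g, V (f * g) = V f * g + f * V g.

Definition lie_bracket V W : CM -> CM := fun f => V (W f) - W (V f).

Definition lie_subalgebra L :=
  [/\ L `<=` vector_field,
      L 0,
      forall (c : C) V W, L V -> L W -> L (c *: V + W) &
      forall V W, L V -> L W -> L (lie_bracket V W)].

Definition generated_lie_algebra L := smallest lie_subalgebra L.

(* phi is an entire integral curve of V: phi' = V o phi, tested against all
   regular functions, the derivative being the complex one. *)
Definition integral_curve V (phi : C -> M) :=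
  forall (f : CM) (t : C),
    is_derive (t : C^o) (1 : C^o) (fun s => f (phi s) : C^o) (V f (phi t)).

Definition complete V :=
  forall x : M, exists phi : C -> M, phi 0 = x /\ integral_curve V phi.

End VectorFields.

Definition algebraic_density_property (R : realType) (n : nat)
    (M : set 'rV[R[i]]_n) :=
  generated_lie_algebra
    [set V : coord_ring M -> coord_ring M | vector_field V /\ complete V] =
  [set V | vector_field V].

Section SpecialAutomorphisms.
Context {R : realType} {n : nat}.
Variable M : set 'rV[R[i]]_n.
Local Notation C := R[i].
Implicit Types (phi psi : M -> M) (G : set (M -> M)).

Definition automorphism phi :=
  is_morphism val phi /\
  exists psi, [/\ is_morphism val psi, cancel phi psi & cancel psi phi].

Definition aut_subgroup G :=
  [/\ G `<=` automorphism,
      G id,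
      forall phi psi, G phi -> G psi -> G (phi \o psi) &
      forall phi psi, G phi -> cancel phi psi -> cancel psi phi -> G psi].

(* An algebraic action C x M -> M of the additive group. *)
Definition Ga_action (a : C -> M -> M) :=
  [/\ is_morphism (fun p : C * M => row_mx (const_mx p.1 : 'rV_1) (val p.2))
        (fun p => a p.1 p.2),
      forall x, a 0 x = x &
      forall s t x, a (s + t) x = a s (a t x)].

Definition SAut : set (M -> M) :=
  smallest aut_subgroup [set phi | exists a t, Ga_action a /\ phi = a t].

Definition SAut_transitive := forall x y : M, exists phi, SAut phi /\ phi x = y.

End SpecialAutomorphisms.

Section SL2.
Variable R : realType.
Local Notation C := R[i].

Record SL2 := MkSL2 { SL2_mx :> 'M[C]_2; _ : \det SL2_mx == 1 }.

HB.instance Definition _ := [isSub for SL2_mx].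
HB.instance Definition _ := [Choice of SL2 by <:].

Fact SL2_one_subproof : \det (1%:M : 'M[C]_2) == 1.
Proof. by rewrite det1. Qed.
Definition SL2_one := MkSL2 SL2_one_subproof.

Fact SL2_mul_subproof (g h : SL2) : \det (g *m h) == 1.
Proof. by rewrite det_mulmx (eqP (valP g)) (eqP (valP h)) mulr1. Qed.
Definition SL2_mul (g h : SL2) := MkSL2 (SL2_mul_subproof g h).

Fact SL2_inv_subproof (g : SL2) : \det (invmx g) == 1.
Proof. by rewrite det_inv (eqP (valP g)) invr1. Qed.
Definition SL2_inv (g : SL2) := MkSL2 (SL2_inv_subproof g).

Fact SL2_unitmx (g : SL2) : (g : 'M[C]_2) \in unitmx.
Proof. by rewrite unitmxE (eqP (valP g)) unitr1. Qed.

Fact SL2_mulA : associative SL2_mul.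
Proof. by move=> g h k; apply: val_inj; rewrite /= mulmxA. Qed.
Fact SL2_mul1 : left_id SL2_one SL2_mul.
Proof. by move=> g; apply: val_inj; rewrite /= mul1mx. Qed.
Fact SL2_mulr1 : right_id SL2_one SL2_mul.
Proof. by move=> g; apply: val_inj; rewrite /= mulmx1. Qed.
Fact SL2_mulV : left_inverse SL2_one SL2_inv SL2_mul.
Proof. by move=> g; apply: val_inj; rewrite /= mulVmx // SL2_unitmx. Qed.
Fact SL2_mulrV : right_inverse SL2_one SL2_inv SL2_mul.
Proof. by move=> g; apply: val_inj; rewrite /= mulmxV // SL2_unitmx. Qed.

HB.instance Definition _ :=
  isGroup.Build SL2 SL2_mulA SL2_mul1 SL2_mulr1 SL2_mulV SL2_mulrV.

Fact upper_root_subproof (t : C) : \det (1%:M + t *: delta_mx 0 1 : 'M[C]_2) == 1.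
Proof.
apply/eqP; rewrite (expand_det_row _ 0) !big_ord_recl big_ord0 /cofactor.
by rewrite !det_mx11 !mxE /= ?(mulr0, mulr1, mul0r, mul1r, addr0, add0r, expr0).
Qed.
Definition upper_root (t : C) : SL2 := MkSL2 (upper_root_subproof t).

Fact lower_root_subproof (t : C) : \det (1%:M + t *: delta_mx 1 0 : 'M[C]_2) == 1.
Proof.
apply/eqP; rewrite (expand_det_row _ 0) !big_ord_recl big_ord0 /cofactor.
by rewrite !det_mx11 !mxE /= ?(mulr0, mulr1, mul0r, mul1r, addr0, add0r, expr0).
Qed.
Definition lower_root (t : C) : SL2 := MkSL2 (lower_root_subproof t).

Context {n : nat}.
Variable M : set 'rV[C]_n.

(* The coordinates on SL_2 are the four matrix entries. *)
Definition SL2_action (a : SL2 -> M -> M) :=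
  [/\ is_morphism
        (fun p : SL2 * M => row_mx (mxvec (p.1 : 'M[C]_2)) (val p.2))
        (fun p => a p.1 p.2),
      forall x, a 1%g x = x &
      forall g h x, a (g * h)%g x = a g (a h x)].

Definition nontrivial_action (a : SL2 -> M -> M) := exists g x, a g x <> x.

(* D f (x) = d/dt f(b t x) at t = 0, for a one-parameter group b. *)
Definition infinitesimal_generator (b : C -> M -> M)
    (D : coord_ring M -> coord_ring M) :=
  forall (f : coord_ring M) (x : M),
    is_derive (0 : C^o) (1 : C^o) (fun t => f (b t x) : C^o) (D f x).

(* With these generators (pullback of functions), E := [D, U] satisfies
   [D, E] = - 2 D and [U, E] = 2 U. *)
Definition induced_pair (a : SL2 -> M -> M) (D U : coord_ring M -> coord_ring M) :=
  infinitesimal_generator (fun t => a (upper_root t)) D /\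
  infinitesimal_generator (fun t => a (lower_root t)) U.

(* A_d = ker D \cap ker (E - d I), with E = [D, U]. *)
Definition highest_weight_space (D U : coord_ring M -> coord_ring M) (d : int) :
    set (coord_ring M) :=
  [set f | D f = 0 /\ lie_bracket D U f = d%:~R *: f].

End SL2.

(* Main.v *)
(** Let L be the Lie algebra generated by the complete algebraic vector fields and let N be
    the largest C[M]-submodule of Vec(M) contained in L; [L, N] is contained in N.

    N is nonzero as soon as SL_2 acts nontrivially.  Let D, U, E be the generators of the
    action, with E = [D, U] that of the torus.  The fields h D with D^2 h = 0, h U with
    U^2 h = 0 and f E with E f = 0 are complete; taking brackets along the sl_2-strings
    shows that f D, f U, f E lie in L for every f of even weight.  If there are functions of
    odd weight, one bracket more gives an odd g <> 0 with g E in L, and then the brackets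
    [f E, g E] give C[M] g E in L.

    Bracketing with N, a C[M]-multiple of every locally nilpotent derivation lies in N.  By
    transitivity, finitely many additive group actions give a dominant polynomial map
    Phi : C^m -> M, whose partial derivatives are tangent to N.  Any vector field V, as a
    derivation of C[M] into C[t_1..t_m], extends up to a factor to C[t_1..t_m]; so it is
    generically a combination of those tangent directions, and by Cramer's rule there is
    c <> 0 with c Vec(M) in N.  The ideal of all such c is invariant under SAut(M), hence
    without zeros, hence it contains 1 by the Nullstellensatz. *)

Require Import Defs.
From mathcomp Require Import all_boot all_order all_algebra.
From mathcomp Require Import -(notations) mpoly.
From mathcomp Require Import complex ring lra zify.
From mathcomp Require Import boolp classical_sets functions cardinality reals topology.
From mathcomp Require Import normedtype sequences derive exp trigo lebesgue_measure.

Set Implicit Arguments.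
Unset Strict Implicit.
Unset Printing Implicit Defensive.

Import Order.TTheory GRing.Theory Num.Theory.
Import numFieldNormedType.Exports.

Local Open Scope classical_set_scope.
Local Open Scope ring_scope.

(** * Complex derivatives and the complex exponential *)

(** A function multiple of a complete field need not be complete, so L is not visibly a C[M]-module;
    this is the obstacle, and N is the device against it. For V in L and W in N the identity f
    [V, W] = [V, f W] - V(f) W keeps the bracket in N. If f lies in the kernel of a locally
    nilpotent d, then f d is complete and f [d, W] - [f d, W] = W(f) d, which carries the module
    property over from W to d; a W that kills ker d is proportional to d anyway. All this holds only
    up to nonzero factors in the domain C[M], and these are removed in one stroke at the end. Even
    weights are singled out because their strings pass through weight 0, the only weight whose
    functions multiply E to a complete field by the torus argument. A string of odd weights misses
    it, hence the detour through one odd g. Ranks, dimensions and extensions of derivations are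
    handled without fraction fields: by nonzero minors, by chains of closed sets, and by subrings of
    dual numbers. *)

Section ComplexDerivative.
Context {C : numFieldType}.
Implicit Types (f g : C -> C) (t : C).

Definition isd f t d := is_derive (t : C^o) (1 : C^o) (f : C -> C^o) d.

Lemma isd_unique f t d d' : isd f t d -> isd f t d' -> d = d'.
Proof. by move=> [_ <-] [_ <-]. Qed.

Lemma isd_eq f t d d' : isd f t d -> d = d' -> isd f t d'.
Proof. by move=> h <-. Qed.

Lemma isd_cst c t : isd (fun=> c) t 0.
Proof. exact: is_derive_cst. Qed.

Lemma isd_id t : isd id t 1.
Proof. exact: is_derive_id. Qed.

Lemma isdD f g t a b : isd f t a -> isd g t b -> isd (fun s => f s + g s) t (a + b).
Proof. exact: is_deriveD. Qed.

Lemma isdM f g t a b : isd f t a -> isd g t b ->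
  isd (fun s => f s * g s) t (a * g t + f t * b).
Proof.
move=> ha hb; apply: isd_eq (is_deriveM ha hb) _.
by rewrite addrC [g t *: a]mulrC.
Qed.

Lemma isd_shift f c t a : isd f (t + c) a -> isd (fun s => f (s + c)) t a.
Proof.
have E : (fun h : C => h^-1 *: (((f : C^o -> C^o) \o shift ((t + c) : C^o)) (h *: (1 : C^o))
                        - f (t + c))) =
         (fun h : C => h^-1 *: (((fun s => f (s + c) : C^o) \o shift (t : C^o)) (h *: (1 : C^o))
                        - f (t + c))).
  by apply/funext => h /=; rewrite addrA.
move=> [dg eg]; split; first by move: dg; rewrite /derivable E.
by move: eg; rewrite /derive E.
Qed.

(** The difference quotient is within K |h| of [a]. This is how explicit estimates yield the
    derivative of [cexp]. *)
Lemma isd_quadratic f t a (K r : C) : 0 < r -> 0 <= K ->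
  (forall h, `|h| < r -> `|f (h + t) - f t - h * a| <= K * `|h| ^+ 2) ->
  isd f t a.
Proof.
move=> r0 K0 H.
have cv : (fun h : C => h^-1 *: (((f : C^o -> C^o) \o shift (t : C^o)) (h *: (1 : C^o)) - f t) : C^o)
    @ 0^' --> (a : C^o).
  apply/cvgrPdist_le => e e0; near=> h.
  have h0 : h != 0 by near: h; exact: nbhs_dnbhs_neq.
  have hr : `|h| < r.
    near: h; apply: dnbhs0_lt => //.
  (* [K] may vanish, hence the denominator K + 1. *)
  have he : `|h| < e / (K + 1).
    near: h; apply: dnbhs0_lt; rewrite divr_gt0 // ltr_wpDl //.
  rewrite /= -normrN opprB.
  have -> : h^-1 *: ((f (h *: (1 : C^o) + t)) - f t) - a = h^-1 * (f (h + t) - f t - h * a).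
    by rewrite [in RHS]mulrBr mulrA mulVf // mul1r [h *: _]mulr1.
  rewrite normrM normfV ler_pdivrMl ?normr_gt0 //.
  apply: le_trans (H _ hr) _; rewrite expr2 mulrCA ler_wpM2l //.
  apply: le_trans (_ : (K + 1) * `|h| <= _); first by rewrite ler_wpM2r // lerDl.
  by rewrite -ler_pdivlMl ?ltr_wpDl // mulrC ltW.
split; first by apply/cvg_ex; exists (a : C^o).
exact/cvg_lim.
Unshelve. all: by end_near. Qed.

Lemma isd_sum (I : Type) (r : seq I) (f : I -> C -> C) (d : I -> C) t :
  (forall i, isd (f i) t (d i)) ->
  isd (fun s => \sum_(i <- r) f i s) t (\sum_(i <- r) d i).
Proof.
move=> h; elim: r => [|i r IH].
  rewrite big_nil; rewrite (_ : (fun _ => _) = fun=> 0); last first.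
    by apply/funext => s; rewrite big_nil.
  exact: isd_cst.
rewrite big_cons (_ : (fun _ => _) = fun s => f i s + \sum_(j <- r) f j s); last first.
  by apply/funext => s; rewrite big_cons.
exact: isdD.
Qed.

Lemma isdX f t d k : isd f t d -> isd (fun s => f s ^+ k) t (k%:R * f t ^+ k.-1 * d).
Proof.
move=> fd; elim: k => [|k IH].
  by rewrite !mul0r (_ : (fun _ => _) = fun=> 1) //; exact: isd_cst.
rewrite (_ : (fun _ => _) = fun s => f s * f s ^+ k); last first.
  by apply/funext => s; rewrite exprS.
apply: isd_eq (isdM fd IH) _.
case: k {IH} => [|k] /=; first by rewrite !expr0; ring.
by rewrite !exprS -[k.+2%:R]natr1 -natr1; ring.
Qed.

Lemma isd_exp n t : isd (fun s => s ^+ n) t (n%:R * t ^+ n.-1).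
Proof. by apply: isd_eq (isdX n (isd_id t)) _; rewrite mulr1. Qed.

Lemma isd_meval m (P : mpoly.mpoly m C) (g : 'I_m -> C -> C) (d : 'I_m -> C) t :
  (forall i, isd (g i) t (d i)) ->
  isd (fun s => mpoly.meval (fun i => g i s) P) t
      (\sum_i mpoly.meval (fun i => g i t) (mpoly.mderiv i P) * d i).
Proof.
move=> h.
pose F P := isd (fun s => mpoly.meval (fun i => g i s) P) t
      (\sum_i mpoly.meval (fun i => g i t) (mpoly.mderiv i P) * d i).
have FD p q : F p -> F q -> F (p + q).
  rewrite /F => hp hq; rewrite (_ : (fun _ => _) = fun s =>
     mpoly.meval (fun i => g i s) p + mpoly.meval (fun i => g i s) q); last first.
    by apply/funext => s; rewrite mpoly.mevalD.
  apply: isd_eq (isdD hp hq) _; rewrite -big_split; apply: eq_bigr => i _.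
  by rewrite mpoly.mderivD mpoly.mevalD mulrDl.
have FM p q : F p -> F q -> F (p * q).
  rewrite /F => hp hq; rewrite (_ : (fun _ => _) = fun s =>
     mpoly.meval (fun i => g i s) p * mpoly.meval (fun i => g i s) q); last first.
    by apply/funext => s; rewrite mpoly.mevalM.
  apply: isd_eq (isdM hp hq) _; rewrite mulr_suml mulr_sumr -big_split.
  apply: eq_bigr => i _ /=.
  rewrite mpoly.mderivM mpoly.mevalD !mpoly.mevalM; ring.
have FC c : F (mpoly.mpolyC m c).
  rewrite /F (_ : (fun _ => _) = fun=> c); last first.
    by apply/funext => s; rewrite mpoly.mevalC.
  apply: isd_eq (isd_cst _ _) _; rewrite big1 // => i _.
  by rewrite mpoly.mderivC mpoly.meval0 mul0r.
have FX i : F (mpoly.mpolyX C (mpoly.mnm1 i)).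
  rewrite /F (_ : (fun _ => _) = g i); last first.
    by apply/funext => s; rewrite mpoly.mevalXU.
  apply: isd_eq (h i) _; rewrite (bigD1 i) //= big1 ?addr0 => [|j ji].
    rewrite mpoly.mderivX mpoly.mnm1E eqxx scale1r mpoly.mevalX big1 ?mul1r // => k _.
    by rewrite mpoly.mnmBE subnn expr0.
  by rewrite mpoly.mderivX mpoly.mnm1E eq_sym (negPf ji) scale0r mpoly.meval0 mul0r.
rewrite -/(F P).
have FXm mm : F (mpoly.mpolyX C mm).
  rewrite mpoly.mpolyXE_id; elim/big_ind: _ => [|p q|i _]; first exact: (FC 1).
    exact: FM.
  by elim: (mm i) => [|k IH]; rewrite ?expr0 ?exprS; [exact: (FC 1)|exact: FM].
elim/mpoly.mpolyind: P => [|c mm p _ _ IH].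
  by have := FC 0; rewrite mpoly.mpolyC0.
by apply: FD => //; rewrite -mpoly.mul_mpolyC; exact: FM.
Qed.

End ComplexDerivative.

Section ComplexExponential.
Context {R : realType}.
Local Notation C := R[i].

Lemma sin_norm_le (b : R) : `|sin b| <= `|b|.
Proof.
wlog b0 : b / 0 <= b.
  move=> H; have [/H//|/ltW b0] := leP 0 b.
  by have := H (- b); rewrite sinN !normrN; apply; rewrite oppr_ge0.
have [c _] := MVT_segment b0 (fun x _ => is_derive_sin x)
  (continuous_subspaceT (@continuous_sin R)).
rewrite sin0 !subr0 => ->.
by rewrite normrM ler_piMl // cos_max.
Qed.

Lemma cos_sub1_norm_le (b : R) : `|cos b - 1| <= b ^+ 2.
Proof.
have -> : cos b - 1 = - (sin (b / 2) ^+ 2 *+ 2).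
  have -> : cos b = cos ((b / 2) *+ 2) by congr cos; rewrite -mulr_natr; field.
  by rewrite cos_mulr2n cos2sin2; ring.
rewrite normrN ger0_norm ?mulrn_wge0 ?sqr_ge0 //.
have : sin (b / 2) ^+ 2 <= (b / 2) ^+ 2.
  rewrite -[sin _ ^+ 2]real_normK ?num_real // -[(b / 2) ^+ 2]real_normK ?num_real //.
  by rewrite ler_pXn2r ?nnegrE // sin_norm_le.
have := sqr_ge0 b; rewrite -mulr_natr; nra.
Qed.

Lemma sin_subr_norm_le (b : R) : `|b| <= 1 -> `|sin b - b| <= b ^+ 2.
Proof.
wlog b0 : b / 0 <= b.
  move=> H; have [/H//|/ltW b0] := leP 0 b.
  have := H (- b); rewrite sinN normrN -opprD normrN sqrrN; apply.
  by rewrite oppr_ge0.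
rewrite ger0_norm // => b1.
have [c] := MVT_segment b0 (fun x _ => is_derive_sin x)
  (continuous_subspaceT (@continuous_sin R)).
rewrite sin0 !subr0 in_itv /= => /andP[c0 cb] ->.
have -> : cos c * b - b = (cos c - 1) * b by ring.
rewrite normrM (ger0_norm b0) expr2 ler_wpM2r //.
apply: le_trans (cos_sub1_norm_le _) _; nra.
Qed.

(** The upper bound comes from 1 - a <= e^(-a), that is e^a <= 1/(1 - a), whose excess over 1 + a is
    a^2/(1 - a) <= 2 a^2. *)
Lemma expR_sub1_bound (a : R) : `|a| <= 1 / 2 ->
  0 <= expR a - 1 - a <= a ^+ 2 *+ 2.
Proof.
rewrite ler_norml => /andP[a1 a2]; rewrite subr_ge0.
have := expR_ge1Dx a; have := expR_ge1Dx (- a); rewrite expRN => h1 h2.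
have e0 := expR_gt0 a.
have h3 : (1 - a) * expR a <= 1.
  by rewrite -ler_pdivlMr // mul1r.
apply/andP; split; first lra.
rewrite -mulr_natr; set e := expR a in h2 e0 h3 *.
have : 0 <= a ^+ 2 by exact: sqr_ge0.
nra.
Qed.

(** Euler's formula for e^z. It parametrises the torus by the additive group C and integrates the
    linear equation behind certain flows. *)
Definition cexp (z : C) : C :=
  Complex (expR (complex.Re z) * cos (complex.Im z)) (expR (complex.Re z) * sin (complex.Im z)).

Lemma cexp0 : cexp 0 = 1.
Proof. by rewrite /cexp /= expR0 cos0 sin0 mulr1 mulr0. Qed.

Lemma cexpD z w : cexp (z + w) = cexp z * cexp w.
Proof.
case: z w => [a b] [c d]; apply/eqP; rewrite eq_complex /= expRD cosD sinD.
by apply/andP; split; apply/eqP; ring.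
Qed.

Lemma cexp_neq0 z : cexp z != 0.
Proof.
have : cexp z * cexp (- z) != 0 by rewrite -cexpD subrr cexp0 oner_eq0.
by apply: contraNneq => ->; rewrite mul0r.
Qed.

Lemma norm_complex_le (x y : R) : `|Complex x y| <= (`|x| + `|y|)%:C%C.
Proof.
have [x0 y0] := (normr_ge0 x, normr_ge0 y).
rewrite normc_def lecR /= -(ger0_norm (addr_ge0 x0 y0)) -sqrtr_sqr.
rewrite ler_sqrt ?sqr_ge0 //.
rewrite -(real_normK (num_real x)) -(real_normK (num_real y)); nra.
Qed.

(** For z = a + i b the real and imaginary parts err by at most 2 a^2 + 2 b^2 and 2 a^2 + 4 b^2; the
    constant 8 generously covers the sum. *)
Lemma cexp_quadratic (z : C) : `|z| < (1 / 2)%:C%C ->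
  `|cexp z - 1 - z| <= (8 : R)%:C%C * `|z| ^+ 2.
Proof.
case: z => a b; rewrite -add_Re2_Im2 /= normc_def ltcR /= => hz.
have hz2 : a ^+ 2 + b ^+ 2 <= (1 / 2) ^+ 2.
  rewrite -(@sqr_sqrtr _ (a ^+ 2 + b ^+ 2)) ?addr_ge0 ?sqr_ge0 //.
  rewrite ler_pXn2r ?nnegrE ?sqrtr_ge0 //; [exact: ltW|lra].
have ha : `|a| <= 1 / 2.
  rewrite -(@ler_pXn2r _ 2) ?nnegrE //; last lra.
  by rewrite real_normK ?num_real // (le_trans _ hz2) // lerDl sqr_ge0.
have hb : `|b| <= 1 / 2.
  rewrite -(@ler_pXn2r _ 2) ?nnegrE //; last lra.
  by rewrite real_normK ?num_real // (le_trans _ hz2) // lerDr sqr_ge0.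
have hb1 : `|b| <= 1 by apply: le_trans hb _; lra.
have -> : cexp (Complex a b) - 1 - Complex a b =
   Complex (expR a * cos b - 1 - a) (expR a * sin b - b).
  by apply/eqP; rewrite eq_complex /= subr0 !eqxx.
apply: le_trans (norm_complex_le _ _) _.
rewrite -rmorphM lecR.
have /andP[e1 e2] := expR_sub1_bound ha.
have c1 := cos_sub1_norm_le b; have s1 := sin_subr_norm_le hb1.
have e0 := expR_ge0 a.
move: ha; rewrite ler_norml => /andP[a1 a2].
move: hb; rewrite ler_norml => /andP[b1 b2].
move: c1; rewrite ler_norml => /andP[c1 c2].
move: s1; rewrite ler_norml => /andP[s1 s2].
have e3 : expR a <= 2 by rewrite -mulr_natr in e2; nra.
set e := expR a in e0 e1 e2 e3 *; set c := cos b in c1 c2 *; set s := sin b in s1 s2 *.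
have A2 := sqr_ge0 a; have B2 := sqr_ge0 b.
have AB1 : 0 <= (a - b) ^+ 2 by exact: sqr_ge0.
have AB2 : 0 <= (a + b) ^+ 2 by exact: sqr_ge0.
set A := a ^+ 2 in A2 *; set B := b ^+ 2 in B2 c1 c2 s1 s2 *.
have h1 : `|e * c - 1 - a| <= 2 * A + 2 * B.
  have -> : e * c - 1 - a = (e - 1 - a) + e * (c - 1) by ring.
  apply: le_trans (ler_normD _ _) _; apply: lerD.
    by rewrite ger0_norm // mulrC mulr_natr.
  rewrite normrM (ger0_norm e0) ler_pM // ler_norml; apply/andP; split=> //.
have h2 : `|e * s - b| <= 2 * B + 2 * (A + B).
  have -> : e * s - b = e * (s - b) + b * (e - 1 - a) + b * a by ring.
  apply: le_trans (ler_normD _ _) _; rewrite [2 * (A + B)](_ : _ = (A + B) + (A + B)); last by ring.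
  rewrite addrA; apply: lerD; last first.
    by rewrite ler_norml; apply/andP; split; rewrite /A /B; nra.
  apply: le_trans (ler_normD _ _) _; apply: lerD.
    rewrite normrM (ger0_norm e0) ler_pM // ler_norml; apply/andP; split=> //.
  rewrite normrM (ger0_norm e1).
  have : `|b| <= 1 / 2 by rewrite ler_norml; apply/andP.
  rewrite -mulr_natr -/A in e2.
  have := normr_ge0 b; set bb := `|b|; nra.
lra.
Qed.

Lemma isd_cexp (c t : C) : isd (fun s => cexp (c * s)) t (c * cexp (c * t)).
Proof.
pose K : C := (8 : R)%:C%C * `|cexp (c * t)| * `|c| ^+ 2.
(* This radius ensures |c h| < 1/2; adding 1 to |c| covers c = 0. *)
pose r : C := (1 / 2 : R)%:C%C / (1 + `|c|).
have c1 : 0 < 1 + `|c| by rewrite ltr_pwDl.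
apply: (@isd_quadratic _ _ _ _ K r).
- by rewrite divr_gt0 // ltcR; lra.
- by rewrite /K !mulr_ge0 // ?exprn_ge0 // lecR; lra.
- move=> h hr.
  have -> : cexp (c * (h + t)) - cexp (c * t) - h * (c * cexp (c * t)) =
     cexp (c * t) * (cexp (c * h) - 1 - c * h).
    rewrite mulrDr cexpD; ring.
  have hc : `|c * h| < (1 / 2 : R)%:C%C.
    rewrite normrM; move: hr; rewrite /r ltr_pdivlMr // mulrC; apply: le_lt_trans.
    by rewrite mulrDl mul1r lerDr.
  rewrite normrM /K; have := cexp_quadratic hc; rewrite normrM exprMn => hq.
  apply: le_trans (ler_wpM2l (normr_ge0 _) hq) _.
  by rewrite le_eqVlt (_ : _ == _) //; apply/eqP; ring.
Qed.

End ComplexExponential.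

(** * The coordinate ring and its derivations *)

Section RegularFunctions.
Context {R : realType} {m : nat} {T : Type}.
Local Notation C := R[i].
Variable iota : T -> 'rV[C]_m.
Implicit Types f g : T -> C.

Lemma regular_cst (c : C) : regular iota (fun=> c).
Proof. by exists (mpoly.mpolyC m c) => t; rewrite mpoly.mevalC. Qed.

Lemma regular_coord j : regular iota (fun t => iota t 0 j).
Proof. by exists (mpoly.mpolyX C (mpoly.mnm1 j)) => t; rewrite mpoly.mevalXU. Qed.

Lemma regularD f g : regular iota f -> regular iota g -> regular iota (fun t => f t + g t).
Proof. by move=> [P hP] [Q hQ]; exists (P + Q) => t; rewrite mpoly.mevalD hP hQ. Qed.

Lemma regularM f g : regular iota f -> regular iota g -> regular iota (fun t => f t * g t).
Proof. by move=> [P hP] [Q hQ]; exists (P * Q) => t; rewrite mpoly.mevalM hP hQ. Qed.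

Lemma regular_ext f g : (forall t, f t = g t) -> regular iota f -> regular iota g.
Proof. by move=> fg [P hP]; exists P => t; rewrite -fg. Qed.

Lemma regular_meval k (P : mpoly.mpoly k C) (g : 'I_k -> T -> C) :
  (forall j, regular iota (g j)) ->
  regular iota (fun t => mpoly.meval (fun j => g j t) P).
Proof.
move=> /choice[Q hQ].
exists (mpoly.comp_mpoly [tuple Q j | j < k] P) => t.
rewrite mpoly.comp_mpoly_meval; apply: mpoly.meval_eq => j.
by rewrite tnth_mktuple hQ.
Qed.

Lemma regular_comp k (T' : Type) (iota' : T' -> 'rV[C]_k) (g : T' -> C) (phi : T -> T') :
  regular iota' g -> (forall j, regular iota (fun t => iota' (phi t) 0 j)) ->
  regular iota (fun t => g (phi t)).
Proof.
move=> [P hP] h; apply: regular_ext (regular_meval P h) => t.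
by rewrite hP.
Qed.

End RegularFunctions.

Section Coordinates.
Context {R : realType} {n : nat} {M : set 'rV[R[i]]_n}.
Local Notation C := R[i].
Local Notation CM := (coord_ring M).
Implicit Types (f g h : CM) (V W : CM -> CM) (x y : M).

Lemma regular_funP f : regular (val : M -> 'rV[C]_n) f.
Proof. by case: f => f hf; apply/asboolP. Qed.

Lemma cm_ext f g : (forall x, f x = g x) -> f = g.
Proof. by move=> fg; apply: val_inj; apply/funext. Qed.

Lemma cmD f g x : (f + g) x = f x + g x. Proof. by []. Qed.
Lemma cmN f x : (- f) x = - f x. Proof. by []. Qed.
Lemma cmM f g x : (f * g) x = f x * g x. Proof. by []. Qed.
Lemma cmZ c f x : (c *: f) x = c * f x. Proof. by []. Qed.
Lemma cm0 x : (0 : CM) x = 0. Proof. by []. Qed.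
Lemma cm1 x : (1 : CM) x = 1. Proof. by []. Qed.
Lemma cmMn f k x : (f *+ k) x = f x *+ k.
Proof. by elim: k => [|k IH]; rewrite ?mulr0n // !mulrS cmD IH. Qed.
Lemma cmX f k x : (f ^+ k) x = f x ^+ k.
Proof. by elim: k => [|k IH]; rewrite ?expr0 // !exprS cmM IH. Qed.
Lemma cm_sum (I : Type) (r : seq I) (P : pred I) (F : I -> CM) x :
  (\sum_(i <- r | P i) F i) x = \sum_(i <- r | P i) F i x.
Proof. by elim/big_rec2: _ => // i y1 y2 _ <-. Qed.

Definition cmE := (cmD, cmN, cmM, cmZ, cm0, cm1, cmMn, cmX, cm_sum).

(** A function that is not regular is sent to 0; regularity is asked for only in [cm_ofE]. *)
Definition cm_of (F : M -> C) : CM := insubd (0 : CM) F.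

Lemma cm_ofE (F : M -> C) x : regular val F -> cm_of F x = F x.
Proof.
move=> hF; rewrite /cm_of -[LHS]/(val (insubd (0 : CM) F) x) val_insubd.
by rewrite ifT //; apply/asboolP.
Qed.

Definition coordf (j : 'I_n) : CM := cm_of (fun x => val x 0 j).

Lemma coordfE j x : coordf j x = val x 0 j.
Proof. by rewrite cm_ofE //; exact: (regular_coord (val : M -> 'rV[C]_n)). Qed.

Lemma point_ext x y : (forall f, f x = f y) -> x = y.
Proof.
move=> h; apply: val_inj; apply/rowP => j.
by rewrite -!coordfE h.
Qed.

(** M lies in the union of the zero loci of two polynomials representing [f] and [g], hence in one
    of them. *)
Lemma cm_mul_eq0 f g : irreducible M -> f * g = 0 -> f = 0 \/ g = 0.
Proof.
move=> [_ irr] fg0.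
have [P hP] := regular_funP f; have [Q hQ] := regular_funP g.
have [] := irr (zero_locus [set P]) (zero_locus [set Q]).
- by exists [set P].
- by exists [set Q].
- move=> z Mz; pose x : M := exist _ z (mem_set Mz).
  have : f x * g x = 0 by rewrite -cmM fg0.
  move/eqP; rewrite mulf_eq0 => /orP[/eqP e|/eqP e]; [left|right] => _ /= ->.
    by rewrite -e hP.
  by rewrite -e hQ.
- move=> h; left; apply: cm_ext => x; rewrite hP; apply: (h (val x)) => //.
  exact/set_mem/(valP x).
- move=> h; right; apply: cm_ext => x; rewrite hQ; apply: (h (val x)) => //.
  exact/set_mem/(valP x).
Qed.

Section Derivation.
Variable V : CM -> CM.
Hypothesis hV : vector_field V.

Lemma vfD f g : V (f + g) = V f + V g.
Proof. by case: hV => h _; have := h 1 f g; rewrite !scale1r. Qed.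
Lemma vf0 : V 0 = 0.
Proof. by have := vfD 0 0; rewrite addr0 => /eqP; rewrite -subr_eq0 opprD addrA subrr sub0r oppr_eq0 => /eqP. Qed.
Lemma vfZ c f : V (c *: f) = c *: V f.
Proof. by case: hV => h _; have := h c f 0; rewrite !addr0 vf0 addr0. Qed.
Lemma vfN f : V (- f) = - V f.
Proof. by rewrite -scaleN1r vfZ scaleN1r. Qed.
Lemma vfB f g : V (f - g) = V f - V g.
Proof. by rewrite vfD vfN. Qed.
Lemma vfM f g : V (f * g) = V f * g + f * V g.
Proof. by case: hV => _; exact. Qed.
Lemma vfMn f k : V (f *+ k) = V f *+ k.
Proof. by elim: k => [|k IH]; rewrite ?mulr0n ?vf0 // !mulrS vfD IH. Qed.
Lemma vf1 : V 1 = 0.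
Proof.
have := vfM 1 1; rewrite !mulr1 mul1r => /eqP.
by rewrite -subr_eq0 opprD addrA subrr sub0r oppr_eq0 => /eqP.
Qed.
Lemma vf_sum (I : Type) (r : seq I) (P : pred I) (F : I -> CM) :
  V (\sum_(i <- r | P i) F i) = \sum_(i <- r | P i) V (F i).
Proof. by elim/big_rec2: _ => [|i y1 y2 _ <-]; rewrite ?vf0 ?vfD. Qed.

End Derivation.

Definition vfE V (hV : vector_field V) :=
  (vfD hV, vfN hV, vfM hV, vfMn hV, vf0 hV, vf1 hV, vfZ hV, vf_sum hV).

Lemma vector_field_ext V W : vector_field V -> vector_field W ->
  (forall j, V (coordf j) = W (coordf j)) -> V = W.
Proof.
move=> hV hW VW; apply/funext => f.
pose ev P : CM := cm_of (fun x => mpoly.meval (val x 0) P).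
have evE P x : ev P x = mpoly.meval (val x 0) P by apply: cm_ofE; exists P.
have [P hP] := regular_funP f.
have -> : f = ev P by apply: cm_ext => x; rewrite hP evE.
have evD p q : ev (p + q) = ev p + ev q.
  by apply: cm_ext => x; rewrite cmE !evE mpoly.mevalD.
have evM p q : ev (p * q) = ev p * ev q.
  by apply: cm_ext => x; rewrite cmE !evE mpoly.mevalM.
have evC c : ev (mpoly.mpolyC n c) = c *: (1 : CM).
  by apply: cm_ext => x; rewrite cmE !evE mpoly.mevalC mulr1.
have VC c : V (ev (mpoly.mpolyC n c)) = W (ev (mpoly.mpolyC n c)).
  by rewrite evC (vfZ hV) (vfZ hW) (vf1 hV) (vf1 hW).
have VM p q : V (ev p) = W (ev p) -> V (ev q) = W (ev q) -> V (ev (p * q)) = W (ev (p * q)).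
  by rewrite evM (vfM hV) (vfM hW) => -> ->.
have VX mm : V (ev (mpoly.mpolyX C mm)) = W (ev (mpoly.mpolyX C mm)).
  rewrite mpoly.mpolyXE_id; elim/big_ind: _ => [|p q|i _]; first exact: (VC 1).
    exact: VM.
  elim: (mm i) => [|k IH]; rewrite ?expr0 ?exprS; first exact: (VC 1).
  apply: VM => //; rewrite (_ : ev _ = coordf i) //.
  by apply: cm_ext => x; rewrite evE mpoly.mevalXU coordfE.
elim/mpoly.mpolyind: P {hP} => [|c mm p _ _ IH].
  by have := VC 0; rewrite mpoly.mpolyC0.
by rewrite evD (vfD hV) (vfD hW) IH -mpoly.mul_mpolyC (VM _ _ (VC c) (VX mm)).
Qed.

Definition fmul f V : CM -> CM := fun h => f * V h.

Lemma vector_field0 : vector_field (0 : CM -> CM).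
Proof. by split=> [c f g|f g] /=; rewrite ?scaler0 ?addr0 ?mul0r ?mulr0 ?addr0. Qed.

Lemma vector_field_lin c V W : vector_field V -> vector_field W -> vector_field (c *: V + W).
Proof.
move=> hV hW; split=> [a f g|f g].
  rewrite !fctE !(vfE hV, vfE hW); apply: cm_ext => x; rewrite !cmE; ring.
rewrite !fctE !(vfE hV, vfE hW); apply: cm_ext => x; rewrite !cmE; ring.
Qed.

Lemma vector_field_bracket V W : vector_field V -> vector_field W ->
  vector_field (lie_bracket V W).
Proof.
move=> hV hW; rewrite /lie_bracket; split=> [a f g|f g].
  rewrite !(vfE hV, vfE hW); apply: cm_ext => x; rewrite !cmE; ring.
rewrite !(vfE hV, vfE hW); ring.
Qed.

Lemma vector_field_fmul f V : vector_field V -> vector_field (fmul f V).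
Proof.
move=> hV; rewrite /fmul; split=> [a g h|g h].
  rewrite !(vfE hV); apply: cm_ext => x; rewrite !cmE; ring.
rewrite !(vfE hV); ring.
Qed.

Section LieSubalgebra.
Variable L : set (CM -> CM).
Hypothesis hL : lie_subalgebra L.

Lemma lie_vf V : L V -> vector_field V. Proof. by case: hL => h _ _ _; exact: h. Qed.
Lemma lieD V W : L V -> L W -> L (fun h => V h + W h).
Proof.
case: hL => _ _ h _ hV hW; have := h 1 V W hV hW.
by congr L; apply/funext => f; rewrite !fctE scale1r.
Qed.
Lemma lieZ c V : L V -> L (fun h => c *: V h).
Proof.
case: hL => _ h0 h _ hV; have := h c V 0 hV h0.
by congr L; apply/funext => f; rewrite !fctE addr0.
Qed.
Lemma lie_br V W : L V -> L W -> L (fun h => V (W h) - W (V h)).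
Proof. by case: hL => _ _ _; exact. Qed.
Lemma lie_ext V W : L V -> (forall h, W h = V h) -> L W.
Proof. by move=> hV e; rewrite (_ : W = V) //; apply/funext. Qed.
Lemma lie0 : L (fun=> 0). Proof. by case: hL. Qed.
Lemma lie_sum (I : Type) (r : seq I) (F : I -> CM -> CM) :
  (forall i, L (F i)) -> L (fun h => \sum_(i <- r) F i h).
Proof.
move=> hF; elim: r => [|i r IH].
  by apply: lie_ext lie0 _ => h; rewrite big_nil.
by apply: lie_ext (lieD (hF i) IH) _ => h; rewrite big_cons.
Qed.

End LieSubalgebra.

End Coordinates.

(** * Weights and Lie brackets for sl_2 *)

Section EigenDecomposition.
Context {R : realType} {n : nat} {M : set 'rV[R[i]]_n}.
Local Notation C := R[i].
Local Notation CM := (coord_ring M).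
Variables (T : CM -> CM) (c : nat -> C) (Q : set CM).
Hypothesis TD : forall f g, T (f + g) = T f + T g.
Hypothesis TZ : forall a f, T (a *: f) = a *: T f.
Hypothesis Q0 : Q 0.
Hypothesis QD : forall f g, Q f -> Q g -> Q (f + g).
Hypothesis QZ : forall a f, Q f -> Q (a *: f).
Hypothesis QT : forall f, Q f -> Q (T f).
Hypothesis c_inj : injective c.

(** The product of the commuting operators T - c_l, l < N, applied to [f]. *)
Fixpoint char_prod (N : nat) (f : CM) : CM :=
  if N is N'.+1 then char_prod N' (T f - c N' *: f) else f.

(** Induction on N: decompose T f - c_N f and divide its l-th component by c_l - c_N; what these
    quotients leave of f is an eigenvector for c_N. [Q] is a T-stable subspace, later a weight
    space. *)
Lemma eigen_decomposition N f : Q f -> char_prod N f = 0 ->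
  exists2 g : nat -> CM, f = \sum_(l < N) g l &
    forall l, (l < N)%N -> Q (g l) /\ T (g l) = c l *: g l.
Proof.
have T0 : T 0 = 0 by rewrite -(scale0r (0 : CM)) TZ !scale0r.
have TS (I : Type) (r : seq I) (F : I -> CM) : T (\sum_(i <- r) F i) = \sum_(i <- r) T (F i).
  by elim/big_rec2: _ => // i y1 y2 _ <-.
have QS (k : nat) (F : 'I_k -> CM) : (forall i, Q (F i)) -> Q (\sum_(i < k) F i).
  by move=> h; elim/big_ind: _ => // i _; exact: h.
elim: N f => [|N IH] f Qf /=.
  by move=> f0; exists (fun=> 0) => //; rewrite big_ord0.
have Qh : Q (T f - c N *: f).
  by rewrite -scaleNr; apply: QD; [exact: QT|exact: QZ].
move=> /(IH _ Qh)[g hE hg].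
pose g1 l := (c l - c N)^-1 *: g l.
have cN l : (l < N)%N -> c l - c N != 0.
  by move=> lN; rewrite subr_eq0; apply: contraTneq lN => /c_inj ->; rewrite ltnn.
have Qg1 l : (l < N)%N -> Q (g1 l) by move=> /hg[h _]; exact: QZ.
have Tg1 l : (l < N)%N -> T (g1 l) = c l *: g1 l.
  by move=> /hg[_ h]; rewrite /g1 TZ h !scalerA mulrC.
pose gN := f - \sum_(l < N) g1 l.
have QgN : Q gN.
  by apply: QD => //; rewrite -scaleN1r; apply: QZ; apply: QS => i; exact: Qg1.
have TgN : T gN = c N *: gN.
  apply/eqP; rewrite -subr_eq0 /gN TD -scaleN1r TZ TS scalerDr scaleN1r.
  have -> : T f = \sum_(l < N) g l + c N *: f by rewrite -hE subrK.
  rewrite scalerN opprD opprK addrACA [_ + c N *: f - _]addrAC.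
  apply/eqP; apply: cm_ext => x; rewrite !cmE.
  have -> : (\sum_(l < N) g l x) = \sum_(l < N) (c l - c N) * g1 l x.
    apply: eq_bigr => l _; rewrite /g1 cmE mulrA mulfV ?mul1r //.
    by rewrite cN.
  have -> : \sum_(i < N) (T (g1 i)) x = \sum_(l < N) c l * g1 l x.
    by apply: eq_bigr => l _; rewrite Tg1.
  have -> : \sum_(l < N) (c l - c N) * g1 l x =
    \sum_(l < N) c l * g1 l x - c N * \sum_(l < N) g1 l x.
    by rewrite mulr_sumr -sumrB; apply: eq_bigr => l _; rewrite mulrBl.
  ring.
exists (fun l => if (l < N)%N then g1 l else gN).
  rewrite big_ord_recr /= ltnn /gN.
  rewrite (eq_bigr (fun l : 'I_N => g1 l)) => [|l _]; last by rewrite ltn_ord.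
  by rewrite addrC subrK.
move=> l; rewrite ltnS; case: ltnP => [lN _|Nl lN]; first by split; auto.
by have -> : l = N by apply/eqP; rewrite eqn_leq lN.
Qed.

End EigenDecomposition.

(** * Strings for sl_2 acting by derivations *)

Section SL2Fields.
Context {R : realType} {n : nat} {M : set 'rV[R[i]]_n}.
Local Notation C := R[i].
Local Notation CM := (coord_ring M).
Implicit Types (f g h a : CM).

Record sl2_fields (D U E : CM -> CM) : Prop := Sl2Fields {
  sl2_D : vector_field D;
  sl2_U : vector_field U;
  sl2_E : vector_field E;
  sl2_DU : forall f, D (U f) - U (D f) = E f;
  sl2_ED : forall f, E (D f) - D (E f) = 2 *: D f;
  sl2_EU : forall f, E (U f) - U (E f) = - 2 *: U f;
  sl2_nilD : forall f, exists N, iter N D f = 0;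
  sl2_nilU : forall f, exists N, iter N U f = 0 }.

(** The Weyl symmetry: root vectors are exchanged and weights negated. It yields the statements for
    U and for negative weights. *)
Lemma sl2_fields_swap D U E : sl2_fields D U E -> sl2_fields U D (fun f => - E f).
Proof.
move=> [hD hU hE DU ED EU nD nU]; split => //.
- split=> [c f g|f g]; rewrite !(vfE hE); apply: cm_ext => x; rewrite !cmE; ring.
- by move=> f; rewrite -DU opprB.
- move=> f; rewrite !(vfE hU) -opprD EU; apply: cm_ext => x; rewrite !cmE; ring.
- move=> f; rewrite !(vfE hD) -opprD ED; apply: cm_ext => x; rewrite !cmE; ring.
Qed.

Section Ladder.
Variables (D U E : CM -> CM).
Hypothesis H : sl2_fields D U E.
Let hD := sl2_D H.
Let hU := sl2_U H.
Let hE := sl2_E H.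

Lemma sl2_E_iterD k f N : E f = k *: f -> E (iter N D f) = (k + N%:R * 2) *: iter N D f.
Proof.
move=> Ef; elim: N => [|N IH] /=; first by rewrite mul0r addr0.
have := sl2_ED H (iter N D f); rewrite IH !(vfE hD) => /eqP; rewrite subr_eq => /eqP ->.
apply: cm_ext => x; rewrite !cmE -natr1; ring.
Qed.

Lemma sl2_UD f : U (D f) = D (U f) - E f.
Proof. by rewrite -(sl2_DU H) subKr. Qed.

(** The sum of the weights k + 2 j for 1 <= j <= N: the eigenvalue of U D on a vector of weight k
    that lies N steps below the top of its string. *)
Definition ladder_coef (k : C) (N : nat) : C := N%:R * (k + N%:R + 1).

Lemma sl2_U_iterD k f N : E f = k *: f ->
  U (iter N.+1 D f) = iter N D (U (D f)) - ladder_coef k N *: iter N D f.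
Proof.
move=> Ef; elim: N => [|N IH]; first by rewrite /ladder_coef mul0r scale0r subr0.
rewrite iterS sl2_UD IH (sl2_E_iterD _ Ef) !(vfE hD).
rewrite -!iterS; apply: cm_ext => x; rewrite !cmE /ladder_coef -!natr1; ring.
Qed.

(** By [sl2_U_iterD], D^N (U D - [ladder_coef k N]) equals U D^(N+1) on weight k. Since D is locally
    nilpotent, the product kills f for large N, and f is a sum of eigenvectors of U D. *)
Lemma sl2_char_prod k f N : E f = k *: f ->
  char_prod (fun f => U (D f)) (ladder_coef k) N f = iter N U (iter N D f).
Proof.
elim: N f => [//|N IH] f Ef.
have iD j : iter N D (U (D f) - j *: f) = iter N D (U (D f)) - j *: iter N D f.
  by elim: N {IH} => //= N ->; rewrite !(vfE hD).
rewrite /= IH; last first.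
  rewrite !(vfE hE).
  have := sl2_EU H (D f); have := sl2_ED H f; rewrite Ef !(vfE hD).
  move=> /eqP; rewrite subr_eq => /eqP ->; rewrite !(vfE hU).
  move=> /eqP; rewrite subr_eq => /eqP ->.
  apply: cm_ext => x; rewrite !cmE; ring.
rewrite iD -iterS iterSr -(sl2_U_iterD _ Ef); by rewrite -iterSr.
Qed.

End Ladder.

End SL2Fields.

(** * Brackets along a string through weight 0 *)

Section SL2LieAlgebra.
Context {R : realType} {n : nat} {M : set 'rV[R[i]]_n}.
Local Notation C := R[i].
Local Notation CM := (coord_ring M).
Implicit Types (f g h a : CM).

Variable L : set (CM -> CM).
Hypothesis hL : lie_subalgebra L.

(** Stated for an abstract [L] and without reference to an action, so that the symmetry exchanging D
    and U applies. *)
Record sl2_complete (D U E : CM -> CM) : Prop := Sl2Complete {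
  sl2c_fields : sl2_fields D U E;
  sl2c_D : forall h, D (D h) = 0 -> L (fmul h D);
  sl2c_U : forall h, U (U h) = 0 -> L (fmul h U);
  sl2c_E : forall h, E h = 0 -> L (fmul h E) }.

Lemma sl2_complete_swap D U E : sl2_complete D U E -> sl2_complete U D (fun f => - E f).
Proof.
move=> [H hD hU hE]; split => //; first exact: sl2_fields_swap.
move=> h /eqP; rewrite oppr_eq0 => /eqP /hE hh.
by apply: lie_ext (lieZ hL (-1) hh) _ => f; rewrite /fmul scaleN1r mulrN.
Qed.

Section Weights.
Variables (D U E : CM -> CM).
Hypothesis H : sl2_complete D U E.
Let Hf := sl2c_fields H.
Let hD := sl2_D Hf.
Let hU := sl2_U Hf.
Let hE := sl2_E Hf.

Lemma sl2_LD : L D.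
Proof.
apply: lie_ext (sl2c_D H (_ : D (D 1) = 0)) _; first by rewrite (vf1 hD) (vf0 hD).
by move=> h; rewrite /fmul mul1r.
Qed.

Lemma sl2_LU : L U.
Proof.
apply: lie_ext (sl2c_U H (_ : U (U 1) = 0)) _; first by rewrite (vf1 hU) (vf0 hU).
by move=> h; rewrite /fmul mul1r.
Qed.

(* Iterating ad U, with [U, D] = - E, [U, E] = 2 U. *)
Lemma sl2_adU_iter h i : L (fmul h D) ->
  L (fun x => iter i.+1 U h * D x - (i.+1%:R : C) *: (iter i U h * E x)
              - (i.+1%:R * i%:R : C) *: (iter i.-1 U h * U x)).
Proof.
move=> hh; elim: i => [|i IH].
  apply: lie_ext (lie_br hL sl2_LU hh) _ => x; rewrite /fmul /= (vfE hU) (sl2_UD Hf).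
  apply: cm_ext => y; rewrite !cmE; ring.
apply: lie_ext (lie_br hL sl2_LU IH) _ => x.
have eU : U (E x) = E (U x) + 2 *: U x.
  by have /eqP := sl2_EU Hf x; rewrite subr_eq => /eqP ->; rewrite addrAC scaleNr addNr add0r.
(* At i = 0 the truncated predecessor would give the wrong iterate, but there the coefficient
   vanishes. *)
have iU : (i%:R : C) *: iter i U h = (i%:R : C) *: U (iter i.-1 U h).
  by case: (i) => [|j] //=; rewrite !scale0r.
have {}iU y : (i%:R : C) * (iter i U h) y = (i%:R : C) * (U (iter i.-1 U h)) y.
  by rewrite -!cmZ iU.
rewrite !(vfE hU) (sl2_UD Hf) eU /=; apply: cm_ext => y; rewrite !cmE.
have := iU y; set p := _ * (iter i U h) y; rewrite /p {p}.
rewrite -[i.+2%:R]natr1 -![i.+1%:R]natr1 /=.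
set a0 := U (iter i U h) y; set a1 := iter i U h y; set a2 := (U (iter i.-1 U h)) y.
set I : C := i%:R => e.
set r := (U (U (iter i U h))) y; set d := D x y; set u := U x y.
set ee := E x y; set eu := E (U x) y; set uu := U (U x) y; set dd := D (U x) y.
set a3 := (iter i.-1 U h) y.
transitivity (r * d + a0 * (dd - ee) - (I + 1) * (a0 * ee + a1 * (eu + 2 * u)) -
  (I + 1) * ((I * a1) * u + I * (a3 * uu)) - (a0 * dd - (I + 1) * (a1 * eu) - (I + 1) * I * (a3 * uu))).
  ring.
rewrite e; ring.
Qed.

(** Let a be the top of the string of f. The fields a D and (U a) D are in [L]; lowering both by
    powers of ad U gives two combinations of (U f) D, f E and (D f) U. Together with f E they
    determine (U f) D, and a bracket with D turns this into c f D. *)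
Lemma sl2_eigen_fD f c : E f = 0 -> U (D f) = c *: f -> L (fmul f D).
Proof.
move=> Ef UDf.
have [->|f0] := eqVneq f 0.
  by apply: lie_ext (lie0 hL) _ => h; rewrite /fmul mul0r.
have Ef0 : E f = (0 : C) *: f by rewrite scale0r.
pose cc := ladder_coef (0 : C).
have ccE k : cc k = k%:R * (k%:R + 1) by rewrite /cc /ladder_coef add0r.
have iDZ N (a : C) g : iter N D (a *: g) = a *: iter N D g.
  by elim: N => //= N ->; rewrite (vfE hD).
have lad N : U (iter N.+1 D f) = (c - cc N) *: iter N D f.
  by rewrite (sl2_U_iterD Hf _ Ef0) UDf iDZ scalerBl.
have [k Dk0 Dk] : exists2 k, iter k D f != 0 & iter k.+1 D f = 0.
  have [N hN] := sl2_nilD Hf f.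
  have ex : exists N, iter N D f == 0 by exists N; apply/eqP.
  case: (ex_minnP ex) => [[|k]] /eqP hk km; first by rewrite (hk : f = 0) eqxx in f0.
  exists k => //; apply/negP => /km; by rewrite ltnn.
(* U D^(k+1) f = 0 while D^k f is nonzero, which forces this eigenvalue. *)
have ck : c = cc k.
  have := lad k; rewrite Dk (vf0 hU) => /esym/eqP; rewrite scaler_eq0 (negPf Dk0) orbF subr_eq0.
  by move/eqP.
(* If D f = 0, then f D is given. Otherwise the index is shifted and the top is D^(k+1) f. *)
case: k Dk0 Dk ck => [|k] Dk0 Dk ck.
  by apply: (sl2c_D H); rewrite /= in Dk; rewrite Dk (vf0 hD).
set a := iter k.+1 D f in Dk0 *.
have Da : D a = 0 by [].
have DUa : D (D (U a)) = 0.
  have := sl2_DU Hf a; rewrite Da (vf0 hU) subr0 => ->.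
  by rewrite (sl2_E_iterD Hf _ Ef0) (vfE hD) -/a Da scaler0.
have cinj i j : (i < j)%N -> cc j - cc i != 0.
  move=> ij; rewrite !ccE.
  have -> : (j%:R * (j%:R + 1) - i%:R * (i%:R + 1) : C) = (j%:R - i%:R) * (j%:R + i%:R + 1).
    by ring.
  rewrite mulf_eq0 negb_or -natrB 1?ltnW // -natrD natr1 !pnatr_eq0.
  by rewrite subn_eq0 -ltnNge ij.
(* Descending from the top, the i-th step contributes the factor c - cc (k - i), nonzero by
   [cinj]. *)
have [g g0 ga] : exists2 g : C, g != 0 & iter k U a = g *: D f.
  have : forall i, (i <= k)%N -> exists2 g : C, g != 0 & iter i U a = g *: iter (k.+1 - i) D f.
    elim=> [|i IH] ik; first by exists 1; rewrite ?oner_eq0 // scale1r subn0.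
    have [g g0 hg] := IH (ltnW ik).
    exists (g * (c - cc (k - i)%N)).
      by rewrite mulf_neq0 // ck cinj // ltnS leq_subr.
    by rewrite iterS hg (vfE hU) subSn 1?ltnW // lad scalerA subSS.
  by move/(_ k (leqnn k)); rewrite subSnn.
have gUa : iter k.+1 U a = (g * c) *: f by rewrite iterS ga (vfE hU) UDf scalerA.
have gUUa : iter k.+2 U a = (g * c) *: U f by rewrite iterS gUa (vfE hU).
have k0 : (k.+1%:R : C) != 0 by rewrite pnatr_eq0.
have k1 : (k.+2%:R : C) != 0 by rewrite pnatr_eq0.
have LaD : L (fmul a D) by apply: (sl2c_D H); rewrite Da (vf0 hD).
have R2 := sl2_adU_iter k.+1 LaD.
have R3 := sl2_adU_iter k (sl2c_D H DUa).
rewrite gUUa gUa /= ga in R2.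
have R3' : L (fun x => (g * c) *: (U f * D x) - ((k.+1%:R : C) * (g * c)) *: (f * E x) -
        (k.+1%:R * k%:R * g : C) *: (D f * U x)).
  have e1 : iter k.+1 U (U a) = (g * c) *: U f by rewrite -iterSr.
  have e2 : iter k U (U a) = (g * c) *: f by rewrite -iterSr.
  apply: lie_ext R3 _ => x; rewrite e1 e2.
  apply: cm_ext => y; rewrite !cmE.
  have -> : (k.+1%:R * k%:R : C) * (iter k.-1 U (U a) y * U x y) =
            (k.+1%:R * k%:R * g : C) * (D f y * U x y).
    case: (k) ga => [|k'] /= e; first by rewrite mulr0 !mul0r.
    by rewrite -iterSr /= e cmE; ring.
  ring.
have LfE := sl2c_E H Ef.
(* The coefficients k + 2 and - k cancel the terms in (D f) U; what remains in f E is compensated by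
   f E itself. *)
have LX : L (fmul (U f) D).
  apply: lie_ext (lieD hL (lieD hL (lieZ hL ((k.+2%:R) / (2 * g * c)) R3')
     (lieZ hL (- (k%:R) / (2 * g * c)) R2)) (lieZ hL (k.+2%:R / 2) LfE)) _ => x; apply: cm_ext => y; rewrite /fmul !cmE.
  have c0 : c != 0 by rewrite ck ccE natr1 mulf_neq0.
  rewrite ck ccE !natr1 in c0 *.
  rewrite -[k.+2%:R]natr1 -![k.+1%:R]natr1 in k0 k1 c0 *.
  field.
  by rewrite k0 g0 k1.
(* [D, (U f) D] = D(U f) D, and D(U f) = U(D f) = c f in weight 0. *)
apply: lie_ext (lieZ hL (c^-1) (lie_br hL sl2_LD LX)) _ => x.
have c0 : c != 0 by rewrite ck ccE natr1 mulf_neq0.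
rewrite /fmul (vfE hD).
have := sl2_DU Hf f; rewrite Ef UDf => /eqP; rewrite subr_eq0 => /eqP ->.
by apply: cm_ext => y; rewrite !cmE; field.
Qed.

End Weights.

End SL2LieAlgebra.

(** * All even weights, and a nonzero submodule *)

Section SL2LieAlgebra.
Context {R : realType} {n : nat} {M : set 'rV[R[i]]_n}.
Local Notation C := R[i].
Local Notation CM := (coord_ring M).
Implicit Types (f g h a : CM).

(** For natural k the values N (k + N + 1) increase with N. For negative k they may coincide, so
    negative weights are left to the symmetry. *)
Lemma ladder_coef_inj (k : nat) : injective (ladder_coef (k%:R : C)).
Proof.
move=> i j; rewrite /ladder_coef -!natrD !natr1 -!natrM => /eqP.
rewrite eqr_nat => /eqP; nia.
Qed.

Lemma sl2_eigen_sum D U E (H : sl2_fields D U E) (k : nat) f : E f = (k%:R : C) *: f ->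
  exists N, exists2 g : nat -> CM, f = \sum_(l < N) g l &
    forall l, (l < N)%N -> E (g l) = (k%:R : C) *: g l /\
      U (D (g l)) = ladder_coef (k%:R : C) l *: g l.
Proof.
have [[hD hU] hE] := (sl2_D H, sl2_U H, sl2_E H).
move=> Ef; have [N hN] := sl2_nilD H f; exists N.
apply: (@eigen_decomposition _ _ _ (fun f => U (D f)) (ladder_coef (k%:R : C))
   [set f | E f = (k%:R : C) *: f]) => //=.
- by move=> p q; rewrite (vfD hD) (vfD hU).
- by move=> p q; rewrite (vfZ hD) (vfZ hU).
- by rewrite (vf0 hE) scaler0.
- by move=> p q hp hq; rewrite (vfD hE) hp hq scalerDr.
- by move=> p q hq; rewrite (vfZ hE) hq !scalerA mulrC.
- move=> p hp; have := sl2_EU H (D p); have := sl2_ED H p; rewrite hp !(vfE hD).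
  move=> /eqP; rewrite subr_eq => /eqP ->; rewrite !(vfE hU).
  move=> /eqP; rewrite subr_eq => /eqP ->.
  apply: cm_ext => x; rewrite !cmE; ring.
- exact: ladder_coef_inj.
- have iU0 j : iter j U 0 = 0 by elim: j => //= j ->; rewrite (vf0 hU).
  by rewrite (sl2_char_prod H _ Ef) hN iU0.
Qed.

Variable L : set (CM -> CM).
Hypothesis hL : lie_subalgebra L.

Lemma fmul_sum (I : Type) (r : seq I) (F : I -> CM) (V : CM -> CM) :
  (forall i, L (fmul (F i) V)) -> L (fmul (\sum_(i <- r) F i) V).
Proof.
move=> h; apply: lie_ext (lie_sum hL r h) _ => x.
by rewrite /fmul mulr_suml.
Qed.

Lemma sl2_wt0_fD D U E (H : sl2_complete L D U E) f : E f = 0 -> L (fmul f D).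
Proof.
move=> Ef; have Ef0 : E f = (0%:R : C) *: f by rewrite scale0r.
have [N [g -> hg]] := sl2_eigen_sum (sl2c_fields H) Ef0.
apply: fmul_sum => l; have [Eg UDg] := hg l (ltn_ord l).
by apply: (sl2_eigen_fD hL H _ UDg); rewrite Eg scale0r.
Qed.

Definition sl2_span D U E : set CM :=
  [set f | [/\ L (fmul f D), L (fmul f U) & L (fmul f E)]].

Section Weights.
Variables (D U E : CM -> CM).
Hypothesis H : sl2_complete L D U E.
Let Hf := sl2c_fields H.
Let hD := sl2_D Hf.
Let hU := sl2_U Hf.
Let hE := sl2_E Hf.

Lemma sl2_span_wt0 f : E f = 0 -> sl2_span D U E f.
Proof.
move=> Ef; split; first exact: sl2_wt0_fD H _ Ef.
  by apply: (sl2_wt0_fD (sl2_complete_swap hL H)); rewrite Ef oppr0.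
exact: sl2c_E H _ Ef.
Qed.

(** The bracket with D differentiates the coefficient, up to multiples of f E or f D that are
    already in [L]. *)
Lemma sl2_span_D f : sl2_span D U E f -> sl2_span D U E (D f).
Proof.
move=> [h1 h2 h3]; have LD := sl2_LD H; split.
- apply: lie_ext (lie_br hL LD h1) _ => x; rewrite /fmul !(vfE hD); ring.
- apply: lie_ext (lieD hL (lie_br hL LD h2) (lieZ hL (-1) h3)) _ => x.
  rewrite /fmul !(vfE hD) (sl2_UD Hf); apply: cm_ext => y; rewrite !cmE; ring.
- apply: lie_ext (lieD hL (lie_br hL LD h3) (lieZ hL 2 h1)) _ => x.
  rewrite /fmul !(vfE hD).
  have /eqP := sl2_ED Hf x; rewrite subr_eq => /eqP ->.
  apply: cm_ext => y; rewrite !cmE; ring.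
Qed.

Lemma sl2_span_Z c f : sl2_span D U E f -> sl2_span D U E (c *: f).
Proof.
by move=> [h1 h2 h3]; split; [apply: lie_ext (lieZ hL c h1) _|
  apply: lie_ext (lieZ hL c h2) _|apply: lie_ext (lieZ hL c h3) _] => x;
  apply: cm_ext => y; rewrite /fmul !cmE mulrA.
Qed.

Lemma sl2_span_sum (I : Type) (r : seq I) (F : I -> CM) :
  (forall i, sl2_span D U E (F i)) -> sl2_span D U E (\sum_(i <- r) F i).
Proof. by move=> h; split; apply: fmul_sum => i; case: (h i). Qed.

(** An eigenvector g of U D of weight k > 0 is recovered from U g, of weight k - 2, since D(U g) = c
    g where c is nonzero by positivity of k. *)
Lemma sl2_span_even_pos (j : nat) f : E f = ((j.*2)%:R : C) *: f -> sl2_span D U E f.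
Proof.
elim: j f => [|j IH] f Ef; first by apply: sl2_span_wt0; rewrite Ef scale0r.
have [N [g -> hg]] := sl2_eigen_sum Hf Ef.
apply: sl2_span_sum => l; have [Eg UDg] := hg l (ltn_ord l).
set k : C := (j.+1).*2%:R in Eg UDg *.
pose c := ladder_coef k l + k.
have DUg : D (U (g l)) = c *: g l.
  have /eqP := sl2_DU Hf (g l); rewrite subr_eq => /eqP ->.
  by rewrite Eg UDg addrC -scalerDl.
have c0 : c != 0.
  by rewrite /c /ladder_coef /k -!natrD natr1 -natrM -natrD pnatr_eq0 addnC.
have EUg : E (U (g l)) = ((j.*2)%:R : C) *: U (g l).
  have /eqP := sl2_EU Hf (g l); rewrite subr_eq Eg (vfE hU) => /eqP ->.
  apply: cm_ext => y; rewrite !cmE /k doubleS -!natr1; ring.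
have := sl2_span_Z c^-1 (sl2_span_D (IH _ EUg)).
by rewrite DUg scalerA mulVf // scale1r.
Qed.

End Weights.

Lemma sl2_span_even D U E (H : sl2_complete L D U E) (z : int) f :
  E f = ((z * 2)%:~R : C) *: f -> sl2_span D U E f.
Proof.
case: z => j Ef.
  by apply: (sl2_span_even_pos H (j := j)); rewrite Ef -muln2 natrM intrM.
have := sl2_span_even_pos (sl2_complete_swap hL H) (j := j.+1) (f := f).
rewrite Ef => h.
have {}h : sl2_span U D (fun f => - E f) f.
  by apply: h; rewrite -scaleNr -muln2 natrM NegzE intrM mulrNz mulNr opprK.
have [h1 h2 h3] := h; split => //.
by apply: lie_ext (lieZ hL (-1) h3) _ => x; rewrite /fmul scaleN1r mulrN opprK.
Qed.

Lemma sl2_submodule D U E (H : sl2_complete L D U E) :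
  irreducible M ->
  (forall f, exists k, exists2 c : 'I_k -> CM, f = \sum_i c i &
      exists w : 'I_k -> int, forall i, E (c i) = ((w i)%:~R : C) *: c i) ->
  (exists f, D f <> 0) ->
  exists2 g, g <> 0 & forall f, L (fmul (f * g) E).
Proof.
move=> irr dec [f0 Df0].
have Hf := sl2c_fields H.
have [[hD hU] hE] := (sl2_D Hf, sl2_U Hf, sl2_E Hf).
have parity (z : int) : (exists y, z = y * 2) \/ (exists y, z = y * 2 + 1).
  have e := divz_eq z 2; have r0 := modz_ge0 z (isT : (2 : int) != 0).
  have r1 : (z %% 2)%Z < 2 := ltz_mod z (isT : (2 : int) != 0).
  have [r|r] : (z %% 2)%Z = 0 \/ (z %% 2)%Z = 1 by lia.
    by left; exists (z %/ 2)%Z; rewrite {1}e r addr0.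
  by right; exists (z %/ 2)%Z; rewrite {1}e r.
have evenL (z : int) f : E f = ((z * 2)%:~R : C) *: f -> sl2_span D U E f.
  exact: sl2_span_even.
have [odd|noodd] := pselect (exists a, exists2 y : int, a <> 0 & E a = ((y * 2 + 1)%:~R : C) *: a);
  last first.
  (* Without odd weights the even case already covers all of C[M]. *)
  exists 1.
    by move=> e; apply: Df0; rewrite -[f0]mulr1 e mulr0 (vf0 hD).
  move=> f; rewrite mulr1.
  have [k [c -> [w hw]]] := dec f.
  apply: fmul_sum => i; have [ci0|/eqP ci0] := eqVneq (c i) 0.
    by rewrite ci0; apply: lie_ext (lie0 hL) _ => x; rewrite /fmul mul0r.
  have [[y wy]|[y wy]] := parity (w i).
    by have [] := evenL y (c i); rewrite // hw wy.
  by case: noodd; exists (c i), y => //; rewrite hw wy.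
(* D shifts weights by 2, so the last nonzero iterate of D is again odd. *)
have [a [y [a0 Ea Da]]] : exists a, exists y : int, [/\ a <> 0, E a = ((y * 2 + 1)%:~R : C) *: a & D a = 0].
  have [a [y a0 Ea]] := odd.
  have [N hN] := sl2_nilD Hf a.
  have ex : exists N, iter N D a == 0 by exists N; apply/eqP.
  case: (ex_minnP ex) => [[|k]] /eqP hk km; first by case: a0; exact: hk.
  exists (iter k D a), (y + k%:Z); split.
  - by move=> /eqP /km; rewrite ltnn.
  - rewrite (sl2_E_iterD Hf _ Ea); congr (_ *: _).
    by rewrite !rmorphD /= !rmorphM /= rmorphD /= -pmulrn; ring.
  - exact: hk.
(* f1 = h^2 has even weight and D^2 f1 = 2 (D h)^2 *)
have [f1 [z [Ef1 DDf1]]] : exists f1, exists z : int,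
    E f1 = ((z * 2)%:~R : C) *: f1 /\ D (D f1) <> 0.
  have [h [z [Eh Dh]]] : exists h, exists z : int, E h = (z%:~R : C) *: h /\ D h <> 0.
    have [k [c ef [w hw]]] := dec f0.
    apply: contrapT => no; apply: Df0; rewrite ef (vf_sum hD).
    rewrite big1 // => i _; apply: contrapT => Dc; apply: no.
    by exists (c i), (w i).
  have [N hN] := sl2_nilD Hf h.
  have ex : exists N, iter N D h == 0 by exists N; apply/eqP.
  case: (ex_minnP ex) => [[|[|k]]] /eqP hk km.
  - by case: Dh; rewrite (hk : h = 0) (vf0 hD).
  - by case: Dh.
  - have Dk : iter k.+1 D h <> 0 by move/eqP/km; rewrite ltnn.
    exists (iter k D h ^+ 2), (z + k%:Z * 2); split.
      rewrite expr2 (vfM hE) (sl2_E_iterD Hf _ Eh).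
      apply: cm_ext => x; rewrite !cmE !rmorphM /= rmorphD /= rmorphM /= -pmulrn; ring.
    rewrite expr2 !(vfM hD, vfD hD) -!iterS hk.
    rewrite mul0r mulr0 add0r addr0 => e.
    have : iter k.+1 D h * iter k.+1 D h = 0.
      apply: cm_ext => x; have := congr1 (fun f : CM => f x) e; rewrite !cmE => /eqP.
      by rewrite -mulr2n mulrn_eq0 /= => /eqP.
    by case/(cm_mul_eq0 irr).
have [L1 L2 L3] := evenL z f1 Ef1.
have hDf1 := sl2_span_D H (evenL z f1 Ef1).
have [L4 L5 L6] := hDf1.
have LaD : L (fmul a D) by apply: (sl2c_D H); rewrite Da (vf0 hD).
(* As D a = 0, [a D, D(f1) E] = g E - (wt a + 2) a D(f1) D, and a D(f1) D = [a D, f1 D]. *)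
pose g := a * D (D f1).
have LgE : L (fmul g E).
  have B1 : L (fmul (a * D f1) D).
    apply: lie_ext (lie_br hL LaD L1) _ => x.
    rewrite /fmul !(vfE hD) Da; ring.
  apply: lie_ext (lieD hL (lie_br hL LaD L6) (lieZ hL (((y * 2 + 1)%:~R : C) + 2) B1)) _ => x.
  rewrite /fmul !(vfE hD, vfE hE) Ea.
  have /eqP := sl2_ED Hf x; rewrite subr_eq => /eqP ->.
  apply: cm_ext => t; rewrite /g !cmE; ring.
have g0 : g <> 0 by case/(cm_mul_eq0 irr).
have Eg : E g = ((y * 2 + 1 + z * 2 + 4)%:~R : C) *: g.
  have := sl2_E_iterD Hf 2 Ef1; rewrite /= => e.
  rewrite /g (vfM hE) Ea e; apply: cm_ext => t; rewrite !cmE !rmorphD /=; ring.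
set wg : int := (y * 2 + 1 + z * 2 + 4)%R in Eg.
clearbody g.
(* [f E, g E] = (wt g - wt f) f g E, and the difference of weights is odd, hence nonzero. *)
have step (u : int) f : E f = ((u * 2)%:~R : C) *: f -> L (fmul (f * g) E).
  move=> Ef; have [_ _ LfE] := evenL u f Ef.
  have c0 : (wg - u * 2)%:~R != 0 :> C by rewrite intr_eq0 /wg; lia.
  apply: lie_ext (lieZ hL ((wg - u * 2)%:~R^-1 : C) (lie_br hL LfE LgE)) _ => x.
  rewrite /fmul !(vfE hE) Ef Eg; apply: cm_ext => t; rewrite !cmE.
  rewrite rmorphB rmorphM /= in c0 *.
  by field.
exists g => // f.
have [k [c -> [w hw]]] := dec f.
rewrite mulr_suml; apply: fmul_sum => i.
have [[u wu]|[u wu]] := parity (w i).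
  by apply: (step u); rewrite hw wu.
(* For an odd component the product with g is even. *)
have [_ _ h] : sl2_span D U E (c i * g).
  apply: (evenL (u + y + z + 3)).
  rewrite (vfM hE) hw wu Eg; apply: cm_ext => t; rewrite !cmE /wg.
  by rewrite !(rmorphD, rmorphM) /=; ring.
exact: h.
Qed.

End SL2LieAlgebra.

(** * Additive group actions *)

Section PolynomialFamilies.
Context {R : realType} {n : nat} {M : set 'rV[R[i]]_n}.
Local Notation C := R[i].
Local Notation CM := (coord_ring M).

(** [S] plays the role of a subalgebra of functions: those polynomial in t, those Laurent polynomial
    in e^z, and those compatible with reduction modulo an ideal. *)
Lemma meval_closed k (T : Type) (S : set (T -> C)) (P : mpoly.mpoly k C) (g : 'I_k -> T -> C) :
  (forall c, S (fun=> c)) ->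
  (forall f h, S f -> S h -> S (fun t => f t + h t)) ->
  (forall f h, S f -> S h -> S (fun t => f t * h t)) ->
  (forall j, S (g j)) -> S (fun t => mpoly.meval (fun j => g j t) P).
Proof.
move=> SC SD SM Sg; pose F P := S (fun t => mpoly.meval (fun j => g j t) P).
have Fext p f : S f -> (forall t, mpoly.meval (fun j => g j t) p = f t) -> F p.
  by move=> Sf e; rewrite /F (_ : (fun _ => _) = f) //; apply/funext.
have FD p q : F p -> F q -> F (p + q).
  by move=> hp hq; apply: Fext (SD _ _ hp hq) _ => t; rewrite mpoly.mevalD.
have FM p q : F p -> F q -> F (p * q).
  by move=> hp hq; apply: Fext (SM _ _ hp hq) _ => t; rewrite mpoly.mevalM.
have FC c : F (mpoly.mpolyC k c) by apply: Fext (SC c) _ => t; rewrite mpoly.mevalC.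
have FX i : F (mpoly.mpolyX C (mpoly.mnm1 i)).
  by apply: Fext (Sg i) _ => t; rewrite mpoly.mevalXU.
rewrite -/(F P).
have FXm mm : F (mpoly.mpolyX C mm).
  rewrite mpoly.mpolyXE_id; elim/big_ind: _ => [|p q|i _]; first exact: (FC 1).
    exact: FM.
  by elim: (mm i) => [|j IH]; rewrite ?expr0 ?exprS; [exact: (FC 1)|exact: FM].
elim/mpoly.mpolyind: P => [|c mm p _ _ IH].
  by have := FC 0; rewrite mpoly.mpolyC0.
by apply: FD => //; rewrite -mpoly.mul_mpolyC; exact: FM.
Qed.

(** A polynomial in t over C[M]. As the coefficients vanish from K on, the bound can be raised
    freely. *)
Definition tpoly (F : C * M -> C) :=
  exists K, exists2 c : nat -> CM, (forall j, (K <= j)%N -> c j = 0) &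
    forall t x, F (t, x) = \sum_(j < K) c j x * t ^+ j.

Lemma tpoly_widen (c : nat -> CM) K K' x (t : C) : (forall j, (K <= j)%N -> c j = 0) ->
  (K <= K')%N -> \sum_(j < K') c j x * t ^+ j = \sum_(j < K) c j x * t ^+ j.
Proof.
move=> c0 KK; rewrite -(subnKC KK) big_split_ord /= [X in _ + X]big1 ?addr0 // => j _.
by rewrite c0 ?cm0 ?mul0r // leq_addr.
Qed.

Lemma tpoly_cst c : tpoly (fun=> c).
Proof.
exists 1%N, (fun j => if j is 0%N then c *: (1 : CM) else 0); first by case.
by move=> t x; rewrite big_ord1 expr0 mulr1 -[RHS]/(c * 1) mulr1.
Qed.

Lemma tpolyD F G : tpoly F -> tpoly G -> tpoly (fun p => F p + G p).
Proof.
move=> [K [c c0 hc]] [K' [c' c0' hc']]; exists (maxn K K'), (fun j => c j + c' j).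
  by move=> j; rewrite geq_max => /andP[/c0 -> /c0' ->]; rewrite addr0.
move=> t x; rewrite hc hc' -(tpoly_widen _ _ c0 (leq_maxl K K')).
rewrite -(tpoly_widen _ _ c0' (leq_maxr K K')) -big_split; apply: eq_bigr => j _ /=.
by rewrite mulrDl.
Qed.

Lemma tpolyM F G : tpoly F -> tpoly G -> tpoly (fun p => F p * G p).
Proof.
move=> [K [c c0 hc]] [K' [c' c0' hc']].
pose e k : CM := \sum_(i < k.+1) c i * c' (k - i)%N.
exists (K + K')%N, e.
  move=> j Kj; rewrite /e big1 // => i _.
  have [/c0 ->|iK] := leqP K i; first by rewrite mul0r.
  by rewrite c0' ?mulr0 //; have := ltn_ord i; lia.
move=> t x; rewrite hc hc'.
pose p := \poly_(j < K) c j x; pose q := \poly_(j < K') c' j x.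
have pE : p.[t] = \sum_(j < K) c j x * t ^+ j by rewrite horner_poly.
have qE : q.[t] = \sum_(j < K') c' j x * t ^+ j by rewrite horner_poly.
rewrite -pE -qE -hornerM (@horner_coef_wide _ (K + K')); last first.
  apply: leq_trans (size_polyMleq _ _) _; apply: leq_trans (leq_pred _) _.
  exact: leq_add (size_poly _ _) (size_poly _ _).
apply: eq_bigr => j _; congr (_ * _); rewrite coefM /e cmE; apply: eq_bigr => i _.
rewrite !coef_poly cmE; congr (_ * _).
  by case: ltnP => // /c0 ->.
by case: ltnP => // /c0' ->.
Qed.

Lemma tpoly_t : tpoly (fun p => p.1).
Proof.
exists 2%N, (fun j => if j is 1%N then 1 else 0); first by case=> [|[]].
by move=> t x; rewrite big_ord_recl big_ord1 /= mul0r add0r mul1r expr1.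
Qed.

Lemma tpoly_cm (f : CM) : tpoly (fun p => f p.2).
Proof.
exists 1%N, (fun j => if j is 0%N then f else 0); first by case.
by move=> t x; rewrite big_ord1 /= expr0 mulr1.
Qed.

Lemma tpoly_regular F :
  regular (fun p : C * M => row_mx (const_mx p.1 : 'rV_1) (val p.2)) F -> tpoly F.
Proof.
move=> [P hP].
have -> : F = fun p : C * M => mpoly.meval
   (fun j => (row_mx (const_mx p.1 : 'rV_1) (val p.2)) 0 j) P by apply/funext.
apply: (@meval_closed _ _ tpoly P
  (fun j p => (row_mx (const_mx p.1 : 'rV_1) (val p.2)) 0 j)).
- exact: tpoly_cst.
- exact: tpolyD.
- exact: tpolyM.
- move=> j; case: (split_ordP j) => k ->.
    rewrite (_ : (fun _ => _) = fun p : C * M => p.1); first exact: tpoly_t.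
    by apply/funext => p; rewrite row_mxEl mxE.
  rewrite (_ : (fun _ => _) = fun p : C * M => coordf k p.2); first exact: tpoly_cm.
  by apply/funext => p; rewrite row_mxEr coordfE.
Qed.

End PolynomialFamilies.

Section GaActions.
Context {R : realType} {n : nat} {M : set 'rV[R[i]]_n}.
Local Notation C := R[i].
Local Notation CM := (coord_ring M).
Implicit Types (f g h : CM) (x y : M) (s t : C).

Lemma cm_morphism k (T : Type) (iota : T -> 'rV[C]_k) (phi : T -> M) f :
  is_morphism iota phi -> regular iota (fun u => f (phi u)).
Proof. move=> h; exact: regular_comp (regular_funP f) h. Qed.

Variable al : C -> M -> M.
Hypothesis hal : Ga_action al.

Let al0 x : al 0 x = x. Proof. by case: hal. Qed.
Let alD s t x : al (s + t) x = al s (al t x). Proof. by case: hal. Qed.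

Lemma ga_tpoly f : tpoly (fun p : C * M => f (al p.1 p.2)).
Proof. by case: hal => h _ _; apply: tpoly_regular; exact: (cm_morphism f h). Qed.

Definition ga_coef f : nat -> CM := projT1 (cid2 (projT2 (cid (ga_tpoly f)))).

Lemma ga_coefP f : exists2 K, forall j, (K <= j)%N -> ga_coef f j = 0 &
    forall t x, f (al t x) = \sum_(j < K) ga_coef f j x * t ^+ j.
Proof.
rewrite /ga_coef; case: cid => K /= h; case: cid2 => c /= c0 hc; by exists K.

Qed.

(** The coefficient of t in f (al t x), that is, the velocity field of the action. *)
Definition ga_der f : CM := ga_coef f 1.

Lemma ga_isd0 f x : isd (fun t => f (al t x)) 0 (ga_der f x).
Proof.
have [K c0 hc] := ga_coefP f.
have hc2 t : f (al t x) = \sum_(j < K.+2) ga_coef f j x * t ^+ j.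
  by rewrite hc -(@tpoly_widen _ _ _ _ K K.+2) // ltnW.
rewrite (_ : (fun _ => _) = fun t => \sum_(j < K.+2) ga_coef f j x * t ^+ j); last first.
  exact/funext.
have h (j : 'I_K.+2) : isd (fun t => ga_coef f j x * t ^+ j) 0
    (ga_coef f j x * (j%:R * 0 ^+ j.-1)).
  by apply: isd_eq (isdM (isd_cst _ _) (isd_exp _ _)) _; rewrite mul0r add0r.
apply: isd_eq (isd_sum _ h) _.
rewrite 2!big_ord_recl big1 => [|j _]; last by rewrite expr0n /= !mulr0.
by rewrite /= mul0r mulr0 add0r addr0 expr0 !mulr1.
Qed.

Lemma ga_isd f x t : isd (fun t => f (al t x)) t (ga_der f (al t x)).
Proof.
have -> : (fun t => f (al t x)) = (fun s => f (al (s + - t) (al t x))).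
  by apply/funext => s; rewrite -alD subrK.
apply: (@isd_shift _ (fun s => f (al s (al t x)))); rewrite subrr; exact: ga_isd0.
Qed.

Lemma ga_der_eq f d x : isd (fun t => f (al t x)) 0 d -> ga_der f x = d.
Proof. exact/isd_unique/ga_isd0. Qed.

Lemma ga_der_vf : vector_field ga_der.
Proof.
split=> [c f g|f g]; apply: cm_ext => x.
  apply: ga_der_eq; rewrite !cmE.
  have := isdD (isdM (isd_cst c _) (ga_isd0 f x)) (ga_isd0 g x).
  by rewrite mul0r add0r.
by apply: ga_der_eq; rewrite !cmE; have := isdM (ga_isd0 f x) (ga_isd0 g x); rewrite al0.
Qed.

(** Differentiating in t shifts the coefficients, so the expansion of f (al t x) is the series of
    exp(t d), with d = [ga_der]. *)
Lemma ga_coef_iter K (c : nat -> CM) f :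
  (forall t x, f (al t x) = \sum_(j < K) c j x * t ^+ j) ->
  iter K ga_der f = 0 /\ forall j, (j < K)%N -> iter j ga_der f = c j *+ j`!.
Proof.
elim: K c f => [|K IH] c f hf.
  by split=> //=; apply: cm_ext => x; rewrite -(al0 x) hf big_ord0 cm0.
have dE t x : ga_der f (al t x) = \sum_(j < K) (c j.+1 *+ j.+1) x * t ^+ j.
  apply: isd_unique (ga_isd f x t) _.
  rewrite (_ : (fun _ => _) = fun t => \sum_(j < K.+1) c j x * t ^+ j); last exact/funext.
  have h (j : 'I_K.+1) : isd (fun t => c j x * t ^+ j) t (c j x * (j%:R * t ^+ j.-1)).
    by apply: isd_eq (isdM (isd_cst _ _) (isd_exp _ _)) _; rewrite mul0r add0r.
  apply: isd_eq (isd_sum _ h) _.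
  rewrite big_ord_recl mul0r mulr0 add0r; apply: eq_bigr => j _.
  by rewrite lift0 cmMn mulrA mulr_natr.
have [h1 h2] := IH (fun j => c j.+1 *+ j.+1) _ dE; split; first by rewrite iterSr.
case=> [_|j jK]; last by rewrite iterSr h2 // -mulrnA factS.
apply: cm_ext => x /=; rewrite -{1}(al0 x) hf big_ord_recl expr0 mulr1 big1 ?addr0 // => j _.
by rewrite expr0n mulr0.
Qed.

Lemma ga_exp f : exists K, forall K', (K <= K')%N -> iter K' ga_der f = 0 /\
  forall t x, f (al t x) = \sum_(j < K') iter j ga_der f x / (j`!)%:R * t ^+ j.
Proof.
have [K c0 hc] := ga_coefP f; exists K => K' KK.
have hc' t x : f (al t x) = \sum_(j < K') ga_coef f j x * t ^+ j.
  by rewrite hc (tpoly_widen _ _ c0 KK).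
have [h1 h2] := ga_coef_iter hc'; split=> // t x.
rewrite hc'; apply: eq_bigr => j _; rewrite h2 // cmMn -[ga_coef f j x *+ _]mulr_natr mulfK //.
by rewrite pnatr_eq0 -lt0n fact_gt0.
Qed.

Lemma ga_nilpotent f : exists N, iter N ga_der f = 0.
Proof. by have [K /(_ K (leqnn K))[h _]] := ga_exp f; exists K. Qed.

Lemma ga_der0_invariant : (forall f, ga_der f = 0) -> forall t x, al t x = x.
Proof.
move=> d0 t x; apply: point_ext => f.
have [K /(_ K.+1 (leqnSn K))[_ ->]] := ga_exp f.
rewrite big_ord_recl big1 => [|j _]; last by rewrite /= d0 cm0 !mul0r.
by rewrite /= addr0 divr1 expr0 mulr1.
Qed.

(* The flow of h d through x is al (sigma t) x, where sigma' = h(x) + (d h)(x) sigma. *)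
Lemma ga_complete h : ga_der (ga_der h) = 0 -> complete (fmul h ga_der).
Proof.
move=> ddh x; set h0 := h x; set h1 := ga_der h x.
have iter0 j : (1 < j)%N -> iter j ga_der h = 0.
  have v0 := vf0 ga_der_vf.
  by case: j => [|[|j]] // _; elim: j => [|j IH] //; rewrite iterS IH.
(* The expansion of h along the orbit stops after the linear term. *)
have hal_ s : h (al s x) = h0 + h1 * s.
  have [K /(_ K.+2 (leqW (leqnSn K)))[_ ->]] := ga_exp h.
  rewrite 2!big_ord_recl big1 => [|j _]; last by rewrite iter0 // cm0 !mul0r.
  by rewrite /= !divr1 expr0 mulr1 addr0 expr1.
have [sg sg0 hsg] : exists2 sg : C -> C, sg 0 = 0 & forall t, isd sg t (h0 + h1 * sg t).
  have [h10|h10] := eqVneq h1 0.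
    exists (fun t => h0 * t) => [|t]; first by rewrite mulr0.
    apply: isd_eq (isdM (isd_cst _ _) (isd_id _)) _; rewrite h10; ring.
  exists (fun t => h0 / h1 * (cexp (h1 * t) - 1)) => [|t].
    by rewrite mulr0 cexp0 subrr mulr0.
  apply: isd_eq (isdM (isd_cst (h0 / h1) _) (isdD (isd_cexp h1 t) (isd_cst (-1) t))) _.
  by field.
exists (fun t => al (sg t) x); split; first by rewrite sg0 al0.
move=> f t.
have [K /(_ K (leqnn K))[_ fE]] := ga_exp f.
(* The chain rule, read off the finite expansion of f along the orbit. *)
have key s d : isd sg s d -> isd (fun t => f (al (sg t) x)) s (d * ga_der f (al (sg s) x)).
  move=> hs; pose c j := iter j ga_der f x / (j`!)%:R.
  have e1 : (fun t => f (al (sg t) x)) = fun t => \sum_(j < K) c j * sg t ^+ j.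
    by apply/funext => u; rewrite fE.
  have -> : ga_der f (al (sg s) x) = \sum_(j < K) c j * (j%:R * sg s ^+ j.-1).
    apply: isd_unique (ga_isd f x (sg s)) _.
    rewrite (_ : (fun _ => _) = fun t => \sum_(j < K) c j * t ^+ j); last first.
      by apply/funext => u; rewrite fE.
    have e (j : 'I_K) : isd (fun t => c j * t ^+ j) (sg s) (c j * (j%:R * sg s ^+ j.-1)).
      by apply: isd_eq (isdM (isd_cst _ _) (isd_exp _ _)) _; rewrite mul0r add0r.
    exact: isd_sum e.
  rewrite e1.
  have e (j : 'I_K) : isd (fun t => c j * sg t ^+ j) s (c j * (j%:R * sg s ^+ j.-1 * d)).
    by apply: isd_eq (isdM (isd_cst _ _) (isdX _ hs)) _; rewrite mul0r add0r.
  apply: isd_eq (isd_sum _ e) _.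
  by rewrite mulr_sumr; apply: eq_bigr => j _; ring.
by have := key _ _ (hsg t); rewrite /fmul !cmE hal_.
Qed.

End GaActions.

(** * SL_2-actions *)

Section SL2Actions.
Context {R : realType} {n : nat} {M : set 'rV[R[i]]_n}.
Local Notation C := R[i].
Local Notation CM := (coord_ring M).
Implicit Types (f : CM) (x y : M) (s t : C) (g h : SL2 R).

Variable a : SL2 R -> M -> M.
Hypothesis ha : SL2_action a.

Let a1 x : a 1%g x = x. Proof. by case: ha. Qed.
Let aM g h x : a (g * h)%g x = a g (a h x). Proof. by case: ha. Qed.

Lemma sl2_polyP f : exists Q : mpoly.mpoly (2 * 2 + n) C,
  forall g x, f (a g x) = mpoly.meval (row_mx (mxvec (g : 'M[C]_2)) (val x) 0) Q.
Proof.
case: ha => hm _ _; have [Q hQ] := cm_morphism f hm; exists Q => g x.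
exact: (hQ (g, x)).
Qed.

Definition sl2_poly f := projT1 (cid (sl2_polyP f)).

Lemma sl2_polyE f g x :
  f (a g x) = mpoly.meval (row_mx (mxvec (g : 'M[C]_2)) (val x) 0) (sl2_poly f).
Proof. by rewrite /sl2_poly; case: cid. Qed.

Definition sl2_partial f (i j : 'I_2) : CM :=
  cm_of (fun x => mpoly.meval (row_mx (mxvec (1%:M : 'M[C]_2)) (val x) 0)
    (mpoly.mderiv (lshift n (mxvec_index i j)) (sl2_poly f))).

Lemma sl2_partialE f i j x : sl2_partial f i j x =
  mpoly.meval (row_mx (mxvec (1%:M : 'M[C]_2)) (val x) 0)
    (mpoly.mderiv (lshift n (mxvec_index i j)) (sl2_poly f)).
Proof.
apply: cm_ofE.
apply: (@regular_meval _ _ _ _ _ _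
   (fun k x => (row_mx (mxvec (1%:M : 'M[C]_2)) (val x)) 0 k)) => k.
case: (split_ordP k) => l ->.
  apply: regular_ext (regular_cst _ (mxvec (1%:M : 'M[C]_2) 0 l)) => y.
  by rewrite row_mxEl.
by apply: regular_ext (regular_coord _ l) => y; rewrite row_mxEr.
Qed.

(** The derivative at the identity of the chosen polynomial [sl2_poly f] in all four matrix entries.
    It makes sense for every matrix xi; on velocities of curves in SL_2 it is intrinsic, by
    [sl2_isd1]. *)
Definition sl2_der (xi : 'M[C]_2) f : CM := \sum_i \sum_j xi i j *: sl2_partial f i j.

Lemma sl2_isd1 (g : C -> SL2 R) t (xi : 'M[C]_2) f x : g t = 1%g ->
  (forall i j, isd (fun s => (g s : 'M[C]_2) i j) t (xi i j)) ->
  isd (fun s => f (a (g s) x)) t (sl2_der xi f x).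
Proof.
move=> gt hg.
have -> : (fun s => f (a (g s) x)) = fun s => mpoly.meval
    (fun k => (row_mx (mxvec (g s : 'M[C]_2)) (val x)) 0 k) (sl2_poly f).
  by apply/funext => s; rewrite sl2_polyE.
pose d (k : 'I_(2 * 2 + n)) : C := (row_mx (mxvec xi) (0 : 'rV_n)) 0 k.
have hd k : isd (fun s => (row_mx (mxvec (g s : 'M[C]_2)) (val x)) 0 k) t (d k).
  rewrite /d; case: (split_ordP k) => l ->.
    case/mxvec_indexP: l => i j.
    rewrite row_mxEl mxvecE (_ : (fun _ => _) = fun s => (g s : 'M[C]_2) i j); last first.
      by apply/funext => s; rewrite row_mxEl mxvecE.
    exact: hg.
  rewrite row_mxEr mxE (_ : (fun _ => _) = fun=> val x 0 l); last first.
    by apply/funext => s; rewrite row_mxEr.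
  exact: isd_cst.
apply: isd_eq (isd_meval _ hd) _.
rewrite big_split_ord /= [X in _ + X]big1 ?addr0 => [|k _]; last first.
  by rewrite /d row_mxEr mxE mulr0.
rewrite /sl2_der cm_sum.
under eq_bigr => i _ do rewrite /d row_mxEl gt.
rewrite (reindex _ (curry_mxvec_bij _ _)) /=.
under [RHS]eq_bigr => i _ do rewrite cm_sum.
rewrite pair_bigA; apply: eq_bigr => -[i j] _.
by rewrite cmZ sl2_partialE mxvecE mulrC.
Qed.

Lemma SL2_mulE (g h : SL2 R) : ((g * h)%g : 'M[C]_2) = (g : 'M_2) *m (h : 'M_2).
Proof. by []. Qed.
Lemma mul2E (A B : 'M[C]_2) i j : (A *m B) i j = A i 0 * B 0 j + A i 1 * B 1 j.
Proof.
rewrite mxE !big_ord_recl big_ord0 addr0.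
by congr (_ * _ + _ * _); congr (fun_of_matrix _ _ _); apply: val_inj.
Qed.

(** The translated curve g(s) g(t)^-1 passes through 1 with velocity xi. *)
Lemma sl2_isd (g : C -> SL2 R) t (xi : 'M[C]_2) f x :
  (forall i j, isd (fun s => (g s : 'M[C]_2) i j) t ((xi *m (g t : 'M[C]_2)) i j)) ->
  isd (fun s => f (a (g s) x)) t (sl2_der xi f (a (g t) x)).
Proof.
move=> hg.
have -> : (fun s => f (a (g s) x)) = fun s => f (a (g s * (g t)^-1)%g (a (g t) x)).
  by apply/funext => s; rewrite -aM -mulgA mulVg mulg1.
apply: (@sl2_isd1 (fun s => (g s * (g t)^-1)%g)); first by rewrite mulgV.
move=> i j.
have e : xi i j = (xi *m (g t : 'M[C]_2) *m ((g t)^-1)%g) i j.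
  by rewrite -mulmxA -SL2_mulE mulgV mulmx1.
rewrite e mul2E (_ : (fun _ => _) = fun s =>
  (g s : 'M[C]_2) i 0 * ((g t)^-1%g : 'M[C]_2) 0 j +
  (g s : 'M[C]_2) i 1 * ((g t)^-1%g : 'M[C]_2) 1 j); last first.
  by apply/funext => s; rewrite SL2_mulE mul2E.
by apply: isdD; apply: isd_eq (isdM (hg _ _) (isd_cst _ _)) _; rewrite mulr0 addr0.
Qed.

End SL2Actions.

(** * Root subgroups, the torus and its weight decomposition *)

Section SL2Generators.
Context {R : realType} {n : nat} {M : set 'rV[R[i]]_n}.
Local Notation C := R[i].
Local Notation CM := (coord_ring M).
Implicit Types (f : CM) (x y : M) (s t z : C) (g h : SL2 R) (N xi : 'M[C]_2).

(** The difference has size at most K and K distinct roots. With u_i = e^i this separates the powers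
    of e^z. *)
Lemma horner_sum_inj (u : nat -> C) (K : nat) (c d : nat -> C) : injective u ->
  (forall i, \sum_(j < K) c j * u i ^+ j = \sum_(j < K) d j * u i ^+ j) ->
  forall j, (j < K)%N -> c j = d j.
Proof.
move=> u_inj h j jK.
have : \poly_(j < K) c j - \poly_(j < K) d j = 0.
  apply/eqP; apply: contraT => p0.
  have := max_poly_roots (rs := [seq u i | i <- iota 0 K]) p0.
  rewrite size_map size_iota => H; have : (K < K)%N; last by rewrite ltnn.
  apply: leq_trans (H _ _) _.
  - apply/allP => _ /mapP[i _ ->]; rewrite /root hornerD hornerN !horner_poly h subrr //.
  - by rewrite map_inj_uniq ?iota_uniq.
  - apply: leq_trans (size_polyD _ _) _; rewrite size_polyN geq_max !size_poly //.
move/(congr1 (fun p : {poly C} => p`_j)); rewrite coefB !coef_poly jK coef0 => /eqP.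
by rewrite subr_eq0 => /eqP.
Qed.

Lemma cexpXn z k : cexp z ^+ k = cexp (k%:R * z).
Proof.
elim: k => [|k IH]; first by rewrite mul0r cexp0.
by rewrite exprS IH -cexpD -natr1 mulrDl mul1r addrC.
Qed.

Lemma cexp_nat_inj : injective (fun i => cexp ((i%:R : R)%:C%C)).
Proof.
move=> i j /eqP; rewrite /cexp eq_complex /= cos0 !mulr1 => /andP[/eqP/expR_inj/eqP].
by rewrite eqr_nat => /eqP.
Qed.

Variable a : SL2 R -> M -> M.
Hypothesis ha : SL2_action a.

Let a1 x : a 1%g x = x. Proof. by case: ha. Qed.
Let aM g h x : a (g * h)%g x = a g (a h x). Proof. by case: ha. Qed.

Lemma mx2P (A B : 'M[C]_2) : A 0 0 = B 0 0 -> A 0 1 = B 0 1 -> A 1 0 = B 1 0 ->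
  A 1 1 = B 1 1 -> A = B.
Proof.
move=> h1 h2 h3 h4; apply/matrixP => i j.
have ord2 (k : 'I_2) : k = 0 \/ k = 1.
  by case: k => -[|[|//]] hk; [left|right]; apply: val_inj.
by have [->|->] := ord2 i; have [->|->] := ord2 j.
Qed.

Lemma sl2_morphism g : is_morphism val (a g).
Proof.
case: ha => hm _ _ j.
have e : (fun x => val (a g x) 0 j) = fun x => (fun p => val (a p.1 p.2) 0 j) (g, x) by [].
rewrite e; apply: (regular_comp (hm j)) => k.
case: (split_ordP k) => l ->.
  apply: regular_ext (regular_cst _ (mxvec (g : 'M[C]_2) 0 l)) => y.
  by rewrite row_mxEl.
by apply: regular_ext (regular_coord _ l) => y; rewrite row_mxEr.
Qed.

Definition pull (phi : M -> M) f : CM := cm_of (fun x => f (phi x)).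

Lemma pullE phi f x : is_morphism val phi -> pull phi f x = f (phi x).
Proof. by move=> h; apply: cm_ofE; exact: cm_morphism. Qed.

Lemma sl2_derD xi xi' f x : sl2_der ha (xi + xi') f x = sl2_der ha xi f x + sl2_der ha xi' f x.
Proof.
rewrite /sl2_der !cm_sum -big_split; apply: eq_bigr => i _.
rewrite !cm_sum -big_split; apply: eq_bigr => j _.
by rewrite !cmZ mxE mulrDl.
Qed.

Lemma sl2_derZ c xi f x : sl2_der ha (c *: xi) f x = c * sl2_der ha xi f x.
Proof.
rewrite /sl2_der !cm_sum mulr_sumr; apply: eq_bigr => i _.
rewrite !cm_sum mulr_sumr; apply: eq_bigr => j _.
by rewrite !cmZ mxE mulrA.
Qed.

Section RootSubgroup.
Variables (r : C -> SL2 R) (N : 'M[C]_2).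
Hypothesis rE : forall t, r t = 1%:M + t *: N :> 'M[C]_2.
Hypothesis N2 : N *m N = 0.

Lemma root_Ga : Ga_action (fun t => a (r t)).
Proof.
split.
- case: ha => hm _ _ j.
  apply: (regular_comp (phi := fun p : C * M => (r p.1, p.2)) (hm j)) => k.
  case: (split_ordP k) => l ->.
    case/mxvec_indexP: l => u v.
    have h : regular (fun p : C * M => row_mx (const_mx p.1 : 'rV_1) (val p.2))
       (fun p => (1%:M : 'M[C]_2) u v + p.1 * N u v).
      apply: regularD; first exact: regular_cst.
      apply: regularM; last exact: regular_cst.
      apply: regular_ext (regular_coord _ (lshift n 0)) => p.
      by rewrite row_mxEl mxE.
    by apply: regular_ext h => p; rewrite row_mxEl mxvecE /= rE !mxE.
  apply: regular_ext (regular_coord _ (rshift 1 l)) => p.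
  by rewrite !row_mxEr.
- move=> x; rewrite (_ : r 0 = 1%g) ?a1 //; apply: val_inj.
  by rewrite /= rE scale0r addr0.
- move=> s t x; rewrite -aM; congr a; apply: val_inj.
  rewrite /= !rE mulmxDl !mulmxDr !mul1mx mulmx1 -scalemxAl -scalemxAr N2.
  by rewrite !scaler0 addr0 scalerDl -addrA; congr (_ + _); rewrite addrC.
Qed.

Lemma root_isd (g : SL2 R) i j :
  isd (fun t => (g * r t)%g i j) 0 ((g *m N) i j).
Proof.
have -> : (fun t => (g * r t)%g i j) = fun t => (g : 'M[C]_2) i j + t * ((g : 'M[C]_2) *m N) i j.
  by apply/funext => t; rewrite SL2_mulE rE mulmxDr mulmx1 -scalemxAr !mxE.
apply: isd_eq (isdD (isd_cst _ _) (isdM (isd_id _) (isd_cst _ _))) _.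
by rewrite mulr0 addr0 add0r mul1r.
Qed.

Lemma root_r0 : r 0 = 1%g.
Proof. by apply: val_inj; rewrite /= rE scale0r addr0. Qed.

Lemma root_ga_der f : ga_der root_Ga f = sl2_der ha N f.
Proof.
apply: cm_ext => x; apply: ga_der_eq.
apply: sl2_isd1; first exact: root_r0.
move=> i j; have := root_isd 1%g i j.
rewrite (_ : SL2_mx 1%g *m N = N); last exact: mul1mx.
by congr isd; apply/funext => t; rewrite mul1g.
Qed.

(** Here xi is g N g^-1, written without the inverse: transport by g conjugates the root
    subgroup. *)
Lemma root_conj g xi f x : xi *m g = (g : 'M_2) *m N ->
  ga_der root_Ga (pull (a g) f) x = sl2_der ha xi f (a g x).
Proof.
move=> e; apply: ga_der_eq.
have -> : (fun t => pull (a g) f (a (r t) x)) = fun t => f (a (g * r t)%g x).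
  by apply/funext => t; rewrite pullE ?aM //; exact: sl2_morphism.
have gr0 : (g * r 0)%g = g by rewrite root_r0 mulg1.
rewrite -{2}gr0; apply: (sl2_isd ha (g := fun t => (g * r t)%g)) => i j.
rewrite gr0 e; exact: root_isd.
Qed.

End RootSubgroup.

Lemma delta01_sq : (delta_mx 0 1 : 'M[C]_2) *m (delta_mx 0 1 : 'M[C]_2) = 0.
Proof. by rewrite mul_delta_mx_0. Qed.
Lemma delta10_sq : (delta_mx 1 0 : 'M[C]_2) *m (delta_mx 1 0 : 'M[C]_2) = 0.
Proof. by rewrite mul_delta_mx_0. Qed.

Definition upper_Ga := root_Ga (r := @upper_root R) (fun t => erefl) delta01_sq.
Definition lower_Ga := root_Ga (r := @lower_root R) (fun t => erefl) delta10_sq.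

(** Differentiating f (b_t x) reverses brackets of matrices. Taking D from the lower and U from the
    upper root subgroup makes [D, U] the derivative along diag(e^z, e^-z). *)
Definition sl2_raise : CM -> CM := ga_der lower_Ga.
Definition sl2_lower : CM -> CM := ga_der upper_Ga.
Definition sl2_H : 'M[C]_2 := \matrix_(i, j) ((i == j)%:R * (-1) ^+ i).
Definition sl2_weight : CM -> CM := sl2_der ha sl2_H.

Lemma sl2_HE : (sl2_H 0 0 = 1) * (sl2_H 0 1 = 0) * (sl2_H 1 0 = 0) * (sl2_H 1 1 = -1).
Proof. by rewrite !mxE /= expr0 expr1 !mul0r !mul1r. Qed.

Definition torus_row z : 'rV[C]_2 := \row_i (if i == 0 then cexp z else cexp (- z)).

Fact torus_subproof z : \det (diag_mx (torus_row z)) == 1.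
Proof.
by rewrite det_diag 2!big_ord_recl big_ord0 mulr1 !mxE /= -cexpD subrr cexp0.
Qed.
Definition torus z : SL2 R := MkSL2 (torus_subproof z).

Lemma torusE z : ((torus z : 'M[C]_2) 0 0 = cexp z) * ((torus z : 'M[C]_2) 0 1 = 0) *
  ((torus z : 'M[C]_2) 1 0 = 0) * ((torus z : 'M[C]_2) 1 1 = cexp (- z)).
Proof. by rewrite !mxE /= !mulr1n !mulr0n. Qed.

Lemma torus0 : torus 0 = 1%g.
Proof.
apply: val_inj; change ((torus 0 : 'M[C]_2) = 1%:M).
by apply: mx2P; rewrite torusE ?oppr0 ?cexp0 !mxE.
Qed.

Lemma torusD z w : torus (z + w) = (torus z * torus w)%g.
Proof.
apply: val_inj; change ((torus (z + w) : 'M[C]_2) = (torus z : 'M[C]_2) *m torus w).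
by apply: mx2P; rewrite mul2E !torusE ?cexpD ?opprD ?cexpD; ring.
Qed.

Lemma torus_isd c t f x :
  isd (fun s => f (a (torus (c * s)) x)) t (c * sl2_weight f (a (torus (c * t)) x)).
Proof.
rewrite -sl2_derZ; apply: (sl2_isd ha (g := fun s => torus (c * s))) => i j.
have isdN : isd (fun s => cexp (- (c * s))) t (- c * cexp (- (c * t))).
  rewrite (_ : (fun _ => _) = fun s => cexp (- c * s)).
    by apply: isd_eq (isd_cexp _ _) _; rewrite !mulNr.
  by apply/funext => s; rewrite mulNr.
have ord2 (k : 'I_2) : k = 0 \/ k = 1.
  by case: k => -[|[|//]] hk; [left|right]; apply: val_inj.
have E00 : (fun s => (torus (c * s) : 'M[C]_2) 0 0) = (fun s => cexp (c * s)).
  by apply/funext => s; rewrite torusE.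
have E01 : (fun s => (torus (c * s) : 'M[C]_2) 0 1) = (fun=> 0).
  by apply/funext => s; rewrite torusE.
have E10 : (fun s => (torus (c * s) : 'M[C]_2) 1 0) = (fun=> 0).
  by apply/funext => s; rewrite torusE.
have E11 : (fun s => (torus (c * s) : 'M[C]_2) 1 1) = (fun s => cexp (- (c * s))).
  by apply/funext => s; rewrite torusE.
have cH u v : (c *: sl2_H) u v = c * sl2_H u v by rewrite mxE.
have [->|->] := ord2 i; have [->|->] := ord2 j; rewrite mul2E !cH !torusE !sl2_HE.
- rewrite E00; apply: isd_eq (isd_cexp _ _) _; ring.
- rewrite E01; apply: isd_eq (isd_cst _ _) _; ring.
- rewrite E10; apply: isd_eq (isd_cst _ _) _; ring.
- rewrite E11; apply: isd_eq isdN _; ring.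
Qed.

Lemma torus_isd0 f x : isd (fun s => f (a (torus s) x)) 0 (sl2_weight f x).
Proof.
have := torus_isd 1 0 f x; rewrite mul1r mulr0 torus0 a1.
by congr isd; apply/funext => s; rewrite mul1r.
Qed.

Lemma sl2_weight_eq f x d : isd (fun s => f (a (torus s) x)) 0 d -> sl2_weight f x = d.
Proof. exact/isd_unique/torus_isd0. Qed.

Lemma sl2_weight_vf : vector_field sl2_weight.
Proof.
split=> [c f g|f g]; apply: cm_ext => x.
  apply: sl2_weight_eq.
  apply: isd_eq (isdD (isdM (isd_cst c _) (torus_isd0 f x)) (torus_isd0 g x)) _.
  by rewrite mul0r add0r.
apply: sl2_weight_eq; apply: isd_eq (isdM (torus_isd0 f x) (torus_isd0 g x)) _.
by rewrite torus0 a1.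
Qed.

(** A Laurent polynomial in e^z over C[M], with the denominator e^(m z) cleared. *)
Definition torus_laurent (F : C * M -> C) := exists m : nat, exists2 G, tpoly G &
  forall z x, F (z, x) * cexp z ^+ m = G (cexp z, x).

Lemma torus_laurentP f : torus_laurent (fun p => f (a (torus p.1) p.2)).
Proof.
have -> : (fun p : C * M => f (a (torus p.1) p.2)) = fun p : C * M => mpoly.meval
    (fun k => (row_mx (mxvec (torus p.1 : 'M[C]_2)) (val p.2)) 0 k) (sl2_poly ha f).
  by apply/funext => p; rewrite (sl2_polyE ha).
have tX m : tpoly (fun p : C * M => p.1 ^+ m).
  elim: m => [|m IH]; first exact: tpoly_cst.
  rewrite (_ : (fun _ => _) = fun p : C * M => p.1 * p.1 ^+ m).
    exact: tpolyM (@tpoly_t _ _ _) IH.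
  by apply/funext => p; rewrite exprS.
have lc c : torus_laurent (fun=> c).
  by exists 0%N, (fun=> c); [exact: tpoly_cst|move=> z x; rewrite mulr1].
apply: (@meval_closed _ _ _ torus_laurent (sl2_poly ha f)
  (fun k p => (row_mx (mxvec (torus p.1 : 'M[C]_2)) (val p.2)) 0 k)) => //.
- move=> F F' [m [G tG hG]] [m' [G' tG' hG']].
  exists (m + m')%N, (fun p => G p * p.1 ^+ m' + G' p * p.1 ^+ m).
    by apply: tpolyD; apply: tpolyM => //; exact: tX.
  by move=> z x /=; rewrite -hG -hG' exprD; ring.
- move=> F F' [m [G tG hG]] [m' [G' tG' hG']].
  exists (m + m')%N, (fun p => G p * G' p); first exact: tpolyM.
  by move=> z x /=; rewrite -hG -hG' exprD; ring.
- move=> k; case: (split_ordP k) => l ->; last first.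
    exists 0%N, (fun p => coordf l p.2); first exact: tpoly_cm.
    by move=> z x; rewrite row_mxEr mulr1 coordfE.
  case/mxvec_indexP: l => u v.
  have eqF F F' : torus_laurent F -> (forall p, F' p = F p) -> torus_laurent F'.
    by move=> h e; rewrite (_ : F' = F) //; apply/funext.
  have ord2 (k' : 'I_2) : k' = 0 \/ k' = 1.
    by case: k' => -[|[|//]] hk; [left|right]; apply: val_inj.
  have lE : torus_laurent (fun p => cexp p.1).
    exists 0%N, (fun p => p.1); first exact: tpoly_t.
    by move=> z x; rewrite mulr1.
  have lEN : torus_laurent (fun p => cexp (- p.1)).
    exists 1%N, (fun=> 1); first exact: tpoly_cst.
    by move=> z x; rewrite expr1 -cexpD addNr cexp0.
  have [->|->] := ord2 u; have [->|->] := ord2 v.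
  - by apply: eqF lE _ => p; rewrite row_mxEl mxvecE torusE.
  - by apply: eqF (lc 0) _ => p; rewrite row_mxEl mxvecE torusE.
  - by apply: eqF (lc 0) _ => p; rewrite row_mxEl mxvecE torusE.
  - by apply: eqF lEN _ => p; rewrite row_mxEl mxvecE torusE.
Qed.

Definition weight_vector (k : C) f := forall z x, f (a (torus z) x) = cexp (k * z) * f x.

Lemma weight_vectorP k f : weight_vector k f -> sl2_weight f = k *: f.
Proof.
move=> h; apply: cm_ext => x; apply: sl2_weight_eq.
rewrite (_ : (fun _ => _) = fun z => cexp (k * z) * f x); last exact/funext.
apply: isd_eq (isdM (isd_cexp k 0) (isd_cst _ _)) _.
by rewrite !mulr0 cexp0 cmZ mulr1 addr0.
Qed.

(** Write f (torus z x) e^(m z) as the sum of the c_j(x) e^(j z). Replacing x by torus w x amounts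
    to replacing z by z + w; comparing coefficients, c_j is multiplied by e^((j - m) w). *)
Lemma weight_decomposition f : exists K, exists m : nat, exists2 c : nat -> CM,
  f = \sum_(k < K) c k & forall k, (k < K)%N -> weight_vector (k%:R - m%:R) (c k).
Proof.
have [m [G [K [c c0 hc]] hG]] := torus_laurentP f.
have hf z x : f (a (torus z) x) * cexp z ^+ m = \sum_(j < K) c j x * cexp z ^+ j.
  by rewrite -hc -hG.
exists K, m, c.
  apply: cm_ext => x; have := hf 0 x; rewrite torus0 a1 cexp0 expr1n mulr1 cm_sum => ->.
  by apply: eq_bigr => j _; rewrite expr1n mulr1.
move=> k kK w x.
pose u i := cexp ((i%:R : R)%:C%C).
have key i : \sum_(j < K) c j (a (torus w) x) * u i ^+ j =
             \sum_(j < K) (c j x * cexp ((j%:R - m%:R) * w)) * u i ^+ j.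
  rewrite -hf -aM -torusD.
  apply: (mulIf (expf_neq0 m (cexp_neq0 w))); rewrite -mulrA -exprMn -cexpD hf mulr_suml.
  apply: eq_bigr => j _.
  have e : cexp ((j%:R - m%:R) * w) * cexp w ^+ m = cexp w ^+ j.
    by rewrite !cexpXn -cexpD -mulrDl subrK.
  by rewrite cexpD exprMn -e /u; ring.
rewrite (horner_sum_inj (c := fun j => c j (a (torus w) x))
  (d := fun j => c j x * cexp ((j%:R - m%:R) * w)) cexp_nat_inj key kK).
by rewrite mulrC.
Qed.

End SL2Generators.

(** * Commutation relations and complete fields of the action *)

Section SL2Relations.
Context {R : realType} {n : nat} {M : set 'rV[R[i]]_n}.
Local Notation C := R[i].
Local Notation CM := (coord_ring M).
Implicit Types (f : CM) (x y : M) (s t z : C) (g h : SL2 R) (N xi : 'M[C]_2).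

Lemma ga_morphism (al : C -> M -> M) s : Ga_action al -> is_morphism val (al s).
Proof.
case=> hm _ _ j.
apply: (regular_comp (phi := fun x : M => (s, x)) (hm j)) => k.
case: (split_ordP k) => l ->.
  apply: regular_ext (regular_cst _ s) => y.
  by rewrite row_mxEl mxE.
by apply: regular_ext (regular_coord _ l) => y; rewrite row_mxEr.
Qed.

(** V applies termwise, since the pullback is a finite exponential series in s. *)
Lemma ga_pull_isd (al : C -> M -> M) (hal : Ga_action al) V f x : vector_field V ->
  isd (fun s => V (pull (al s) f) x) 0 (V (ga_der hal f) x).
Proof.
move=> hV; have [K /(_ K.+2 (leqW (leqnSn K)))[_ fE]] := ga_exp hal f.
pose c j := V (iter j (ga_der hal) f) x / (j`!)%:R.
have -> : (fun s => V (pull (al s) f) x) = fun s => \sum_(j < K.+2) c j * s ^+ j.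
  apply/funext => s.
  have -> : pull (al s) f = \sum_(j < K.+2) (s ^+ j / (j`!)%:R) *: iter j (ga_der hal) f.
    apply: cm_ext => y; rewrite pullE ?fE; last exact: ga_morphism.
    by rewrite cm_sum; apply: eq_bigr => j _; rewrite cmZ mulrC mulrA mulrAC.
  rewrite (vf_sum hV) cm_sum; apply: eq_bigr => j _.
  by rewrite (vfZ hV) cmZ /c mulrC mulrA mulrAC.
have h (j : 'I_K.+2) : isd (fun t => c j * t ^+ j) 0 (c j * (j%:R * 0 ^+ j.-1)).
  by apply: isd_eq (isdM (isd_cst _ _) (isd_exp _ _)) _; rewrite mul0r add0r.
apply: isd_eq (isd_sum _ h) _.
rewrite 2!big_ord_recl big1 => [|j _]; last by rewrite expr0n /= !mulr0.
by rewrite lift0 mul0r mulr0 add0r addr0 expr0 !mulr1 /c divr1.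
Qed.

Variable a : SL2 R -> M -> M.
Hypothesis ha : SL2_action a.
Let D := sl2_raise ha.
Let U := sl2_lower ha.
Let E := sl2_weight ha.
Let hD : vector_field D := ga_der_vf (lower_Ga ha).
Let hU : vector_field U := ga_der_vf (upper_Ga ha).
Let hE : vector_field E := sl2_weight_vf ha.

(** Let u_s be the upper root subgroup. The derivative of D (f o u_s) (x) at s = 0 is D(U f) by the
    expansion of the flow, and U(D f) + E f by the conjugation formula u_s e_10 u_s^-1 = e_10 + s H
    - s^2 e_01. *)
Lemma sl2_bracket f : D (U f) - U (D f) = E f.
Proof.
apply: cm_ext => x.
have h1 := ga_pull_isd (upper_Ga ha) f x hD.
have h2 : isd (fun s => D (pull (a (upper_root s)) f) x) 0 (U (D f) x + E f x).
  pose xi s : 'M[C]_2 := delta_mx 1 0 + (s *: sl2_H + (- s ^+ 2) *: delta_mx 0 1).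
  have xiE s : xi s *m (upper_root s : 'M[C]_2) = (upper_root s : 'M[C]_2) *m delta_mx 1 0.
    apply: mx2P; rewrite !mul2E /=; do !rewrite ?sl2_HE mxE /=; rewrite ?expr0 ?expr1; ring.
  have -> : (fun s => D (pull (a (upper_root s)) f) x) = fun s =>
      D f (a (upper_root s) x) + (s * E f (a (upper_root s) x)
        + (- s ^+ 2) * U f (a (upper_root s) x)).
    apply/funext => s; rewrite /D /sl2_raise /lower_Ga (root_conj _ _ _ _ _ (xiE s)).
    rewrite /xi !sl2_derD !sl2_derZ; congr (_ + (_ + _ * _)).
      by rewrite /lower_Ga root_ga_der.
    by rewrite /U /sl2_lower /upper_Ga root_ga_der.
  have u0 : a (upper_root 0) x = x.
    by have [_ + _] := upper_Ga ha; apply.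
  have d1 := ga_isd0 (upper_Ga ha) (D f) x.
  have d2 := ga_isd0 (upper_Ga ha) (E f) x.
  have d3 := ga_isd0 (upper_Ga ha) (U f) x.
  have sq : isd (fun s => - s ^+ 2) 0 0.
    rewrite (_ : (fun _ => _) = fun s : C => -1 * s ^+ 2).
      by apply: isd_eq (isdM (isd_cst _ _) (isd_exp _ _)) _; rewrite /= expr1 !mulr0 mul0r addr0.
    by apply/funext => s; rewrite mulN1r.
  apply: isd_eq (isdD d1 (isdD (isdM (isd_id 0) d2) (isdM sq d3))) _.
  by rewrite u0 /=; ring.
have := isd_unique h1 h2; rewrite cmD cmN => ->; ring.
Qed.

Lemma weight_linear_ext (F G : CM -> CM) :
  (forall f (g : CM), F (f + g) = F f + F g) -> (forall f (g : CM), G (f + g) = G f + G g) ->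
  (forall k f, weight_vector a k f -> F f = G f) -> F = G.
Proof.
move=> FD GD h.
have z0 (H : CM -> CM) : (forall f (g : CM), H (f + g) = H f + H g) -> H 0 = 0.
  by move=> HD; have := HD 0 0; rewrite addr0 => /eqP; rewrite -subr_eq0 opprD addrA
    subrr sub0r oppr_eq0 => /eqP.
apply/funext => f; have [K [m [c -> hc]]] := weight_decomposition ha f.
have S (H : CM -> CM) : (forall f (g : CM), H (f + g) = H f + H g) ->
    H (\sum_(k < K) c k) = \sum_(k < K) H (c k).
  by move=> HD; elim/big_rec2: _ => [|i y1 y2 _ <-]; rewrite ?HD ?z0.
rewrite !S //; apply: eq_bigr => k _; apply: h; exact: hc.
Qed.

(** Conjugation by the torus scales N by e^(w z), so the generator maps weight k to weight k - w. *)
Lemma torus_conj (r : C -> SL2 R) N (rE : forall t, r t = 1%:M + t *: N :> 'M[C]_2)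
    (N2 : N *m N = 0) (w : C) f :
  (forall z, cexp (w * z) *: N *m torus z = (torus z : 'M[C]_2) *m N) ->
  E (ga_der (root_Ga ha rE N2) f) - ga_der (root_Ga ha rE N2) (E f)
  = - w *: ga_der (root_Ga ha rE N2) f.
Proof.
move=> hw; set V := ga_der _; have hV : vector_field V := ga_der_vf _.
suff H : (fun f => E (V f)) = fun f => V (E f) + - w *: V f.
  have H1 : E (V f) = V (E f) + - w *: V f by exact: (congr1 (fun F => F f) H).
  by rewrite H1 addrAC subrr add0r.
apply: weight_linear_ext.
- by move=> p q; rewrite (vfD hV) (vfD hE).
- by move=> p q; rewrite (vfD hV) (vfD hE) (vfD hV) scalerDr addrACA.
move=> k p hp; rewrite /E (weight_vectorP ha hp) (vfZ hV) -scalerDl.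
apply: cm_ext => x; apply: sl2_weight_eq.
have e z : V p (a (torus z) x) = cexp ((k - w) * z) * V p x.
  have := root_conj ha rE N2 p x (hw z); rewrite -/V sl2_derZ.
  have -> : pull (a (torus z)) p = cexp (k * z) *: p.
    by apply: cm_ext => y; rewrite pullE ?hp //; exact: sl2_morphism.
  rewrite (vfZ hV) cmZ -(root_ga_der ha rE N2) -/V => e.
  apply: (mulfI (cexp_neq0 (w * z))); rewrite -e mulrA -cexpD; congr (cexp _ * _); ring.
rewrite (_ : (fun _ => _) = fun z => cexp ((k - w) * z) * V p x); last exact/funext.
apply: isd_eq (isdM (isd_cexp _ _) (isd_cst _ _)) _.
by rewrite !mulr0 cexp0 cmZ mulr1 addr0.
Qed.

Lemma sl2_fieldsP : sl2_fields D U E.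
Proof.
split=> //.
- exact: sl2_bracket.
- move=> f; rewrite /D /sl2_raise (@torus_conj _ _ _ _ (- 2)) ?opprK // => z.
  apply: mx2P; rewrite !mul2E !torusE; do !rewrite mxE /=; rewrite ?mulr0 ?mul0r ?addr0 ?mulr1 ?mul1r //.
  by rewrite -cexpD; rewrite add0r; congr cexp; ring.
- move=> f; rewrite /U /sl2_lower (@torus_conj _ _ _ _ 2) // => z.
  apply: mx2P; rewrite !mul2E !torusE; do !rewrite mxE /=; rewrite ?mulr0 ?mul0r ?addr0 ?mulr1 ?mul1r //.
  by rewrite -cexpD; rewrite add0r; congr cexp; ring.
- exact: ga_nilpotent.
- exact: ga_nilpotent.
Qed.

(** f is constant on torus orbits, so the flow of f E through x is the torus run at the constant
    speed f(x). *)
Lemma torus_complete f : E f = 0 -> complete (fmul f E).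
Proof.
move=> Ef x; exists (fun t => a (torus (f x * t)) x); split.
  by rewrite mulr0 torus0; case: ha.
have fc z : f (a (torus z) x) = f x.
  have [K [m [c fE hc]]] := weight_decomposition ha f.
  pose u i := cexp ((i%:R : R)%:C%C).
  (* E f = 0 at the point torus i x; comparing powers of e^i leaves only the component of weight
     0. *)
  have Ef0 i : \sum_(j < K) ((j%:R - m%:R) * c j x) * u i ^+ j = \sum_(j < K) 0 * u i ^+ j.
    rewrite [RHS]big1 => [|j _]; last by rewrite mul0r.
    pose w := (i%:R : R)%:C%C.
    have : E f (a (torus w) x) = 0 by rewrite Ef.
    rewrite fE (vf_sum hE) cm_sum => e.
    apply: (mulIf (cexp_neq0 (- m%:R * w))); rewrite mul0r -[RHS]e mulr_suml.
    apply: eq_bigr => j _; rewrite /E (weight_vectorP ha (hc j (ltn_ord j))) cmZ (hc j (ltn_ord j)).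
    by rewrite [(_ - _) * w]mulrDl cexpD /u -/w cexpXn; ring.
  have cj := horner_sum_inj (c := fun j => (j%:R - m%:R) * c j x) (d := fun=> 0)
    (@cexp_nat_inj R) Ef0.
  rewrite fE !cm_sum; apply: eq_bigr => j _.
  rewrite (hc j (ltn_ord j)).
  have /eqP := cj j (ltn_ord j); rewrite mulf_eq0 => /orP[/eqP ->|/eqP ->].
    by rewrite mul0r cexp0 mul1r.
  by rewrite mulr0.
move=> g t; apply: isd_eq (torus_isd ha (f x) t g x) _.
by rewrite /fmul cmM fc.
Qed.

Definition complete_lie : set (CM -> CM) :=
  generated_lie_algebra [set V : CM -> CM | vector_field V /\ complete V].

Lemma complete_lie_subalgebra : lie_subalgebra complete_lie.
Proof.
split.
- move=> V; apply; split; last by move=> W [].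
  split; first by [].
  + exact: vector_field0.
  + by move=> c V1 V2; exact: vector_field_lin.
  + by move=> V1 V2; exact: vector_field_bracket.
- by move=> L' [[]].
- move=> c V W hV hW L' hL'; case: (hL') => -[_ _ h _] _; apply: h.
    exact: hV.
  exact: hW.
- move=> V W hV hW L' hL'; case: (hL') => -[_ _ _ h] _; apply: h.
    exact: hV.
  exact: hW.
Qed.

Lemma complete_lieP V : vector_field V -> complete V -> complete_lie V.
Proof. by move=> h1 h2 L' [_]; apply. Qed.

Lemma sl2_completeP : sl2_complete complete_lie D U E.
Proof.
split; first exact: sl2_fieldsP.
- move=> h hh; apply: complete_lieP; first exact: vector_field_fmul.
  exact: ga_complete.
- move=> h hh; apply: complete_lieP; first exact: vector_field_fmul.
  exact: ga_complete.
- move=> h hh; apply: complete_lieP; first exact: vector_field_fmul.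
  exact: torus_complete.
Qed.

Lemma det22 (A : 'M[C]_2) : \det A = A 0 0 * A 1 1 - A 0 1 * A 1 0.
Proof.
rewrite (expand_det_row _ 0) 2!big_ord_recl big_ord0 addr0 /cofactor !det_mx11 !mxE /=.
rewrite expr0 expr1 mul1r mulN1r mulrN.
have ext (i j i' j' : 'I_2) : val i = val i' -> val j = val j' -> A i j = A i' j'.
  by move=> /val_inj -> /val_inj ->.
by congr (_ + - _); congr (_ * _); apply: ext.
Qed.

Lemma upper_rootE t : ((upper_root t : 'M[C]_2) 0 0 = 1) * ((upper_root t : 'M[C]_2) 0 1 = t) *
  ((upper_root t : 'M[C]_2) 1 0 = 0) * ((upper_root t : 'M[C]_2) 1 1 = 1).
Proof. by rewrite !mxE /= ?mulr1 ?mulr0 ?addr0 ?add0r. Qed.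

Lemma lower_rootE t : ((lower_root t : 'M[C]_2) 0 0 = 1) * ((lower_root t : 'M[C]_2) 0 1 = 0) *
  ((lower_root t : 'M[C]_2) 1 0 = t) * ((lower_root t : 'M[C]_2) 1 1 = 1).
Proof. by rewrite !mxE /= ?mulr1 ?mulr0 ?addr0 ?add0r. Qed.

(** If g_10 is nonzero, g is a product upper-lower-upper whose lower factor has the entry g_10.
    Otherwise g_00 is nonzero, and multiplication by the lower root element at 1 leads back to that
    case. *)
Lemma SL2_generated (S : set (SL2 R)) :
  (forall t, S (upper_root t)) -> (forall t, S (lower_root t)) ->
  (forall g h, S g -> S h -> S (g * h)%g) -> forall g, S g.
Proof.
move=> Su Sl SM.
have fact (p c q : C) : let A := (upper_root p : 'M[C]_2) *m
    ((lower_root c : 'M[C]_2) *m (upper_root q : 'M[C]_2)) in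
    [/\ A 0 0 = 1 + p * c, A 0 1 = q + p * (c * q + 1), A 1 0 = c & A 1 1 = c * q + 1].
  move=> A; rewrite /A; move: (upper_rootE p) (lower_rootE c) (upper_rootE q).
  move: (SL2_mx (upper_root p)) (SL2_mx (lower_root c)) (SL2_mx (upper_root q)) => X Y Z hX hY hZ.
  by split; rewrite mul2E !(mul2E Y) !hX !hY !hZ; ring.
have key g : (g : 'M[C]_2) 1 0 != 0 -> S g.
  move=> c0.
  have : (g : 'M[C]_2) 0 0 * (g : 'M[C]_2) 1 1 - (g : 'M[C]_2) 0 1 * (g : 'M[C]_2) 1 0 = 1.
    by have /eqP := valP g; rewrite det22.
  have [g00 e00] : exists c, (g : 'M[C]_2) 0 0 = c by eexists.
  have [g01 e01] : exists c, (g : 'M[C]_2) 0 1 = c by eexists.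
  have [c e10] : exists c, (g : 'M[C]_2) 1 0 = c by eexists.
  have [g11 e11] : exists c, (g : 'M[C]_2) 1 1 = c by eexists.
  rewrite e00 e01 e10 e11 => dt; rewrite e10 in c0.
  pose p := (g00 - 1) / c; pose q := (g11 - 1) / c.
  have [f00 f01 f10 f11] := fact p c q.
  have -> : g = (upper_root p * (lower_root c * upper_root q))%g.
    apply: val_inj; apply: mx2P.
    - by rewrite [RHS]f00 [LHS]e00 /p; field.
    - rewrite [RHS]f01 [LHS]e01 /p /q.
      have -> : g01 = (g00 * g11 - 1) / c by rewrite -dt; field.
      by field.
    - by rewrite [RHS]f10 [LHS]e10.
    - by rewrite [RHS]f11 [LHS]e11 /q; field.
  by apply: (SM) => //; apply: (SM).
move=> g; have [c0|c0] := eqVneq ((g : 'M[C]_2) 1 0) 0; last exact: key.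
pose m : C := -1; pose p : C := 1.
have -> : g = (lower_root m * (lower_root p * g))%g.
  rewrite mulgA (_ : (lower_root m * lower_root p)%g = 1%g) ?mul1g //.
  apply: val_inj; change ((lower_root m : 'M[C]_2) *m lower_root p = 1%:M).
  move: (lower_rootE m) (lower_rootE p).
  move: (SL2_mx (lower_root m)) (SL2_mx (lower_root p)) => X Y hX hY.
  by apply: mx2P; rewrite mul2E !hX !hY !mxE /= /m /p; ring.
apply: (SM) => //; apply: key.
rewrite SL2_mulE mul2E c0 !lower_rootE mulr0 addr0 mul1r.
apply: contraTneq isT => g00.
have /eqP := valP g; rewrite det22 /= g00 c0 mul0r mulr0 subrr => /eqP.
by rewrite eq_sym oner_eq0.
Qed.

(** If D = 0, then E = [D, U] = 0 and - 2 U = [E, U] = 0, so both root subgroups act trivially. *)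
Lemma sl2_nontrivial : nontrivial_action a -> exists f, D f <> 0.
Proof.
move=> [g [x gx]]; apply: contrapT => noD.
have D0 f : D f = 0 by apply: contrapT => h; apply: noD; exists f.
have E0 f : E f = 0.
  by rewrite -sl2_bracket !D0 (vf0 hU) subrr.
have U0 f : U f = 0.
  have := sl2_EU sl2_fieldsP f; rewrite !E0 (vf0 hU) subrr => /esym/eqP.
  by rewrite scaler_eq0 oppr_eq0 pnatr_eq0 /= => /eqP.
apply: gx; move: g x; apply: SL2_generated.
- exact: (ga_der0_invariant U0).
- exact: (ga_der0_invariant D0).
- by case: ha => _ _ hM g h hg hh x; rewrite hM hh hg.
Qed.

Theorem sl2_action_submodule : irreducible M -> nontrivial_action a ->
  exists2 V : CM -> CM, V <> 0 & vector_field V /\ forall f, complete_lie (fmul f V).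
Proof.
move=> irr nt; have nD := sl2_nontrivial nt.
have [f|g g0 hg] := sl2_submodule complete_lie_subalgebra sl2_completeP irr _ nD.
  have [K [m [c fE hc]]] := weight_decomposition ha f.
  exists K, (fun i : 'I_K => c i) => //; exists (fun i : 'I_K => i%:Z - m%:Z) => i.
  by rewrite rmorphB; exact: (weight_vectorP ha (hc i (ltn_ord i))).
exists (fmul g E).
  (* E = 0 would give 2 D = [E, D] = 0. *)
  move=> gE0; have [f Df] := nD; apply: Df.
  have E0 (p : CM) : E p = 0.
    have : fmul g E p = 0 by rewrite gE0.
    by case/(cm_mul_eq0 irr).
  have := sl2_ED sl2_fieldsP f; rewrite !E0 (vf0 hD) subrr => /esym/eqP.
  by rewrite scaler_eq0 pnatr_eq0 /= => /eqP.
split; first exact: vector_field_fmul.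
move=> f; apply: lie_ext (hg f) _ => h.
by rewrite /fmul mulrA.
Qed.

End SL2Relations.

(** * The largest submodule of the Lie algebra *)

Section LieSubmodule.
Context {R : realType} {n : nat} {M : set 'rV[R[i]]_n}.
Local Notation C := R[i].
Local Notation CM := (coord_ring M).
Implicit Types (f g h : CM) (V W X Y : CM -> CM) (x y : M).

Local Notation L := (@complete_lie R n M).
Let hL := @complete_lie_subalgebra R n M.

(* The largest C[M]-submodule of the Lie algebra generated by the complete fields. *)
Definition lie_core : set (CM -> CM) :=
  [set V | vector_field V /\ forall f, L (fmul f V)].

Lemma lie_core_vf V : lie_core V -> vector_field V. Proof. by case. Qed.

Lemma lie_core_ext V W : lie_core V -> (forall h, W h = V h) -> lie_core W.
Proof. by move=> hV e; rewrite (_ : W = V) //; apply/funext. Qed.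

Lemma lie_core_lie V : lie_core V -> L V.
Proof. by move=> [_ h]; apply: lie_ext (h 1) _ => f; rewrite /fmul mul1r. Qed.

Lemma lie_core0 : lie_core (fun=> 0).
Proof.
split; first exact: vector_field0.
by move=> f; apply: lie_ext (lie0 hL) _ => h; rewrite /fmul mulr0.
Qed.

Lemma lie_coreD V W : lie_core V -> lie_core W -> lie_core (fun h => V h + W h).
Proof.
move=> [v1 h1] [v2 h2]; split.
  have := vector_field_lin 1 v1 v2.
  by rewrite (_ : _ *: _ + _ = fun h => V h + W h) //; apply/funext => h; rewrite !fctE scale1r.
by move=> f; apply: lie_ext (lieD hL (h1 f) (h2 f)) _ => h; rewrite /fmul mulrDr.
Qed.

Lemma lie_core_fmul f V : lie_core V -> lie_core (fmul f V).
Proof.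
move=> [v h]; split; first exact: vector_field_fmul.
by move=> g; apply: lie_ext (h (g * f)) _ => p; rewrite /fmul mulrA.
Qed.

Lemma lie_coreB V W : lie_core V -> lie_core W -> lie_core (fun h => V h - W h).
Proof.
move=> hV hW; apply: lie_core_ext (lie_coreD hV (lie_core_fmul (-1) hW)) _ => h.
by rewrite /fmul mulN1r.
Qed.

Lemma lie_core_sum (I : Type) (r : seq I) (F : I -> CM -> CM) :
  (forall i, lie_core (F i)) -> lie_core (fun h => \sum_(i <- r) F i h).
Proof.
move=> hF; elim: r => [|i r IH].
  by apply: lie_core_ext lie_core0 _ => h; rewrite big_nil.
by apply: lie_core_ext (lie_coreD (hF i) IH) _ => h; rewrite big_cons.
Qed.

Lemma lie_core_bracket V W : L V -> lie_core W -> lie_core (fun h => V (W h) - W (V h)).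
Proof.
move=> hV hW; have vV := lie_vf hL hV; have vW := lie_core_vf hW.
split; first exact: vector_field_bracket.
move=> f.
apply: lie_ext (lieD hL (lie_br hL hV (hW.2 f)) (lieZ hL (-1) (hW.2 (V f)))) _ => h.
rewrite /fmul (vfM vV) scaleN1r; ring.
Qed.

(** The saturation of [lie_core]: membership at the generic point of M. *)
Definition lie_core_sat : set (CM -> CM) :=
  [set V | vector_field V /\ exists2 h, h <> 0 & lie_core (fmul h V)].

Hypothesis irr : irreducible M.

Lemma cm_mul_neq0 f g : f <> 0 -> g <> 0 -> f * g <> 0.
Proof. by move=> f0 g0 /(cm_mul_eq0 irr)[]. Qed.

Lemma cm_mulI h f g : h <> 0 -> h * f = h * g -> f = g.
Proof.
move=> h0 e; apply/eqP; rewrite -subr_eq0; apply/eqP.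
have : h * (f - g) = 0 by rewrite mulrBr e subrr.
by case/(cm_mul_eq0 irr).
Qed.

Lemma cm_one_neq0 : (1 : CM) <> 0.
Proof.
case: irr => -[z Mz] _ e; pose x : M := exist _ z (mem_set Mz).
have := congr1 (fun f : CM => f x) e => /eqP.
by rewrite -[_ == _]/((1 : C) == 0) oner_eq0.
Qed.

Lemma cm_natmul_neq0 f k : f <> 0 -> f *+ k.+1 <> 0.
Proof.
move=> f0 e; apply: f0; apply: cm_ext => x.
have /eqP := congr1 (fun f : CM => f x) e.
by rewrite [_ == _](_ : _ = (f x *+ k.+1 == 0)) ?cmMn // mulrn_eq0 => /eqP.
Qed.

Section Slice.
Variable V : CM -> CM.
Hypothesis vV : vector_field V.
Variables (s : CM).
Hypothesis VVs : V (V s) = 0.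

Lemma slice_expr N c : V c = 0 -> V (s ^+ N * c) = s ^+ N.-1 * (V s * c) *+ N.
Proof.
move=> Vc; elim: N => [|N IH]; first by rewrite expr0 mul1r mulr0n.
rewrite exprS -mulrA (vfM vV) IH; case: N {IH} => [|N] /=.
  by rewrite expr0; ring.
by rewrite exprS mulrS; ring.
Qed.

Lemma slice_iter N c : V c = 0 -> iter N V (s ^+ N * c) = V s ^+ N * c *+ N`!.
Proof.
elim: N c => [|N IH] c Vc; first by rewrite !expr0.
rewrite iterSr slice_expr // -mulrnAr IH; last first.
  by rewrite (vfMn vV) (vfM vV) VVs Vc mul0r mulr0 addr0 mul0rn.
by rewrite -mulrnAr exprS factS mulrnA -!mulrnAr; ring.
Qed.

(** s is a local slice of V. If V^(N+1) f = 0, then N! (V s)^N f and s^N V^N f have the same image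
    under V^N, so induction applies to their difference, and W kills the nonzero multiple N! (V s)^N
    f of f. *)
Lemma slice_der0 W f N : vector_field W -> (forall c, V c = 0 -> W c = 0) -> W s = 0 ->
  V s <> 0 -> iter N V f = 0 -> W f = 0.
Proof.
move=> vW Wker Ws Vs0.
have Wsn k : W (s ^+ k) = 0.
  by elim: k => [|k IH]; rewrite ?expr0 ?(vf1 vW) // exprS (vfM vW) Ws IH mul0r mulr0 addr0.
have Van k : V (V s ^+ k) = 0.
  by elim: k => [|k IH]; rewrite ?expr0 ?(vf1 vV) // exprS (vfM vV) VVs IH mul0r mulr0 addr0.
have iB k p q : iter k V (p - q) = iter k V p - iter k V q.
  by elim: k => //= k ->; rewrite (vfB vV).
have iK k c p : V c = 0 -> iter k V (c * p) = c * iter k V p.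
  by move=> Vc; elim: k => //= k ->; rewrite (vfM vV) Vc mul0r add0r.
elim: N f => [f /= ->|N IH f Vf]; first exact: vf0.
set c := V s ^+ N *+ N`!.
have Vc : V c = 0 by rewrite /c (vfMn vV) Van mul0rn.
have Vg : V (iter N V f) = 0 by [].
have : W (c * f - s ^+ N * iter N V f) = 0.
  apply: IH; rewrite iB iK // slice_iter // /c; rewrite mulrnAl subrr //.
rewrite (vfB vW) !(vfM vW) (Wker _ Vc) (Wker _ Vg) Wsn !mul0r mulr0 add0r addr0 subr0.
case/(cm_mul_eq0 irr) => //; rewrite /c -(prednK (fact_gt0 N)).
move=> e; exfalso; move: e; apply: cm_natmul_neq0.
by elim: (N) => [|k]; [rewrite expr0; exact: cm_one_neq0|rewrite exprS; exact: cm_mul_neq0].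
Qed.

End Slice.

Lemma ga_lie al (hal : Ga_action al) h : ga_der hal (ga_der hal h) = 0 ->
  L (fmul h (ga_der hal)).
Proof.
move=> hh; apply: complete_lieP; last exact: ga_complete.
by apply: vector_field_fmul; exact: ga_der_vf.
Qed.

Lemma ga_lie1 al (hal : Ga_action al) : L (ga_der hal).
Proof.
have vd := ga_der_vf hal.
have h1 : L (fmul 1 (ga_der hal)) by apply: ga_lie; rewrite (vf1 vd) (vf0 vd).
by apply: lie_ext h1 _ => h; rewrite /fmul mul1r.
Qed.

Lemma ga_lie_core_sat al (hal : Ga_action al) :
  (exists2 V, lie_core V & V <> 0) -> lie_core_sat (ga_der hal).
Proof.
move=> [w hw w0]; set d := ga_der hal.
have vd : vector_field d := ga_der_vf hal.
have vw := lie_core_vf hw.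
split => //.
have [[f [df wf]]|no] := pselect (exists f, d f = 0 /\ w f <> 0).
  exists (w f) => //.
  have Lf : L (fmul f d) by apply: ga_lie; rewrite -/d df (vf0 vd).
  have h1 := lie_core_bracket Lf hw.
  have h2 := lie_core_fmul f (lie_core_bracket (ga_lie1 hal) hw).
  apply: lie_core_ext (lie_coreB h2 h1) _ => h.
  rewrite /fmul -/d (vfM vw); ring.
have wker c : d c = 0 -> w c = 0.
  by move=> dc; apply: contrapT => wc; apply: no; exists c.
have [d0|/existsNP[f df]] := pselect (forall f, d f = 0).
  exists 1; first exact: cm_one_neq0.
  by apply: lie_core_ext lie_core0 _ => h; rewrite /fmul d0 mulr0.
have [s [ds dds]] : exists s, d s <> 0 /\ d (d s) = 0.
  have [N hN] := ga_nilpotent hal f.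
  have ex : exists N, iter N d f == 0 by exists N; apply/eqP.
  case: (ex_minnP ex) => [[|[|k]]] /eqP hk km.
  - by case: df; rewrite (hk : f = 0) (vf0 vd).
  - by case: df.
  - exists (iter k d f); split; last exact: hk.
    by move=> /eqP /(km k.+1); rewrite ltnn.
(* This field kills ker d and the local slice s, hence is zero: w is proportional to d. *)
pose D h := d s * w h - w s * d h.
have vD : vector_field D.
  have := vector_field_lin (-1) (vector_field_fmul (w s) vd) (vector_field_fmul (d s) vw).
  by congr vector_field; apply/funext => h; rewrite !fctE /fmul scaleN1r addrC.
have D0 f' : D f' = 0.
  have [N hN] := ga_nilpotent hal f'.
  apply: (slice_der0 vd dds vD _ _ ds hN).
    by move=> c dc; rewrite /D dc wker // !mulr0 subrr.
  by rewrite /D mulrC subrr.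
exists (w s).
  move=> ws; apply: w0; apply/funext => h.
  have := D0 h; rewrite /D ws mul0r subr0 => /(cm_mul_eq0 irr)[//|].
  by [].
apply: lie_core_ext (lie_core_fmul (d s) hw) _ => h.
rewrite /fmul; have /eqP := D0 h; rewrite subr_eq0 => /eqP -> //.
Qed.

End LieSubmodule.

(** * Transport by automorphisms *)

Section Pushforward.
Context {R : realType} {n : nat} {M : set 'rV[R[i]]_n}.
Local Notation C := R[i].
Local Notation CM := (coord_ring M).
Implicit Types (f g h : CM) (V W X Y : CM -> CM) (x y : M).
Variables (phi psi : M -> M).
Hypothesis phi_reg : is_morphism val phi.
Hypothesis psi_reg : is_morphism val psi.
Hypothesis phiK : cancel phi psi.
Hypothesis psiK : cancel psi phi.

Let pE f x : pull phi f x = f (phi x). Proof. exact: pullE. Qed.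
Let qE f x : pull psi f x = f (psi x). Proof. exact: pullE. Qed.

Definition pushforward V : CM -> CM := fun h => pull psi (V (pull phi h)).

Lemma pushforwardE V h x : pushforward V h (phi x) = V (pull phi h) x.
Proof. by rewrite /pushforward qE phiK. Qed.

Lemma pushforward_vf V : vector_field V -> vector_field (pushforward V).
Proof.
move=> hV; rewrite /pushforward; split=> [c f g|f g].
  have -> : pull phi (c *: f + g) = c *: pull phi f + pull phi g.
    by apply: cm_ext => x; rewrite cmD cmZ !pE.
  by rewrite !(vfE hV); apply: cm_ext => x; rewrite cmD cmZ !qE.
have -> : pull phi (f * g) = pull phi f * pull phi g.
  by apply: cm_ext => x; rewrite cmM !pE.
rewrite (vfM hV); apply: cm_ext => x.
by rewrite cmD !cmM !qE cmD !cmM !pE psiK.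
Qed.

Lemma pushforward_complete V : complete V -> complete (pushforward V).
Proof.
move=> hV x; have [c [c0 hc]] := hV (psi x).
exists (fun t => phi (c t)); split; first by rewrite c0 psiK.
move=> f t; rewrite pushforwardE.
have := hc (pull phi f) t; congr (is_derive _ _ _ _).
by apply/funext => s; rewrite pE.
Qed.

(** The fields whose push-forward lies in the generated algebra form a Lie subalgebra, and it
    contains the complete ones. *)
Lemma pushforward_lie V : complete_lie V -> complete_lie (pushforward V).
Proof.
pose S := [set V | vector_field V /\ complete_lie (pushforward V)].
have hL := @complete_lie_subalgebra R n M.
suff H : lie_subalgebra S.
  move=> hV; suff [] : S V by [].
  apply: hV; split=> // W [vW cW]; split=> //; apply: complete_lieP.
    exact: pushforward_vf.
  exact: pushforward_complete.
split.
- by move=> W [].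
- split; first exact: vector_field0.
  apply: lie_ext (lie0 hL) _ => h; apply: cm_ext => x; rewrite /pushforward qE //.
- move=> c W W' [v1 h1] [v2 h2]; split; first exact: vector_field_lin.
  apply: lie_ext (lieD hL (lieZ hL c h1) h2) _ => h; apply: cm_ext => x.
  by rewrite cmD cmZ /pushforward !qE.
- move=> W W' [v1 h1] [v2 h2]; split; first exact: vector_field_bracket.
  apply: lie_ext (lie_br hL h1 h2) _ => h; apply: cm_ext => x.
  have e (Z : CM -> CM) : pull phi (pushforward Z h) = Z (pull phi h).
    by apply: cm_ext => y; rewrite pE pushforwardE.
  by rewrite -(psiK x) pushforwardE /lie_bracket !(cmD, cmN) !pushforwardE !e.
Qed.

Lemma pushforward_fmul f V h : pushforward (fmul (pull phi f) V) h = fmul f (pushforward V) h.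
Proof.
apply: cm_ext => x; rewrite -(psiK x) pushforwardE /fmul !cmM pushforwardE pE //.
Qed.

Lemma pullK f : pull phi (pull psi f) = f.
Proof. by apply: cm_ext => x; rewrite pE qE phiK. Qed.

Lemma pushforward_lie_core V : lie_core V -> lie_core (pushforward V).
Proof.
move=> [vV hV]; split; first exact: pushforward_vf.
move=> f; apply: lie_ext (pushforward_lie (hV (pull phi f))) _ => h.
by rewrite pushforward_fmul.
Qed.

Lemma pushforward_lie_core_sat V : lie_core_sat V -> lie_core_sat (pushforward V).
Proof.
move=> [vV [h h0 hV]]; split; first exact: pushforward_vf.
exists (pull psi h).
  by move=> e; apply: h0; rewrite -(pullK h) e; apply: cm_ext => x; rewrite pE.
apply: lie_core_ext (pushforward_lie_core hV) _ => p.
by rewrite -pushforward_fmul pullK.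
Qed.

End Pushforward.

(** * The generic rank of the core *)

Section Rank.
Context {R : realType} {n : nat} {M : set 'rV[R[i]]_n}.
Local Notation C := R[i].
Local Notation CM := (coord_ring M).
Implicit Types (f g h : CM) (V W Y : CM -> CM) (x y : M).
Hypothesis irr : irreducible M.

Definition jacobian k (X : 'I_k -> CM -> CM) (sg : 'I_k -> 'I_n) : 'M[CM]_k :=
  \matrix_(i, j) X i (coordf (sg j)).

Definition independent_core (k : nat) := exists X : 'I_k -> CM -> CM,
  exists2 sg, forall i, lie_core (X i) & \det (jacobian X sg) <> 0.

(** Beyond n some coordinate is repeated and the minor has two equal columns. *)
Lemma independent_core_le k : independent_core k -> (k <= n)%N.
Proof.
move=> [X [sg _ d0]]; rewrite leqNgt; apply/negP => nk; apply: d0.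
have [i [j [ij e]]] : exists i j, i != j /\ sg i = sg j.
  apply: contrapT => no; have inj : injective sg.
    move=> i j e; apply/eqP; apply: contraT => ij; exfalso.
    by apply: no; exists i, j.
  by have := leq_card sg inj; rewrite !card_ord leqNgt nk.
rewrite -det_tr; apply: (determinant_alternate ij) => l.
by rewrite !mxE e.
Qed.

Lemma independent_core0 : independent_core 0.
Proof.
exists (fun _ _ => 0), (fun i : 'I_0 => match i with Ordinal m lt => match notF lt with end end) => [[]//|].
rewrite det_mx00; exact: cm_one_neq0.
Qed.

(* Fraction-free Cramer's rule: the bordered minors of a maximal nonzero minor vanish. *)
Lemma cramer_core : exists k (sg : 'I_k -> 'I_n) (B : 'I_k -> CM -> CM), exists2 d : CM, d <> 0 &
  (forall j, lie_core (B j)) /\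
  forall V, lie_core_sat V -> forall h, d * V h = \sum_j V (coordf (sg j)) * B j h.
Proof.
have [k [hk kmax]] : exists k, independent_core k /\ forall k', independent_core k' -> (k' <= k)%N.
  have ex : exists k, `[< independent_core k >].
    by exists 0%N; apply/asboolP; exact: independent_core0.
  have ub k : `[< independent_core k >] -> (k <= n)%N.
    by move/asboolP; exact: independent_core_le.
  case: (ex_maxnP ex ub) => k /asboolP hk kmax; exists k; split=> // k' hk'.
  by apply: kmax; exact/asboolP.
have [X [sg hX d0]] := hk; set A := jacobian X sg in d0; set d := \det A in d0.
(* Up to the factor d, these fields are dual to the chosen coordinates: B_j maps the j-th of them to
   d and the others to 0. *)
pose B j h := \sum_i (\adj A) j i * X i h.
have hB j : lie_core (B j).
  by apply: lie_core_sum => i; exact: lie_core_fmul.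
exists k, sg, B, d => //; split=> //.
have main V l : lie_core V -> d * V (coordf l) = \sum_j V (coordf (sg j)) * B j (coordf l).
  move=> hV.
  pose b : 'cV[CM]_k := \col_i X i (coordf l).
  pose v : 'rV[CM]_k := \row_j V (coordf (sg j)).
  pose w : 'M[CM]_1 := (V (coordf l))%:M.
  (* Otherwise V and the coordinate l would enlarge the maximal minor. *)
  have det0 : \det (block_mx A b v w) = 0.
    apply: contrapT => dn0; have : (k + 1 <= k)%N; last by rewrite addn1 ltnn.
    apply: kmax.
    exists (fun i => match fintype.split i with inl i => X i | inr _ => V end).
    exists (fun i => match fintype.split i with inl i => sg i | inr _ => l end).
      by move=> i; case: fintype.split.
    rewrite (_ : jacobian _ _ = block_mx A b v w) //.
    have sl (i : 'I_k) : fintype.split (lshift 1 i) = inl i := unsplitK (inl i).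
    have sr (i : 'I_1) : fintype.split (rshift k i) = inr i := unsplitK (inr i).
    apply/matrixP => i j; rewrite mxE.
    case: (split_ordP i) => i' ->; case: (split_ordP j) => j' ->; rewrite ?sl ?sr.
    - by rewrite block_mxEul mxE.
    - by rewrite block_mxEur mxE.
    - by rewrite block_mxEdl mxE.
    - by rewrite block_mxEdr (ord1 i') (ord1 j') mxE eqxx mulr1n.
  (* Right multiplication by this matrix clears the column b, so the product of determinants is d (d
     V(x_l) - v adj(A) b). *)
  have := congr1 (fun z => z * \det (block_mx (1%:M : 'M_k) (- (\adj A *m b)) 0 (d%:M : 'M_1))) det0.
  rewrite mul0r -det_mulmx mulmx_block !mulmx0 !mulmx1 !addr0 mulmxN mulmxA mul_mx_adj -/d.
  rewrite mul_scalar_mx mul_mx_scalar addNr det_lblock -/d => /(cm_mul_eq0 irr)[//|].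
  have E : (v *m - (\adj A *m b) + w *m d%:M) 0 0 =
      d * V (coordf l) - \sum_j v 0 j * (\adj A *m b) j 0.
    by rewrite mulmxN mul_mx_scalar !mxE mulr1n addrC.
  rewrite det_mx11 E => /eqP; rewrite subr_eq0 => /eqP ->.
  apply: eq_bigr => j _; rewrite !mxE; congr (_ * _).
  by apply: eq_bigr => i _; rewrite !mxE.
have sumvf V : vector_field (fun h => \sum_j V (coordf (sg j)) * B j h).
  by apply: lie_core_vf; apply: lie_core_sum => j; exact: lie_core_fmul.
have main' V h : lie_core V -> d * V h = \sum_j V (coordf (sg j)) * B j h.
  move=> hV.
  have : fmul d V = (fun h => \sum_j V (coordf (sg j)) * B j h).
    apply: vector_field_ext; [|exact: sumvf|by move=> l; exact: main].
    by apply: vector_field_fmul; exact: lie_core_vf.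
  by move/(congr1 (fun F => F h)).
(* The identity holds for p V in the core, and both sides are linear in the field over C[M]. *)
move=> V [vV [p p0 pV]] h; apply: (cm_mulI irr p0).
rewrite mulrCA (main' _ h pV) mulr_sumr; apply: eq_bigr => j _.
by rewrite /fmul mulrA.
Qed.

End Rank.

(** * Dominant flow maps *)

Section PolynomialZeros.
Context {R : realType}.
Local Notation C := R[i].

Definition update_fun m (v : 'I_m -> C) (k : 'I_m) (s : C) : 'I_m -> C :=
  fun j => if j == k then s else v j.

Lemma update_fun_id m (v : 'I_m -> C) k : update_fun v k (v k) = v.
Proof. by apply/funext => j; rewrite /update_fun; case: eqP => // ->. Qed.

Lemma isd_mderiv m (p : mpoly.mpoly m C) (v : 'I_m -> C) k :
  isd (fun s => mpoly.meval (update_fun v k s) p) (v k) (mpoly.meval v (mpoly.mderiv k p)).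
Proof.
have hd j : isd (fun s => update_fun v k s j) (v k) ((j == k)%:R).
  rewrite /update_fun; case: eqP => _; [exact: isd_id|exact: isd_cst].
apply: isd_eq (isd_meval p hd) _; rewrite (bigD1 k) //= big1 ?addr0 => [|j jk].
  by rewrite eqxx mulr1; congr (mpoly.meval _ _); exact: update_fun_id.
by rewrite (negPf jk) mulr0.
Qed.

(** Induction on the degree: the partial derivatives vanish everywhere too, hence are zero, and the
    polynomial is constant. *)
Lemma mpoly_eq0 m (p : mpoly.mpoly m C) : (forall v, mpoly.meval v p = 0) -> p = 0.
Proof.
pose small k (q : mpoly.mpoly m C) := forall mm, (k <= mpoly.mdeg mm)%N -> mpoly.mcoeff mm q = 0.
have : small (mpoly.msize p) p.
  move=> mm; apply: contraTeq; rewrite -mpoly.mcoeff_msupp => /mpoly.msize_mdeg_lt.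
  by rewrite ltnNge.
move: (mpoly.msize p) => k; elim: k p => [|k IH] q sq q0.
  by apply/mpoly.mpolyP => mm; rewrite mpoly.mcoeff0 sq.
have dq i : mpoly.mderiv i q = 0.
  apply: IH => [mm kmm|v].
    by rewrite mpoly.mcoeff_mderiv sq ?mul0rn // mpoly.mdegD mpoly.mdeg1 addn1.
  apply: isd_unique (isd_mderiv q v i) _.
  rewrite (_ : (fun _ => _) = fun=> 0); first exact: isd_cst.
  by apply/funext => s; rewrite q0.
have cq mm : mm <> mpoly.mnm0 -> mpoly.mcoeff mm q = 0.
  move=> mm0; have [i mi] : exists i, mm i != 0%N.
    apply: contrapT => no; apply: mm0; apply/mpoly.mnmP => i; rewrite mpoly.mnm0E.
    by apply/eqP; apply: contraT => h; exfalso; apply: no; exists i.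
  have := mpoly.mcoeff_mderiv i q (mpoly.mnm_sub mm (mpoly.mnm1 i)).
  rewrite dq mpoly.mcoeff0 mpoly.submK ?mpoly.lep1mP // => /esym/eqP.
  by rewrite mulrn_eq0 /= => /eqP.
have qC : q = mpoly.mpolyC m (mpoly.mcoeff mpoly.mnm0 q).
  apply/mpoly.mpolyP => mm; rewrite mpoly.mcoeffC.
  by case: eqP => [->|/eqP]; [rewrite mulr1|rewrite mulr0 => /eqP/cq].
by have := q0 (fun=> 0); rewrite qC mpoly.mevalC => ->; rewrite mpoly.mpolyC0.
Qed.

Lemma mpoly_eq m (p q : mpoly.mpoly m C) :
  (forall v : 'rV[C]_m, mpoly.meval (v 0) p = mpoly.meval (v 0) q) -> p = q.
Proof.
move=> h; apply/eqP; rewrite -subr_eq0; apply/eqP; apply: mpoly_eq0 => v.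
have := h (\row_j v j); rewrite mpoly.mevalB => e.
have ev : ((\row_j v j) 0 : 'I_m -> C) =1 v by move=> j; rewrite mxE.
by apply/eqP; rewrite subr_eq0 -!(mpoly.meval_eq _ ev) e.
Qed.

End PolynomialZeros.

Section Automorphisms.
Context {R : realType} {n : nat} {M : set 'rV[R[i]]_n}.
Local Notation C := R[i].

Lemma automorphism_subgroup : aut_subgroup (@automorphism R n M).
Proof.
split=> //.
- split; first by move=> j; exact: regular_coord.
  by exists id; split=> // j; exact: regular_coord.
- move=> p q [mp [p' [mp' pK Kp]]] [mq [q' [mq' qK Kq]]]; split.
    by move=> j; apply: (regular_comp (mp j)) => i; exact: mq.
  exists (q' \o p'); split.
  + by move=> j; apply: (regular_comp (mq' j)) => i; exact: mp'.
  + by move=> y /=; rewrite pK qK.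
  + by move=> y /=; rewrite Kq Kp.
- move=> p q [mp [p' [mp' pK' Kp']]] pK Kp.
  have qp' : q = p' by apply/funext => y; apply: (can_inj pK); rewrite Kp Kp'.
  by split; [rewrite qp'|exists p; split].
Qed.

Variable al : C -> M -> M.
Hypothesis hal : Ga_action al.

Lemma Ga_cancel t : cancel (al t) (al (- t)).
Proof. by case: hal => _ a0 aD x; rewrite -aD addNr a0. Qed.

Lemma Ga_cancelN t : cancel (al (- t)) (al t).
Proof. by have := Ga_cancel (- t); rewrite opprK. Qed.

Lemma Ga_automorphism t : automorphism (al t).
Proof.
split; first exact: ga_morphism.
by exists (al (- t)); split; [exact: ga_morphism|exact: Ga_cancel|exact: Ga_cancelN].
Qed.

End Automorphisms.

Lemma SAut_automorphism (R : realType) (n : nat) (M : set 'rV[R[i]]_n) (phi : M -> M) :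
  SAut phi -> automorphism phi.
Proof.
apply; split; first exact: automorphism_subgroup.
by move=> _ [al [t [hal ->]]]; exact: Ga_automorphism.
Qed.

Section FlowMaps.
Context {R : realType} {n : nat} {M : set 'rV[R[i]]_n}.
Local Notation C := R[i].
Local Notation CM := (coord_ring M).
Implicit Types (f g h : CM) (V W Y : CM -> CM) (x y : M).
Hypothesis irr : irreducible M.
Hypothesis core : exists2 V : CM -> CM, lie_core V & V <> 0.

Definition update m (v : 'rV[C]_m) (k : 'I_m) (s : C) : 'rV[C]_m :=
  \row_j (if j == k then s else v 0 j).

(** Each partial derivative at v is the value at Phi v of a field in the saturated core; the field
    may depend on v. *)
Definition flow_map N (Phi : 'rV[C]_N -> M) :=
  is_morphism (fun v : 'rV[C]_N => v) Phi /\
  forall v k, exists2 Y, lie_core_sat Y &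
    forall h, isd (fun s => h (Phi (update v k s))) (v 0 k) (Y h (Phi v)).

Lemma flow_map_cst x : flow_map (fun _ : 'rV[C]_0 => x).
Proof. by split=> [j|v [[]]] //; exact: regular_cst. Qed.

Definition flow_step (al : C -> M -> M) N (Phi : 'rV[C]_N -> M) : 'rV[C]_(1 + N) -> M :=
  fun v => al (v 0 (lshift N 0)) (Phi (rsubmx v)).

(** The new parameter moves along the field of [al], which is in the saturation; the old tangent
    fields are carried along by the automorphism [al t]. *)
Lemma flow_map_step al N (Phi : 'rV[C]_N -> M) : Ga_action al -> flow_map Phi ->
  flow_map (flow_step al Phi).
Proof.
move=> hal [reg tan]; split.
  case: (hal) => hm _ _ j.
  apply: (regular_comp (phi := fun v : 'rV[C]_(1 + N) => (v 0 (lshift N 0), Phi (rsubmx v))) (hm j)) => k.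
  case: (split_ordP k) => l ->.
    apply: regular_ext (regular_coord _ (lshift N 0)) => v.
    by rewrite row_mxEl mxE.
  have h : regular (fun v : 'rV[C]_(1 + N) => v) (fun v => val (Phi (rsubmx v)) 0 l).
    apply: (regular_comp (phi := fun v : 'rV[C]_(1 + N) => rsubmx v) (reg l)) => i.
    by apply: regular_ext (regular_coord _ (rshift 1 i)) => v; rewrite mxE.
  by apply: regular_ext h => v; rewrite row_mxEr.
move=> v k; case: (split_ordP k) => l ->.
  exists (ga_der hal); first exact: ga_lie_core_sat.
  move=> h; rewrite (ord1 l).
  have := ga_isd hal h (Phi (rsubmx v)) (v 0 (lshift N 0)).
  congr isd; apply/funext => s; rewrite /flow_step mxE eqxx; congr (h (al s (Phi _))).
  by apply/rowP => j; rewrite !mxE eq_rlshift.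
have [Y hY tY] := tan (rsubmx v) l.
set t := v 0 (lshift N 0).
have [alK alK'] := (Ga_cancel hal t, Ga_cancelN hal t).
exists (pushforward (al t) (al (- t)) Y).
  by apply: pushforward_lie_core_sat => //; exact: ga_morphism.
move=> h; rewrite /flow_step pushforwardE //; last exact: ga_morphism.
have := tY (pull (al t) h); rewrite mxE; congr isd; apply/funext => s.
rewrite pullE; last exact: ga_morphism.
congr (h (al _ (Phi _))); first by rewrite mxE eq_lrshift.
by apply/rowP => j; rewrite !mxE (inj_eq (@rshift_inj _ _)).
Qed.

Definition image_closure N (Phi : 'rV[C]_N -> M) : set 'rV[C]_n :=
  zero_locus (vanishing_ideal [set val (Phi v) | v in setT]).

Lemma image_closureP N (Phi : 'rV[C]_N -> M) z : image_closure Phi z <->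
  forall P, (forall v, mpoly.meval (val (Phi v) 0) P = 0) -> mpoly.meval (z 0) P = 0.
Proof.
split=> [h P hP|h P hP].
  by apply: h => _ [v _ <-]; exact: hP.
by apply: h => v; apply: hP; exists v.
Qed.

Lemma image_closure_in N (Phi : 'rV[C]_N -> M) v : image_closure Phi (val (Phi v)).
Proof. by apply/image_closureP => P. Qed.

(** Irreducibility is inherited from C^N, whose polynomial ring is a domain. *)
Lemma image_closure_variety N (Phi : 'rV[C]_N -> M) :
  is_morphism (fun v : 'rV[C]_N => v) Phi -> affine_variety (image_closure Phi).
Proof.
move=> reg; split; first by eexists.
split; first by exists (val (Phi 0)); exact: image_closure_in.
move=> Y Z [S ->] [S' ->] sub.
have [hY|/existsNP[P hP]] := pselect (forall P, S P -> forall v, mpoly.meval (val (Phi v) 0) P = 0).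
  left=> z /image_closureP hz P SP; apply: hz => v; exact: hY.
have [SP /existsNP[v0 hv0]] : S P /\ ~ forall v, mpoly.meval (val (Phi v) 0) P = 0.
  by split; [apply: contrapT => h|move=> h]; apply: hP.
right=> z /image_closureP hz Q SQ; apply: hz => v1.
have reg' P' : regular (fun v : 'rV[C]_N => v) (fun v => mpoly.meval (val (Phi v) 0) P').
  exact: (@regular_meval _ _ _ _ _ _ (fun j v => val (Phi v) 0 j) reg).
have [p hp] := reg' P; have [q hq] := reg' Q.
have pq : p * q = 0.
  apply: mpoly_eq => v; rewrite mpoly.mevalM mpoly.meval0 -hp -hq.
  have [h|h] := sub _ (image_closure_in (Phi := Phi) v).
    by rewrite (h P SP) mul0r.
  by rewrite (h Q SQ) mulr0.
move/eqP: pq; rewrite mulf_eq0 => /orP[/eqP p0|/eqP q0].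
  by case: hv0; rewrite hp p0 mpoly.meval0.
by rewrite hq q0 mpoly.meval0.
Qed.

Hypothesis M_closed : zariski_closed M.

Lemma image_closure_sub N (Phi : 'rV[C]_N -> M) : image_closure Phi `<=` M.
Proof.
case: M_closed => S MS z /image_closureP hz; rewrite MS => P SP; apply: hz => v.
have : M (val (Phi v)) by exact/set_mem/(valP (Phi v)).
by rewrite {1}MS; apply.
Qed.

(* A flow map whose image closure cannot be enlarged is dominant. *)
Lemma dominant_flow_map d : has_dimension M d -> SAut_transitive M ->
  exists N, exists2 Phi : 'rV[C]_N -> M, flow_map Phi &
    forall f, (forall v, f (Phi v) = 0) -> f = 0.
Proof.
move=> [_ dmax] trans.
have [x0 _] : exists x0 : M, True.
  by case: irr => -[z Mz] _; exists (exist _ z (mem_set Mz)).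
(* Chains ending in the image closure serve as a measure of its dimension, bounded by [d]. *)
pose good k := exists N, exists Phi : 'rV[C]_N -> M, flow_map Phi /\
  exists2 Z, irreducible_chain M k Z & Z k = image_closure Phi.
have good0 : good 0%N.
  exists 0%N, (fun=> x0); split; first exact: flow_map_cst.
  exists (fun=> image_closure (fun _ : 'rV[C]_0 => x0)) => //; split=> // i _; split.
    by apply: image_closure_variety; case: (flow_map_cst x0).
  exact: image_closure_sub.
have goodd k : good k -> (k <= d)%N by move=> [N [Phi [_ [Z hZ _]]]]; exact: dmax hZ.
have [k [gk kmax]] : exists k, good k /\ forall k', good k' -> (k' <= k)%N.
  have ex : exists k, `[< good k >] by exists 0%N; exact/asboolP.
  have ub k : `[< good k >] -> (k <= d)%N by move/asboolP; exact: goodd.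
  case: (ex_maxnP ex ub) => k /asboolP hk kmax; exists k; split=> // k' hk'.
  by apply: kmax; exact/asboolP.
have [N [Phi [fPhi [Z [hZ1 hZ2] Zk]]]] := gk.
exists N, Phi => //.
have stab al t : Ga_action al -> forall y : M, image_closure Phi (val y) ->
    image_closure Phi (val (al t y)).
  move=> hal; pose Phi' := flow_step al Phi.
  have fPhi' : flow_map Phi' by exact: flow_map_step.
  (* The old image is the part of the new one at time 0. *)
  have sub : image_closure Phi `<=` image_closure Phi'.
    move=> z /image_closureP hz; apply/image_closureP => P hP; apply: hz => v.
    have := hP (row_mx 0 v); rewrite /Phi' /flow_step row_mxEl mxE row_mxKr.
    by case: (hal) => _ -> _.
  (* Otherwise the new closure would prolong a chain of maximal length. *)
  have sub' : image_closure Phi' `<=` image_closure Phi.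
    apply: contrapT => nsub; have : (k.+1 <= k)%N; last by rewrite ltnn.
    apply: kmax; exists (1 + N)%N, Phi'; split=> //.
    exists (fun i => if (i <= k)%N then Z i else image_closure Phi'); last first.
      by rewrite ltnn.
    split=> i ik.
      case: leqP => [/hZ1 //|_]; split; last exact: image_closure_sub.
      by apply: image_closure_variety; case: fPhi'.
    rewrite -ltnS ik; move: ik; rewrite ltnS leq_eqVlt => /orP[/eqP ->|ik].
      rewrite ltnn Zk; split=> // e; exact: nsub.
    by rewrite ik; exact: hZ2.
  move=> y /image_closureP hy; apply/image_closureP => P hP.
  have [q hq] := @regular_meval _ _ _ (val : M -> 'rV[C]_n) _ P
    (fun j y => val (al t y) 0 j) (ga_morphism t hal).
  rewrite hq; apply: hy => v; rewrite -hq.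
  have := sub' _ (image_closure_in (Phi := Phi') (row_mx (const_mx t : 'rV_1) v)).
  by rewrite /Phi' /flow_step row_mxEl mxE row_mxKr => /image_closureP; exact.
have stabS phi : SAut phi -> forall y, image_closure Phi (val y) -> image_closure Phi (val (phi y)).
  pose inv (phi : M -> M) := forall y : M, image_closure Phi (val y) -> image_closure Phi (val (phi y)).
  (* Invariance under the inverse is built in, because a subgroup has to be closed under
     inversion. *)
  pose G := [set phi : M -> M | automorphism phi /\ inv phi /\
      forall psi, cancel phi psi -> cancel psi phi -> inv psi].
  suff H : aut_subgroup G.
    move=> hphi; have [_ [h _]] : G phi; last exact: h.
    apply: hphi; split=> // _ [al [t [hal ->]]]; split; last split.
    - exact: Ga_automorphism.
    - exact: stab.
    - move=> psi pK Kp y hy; rewrite (_ : psi y = al (- t) y); first exact: stab.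
      by apply: (can_inj pK); rewrite Kp Ga_cancelN.
  have [_ autid autcomp autinv] := @automorphism_subgroup R n M.
  split.
  - by move=> p [].
  - split; first exact: autid.
    split => //; by move=> psi pK _ y; have := pK y; rewrite /= => ->.
  - move=> p q [ap [ip jp]] [aq [iq jq]]; split; first exact: autcomp.
    split; first by move=> y hy; apply: ip; exact: iq.
    move=> psi pK Kp y hy.
    have [_ [p' [_ pK' Kp']]] := ap; have [_ [q' [_ qK' Kq']]] := aq.
    rewrite (_ : psi y = q' (p' y)); last first.
      apply: (can_inj pK); rewrite Kp /= Kq' Kp' //.
    by apply: jq qK' Kq' _ _; apply: jp pK' Kp' _ _.
  - move=> p q [ap [ip jp]] pK Kp; split; first exact: autinv ap pK Kp.
    split; first exact: jp.
    move=> psi qK Kq; rewrite (_ : psi = p) //; apply/funext => y.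
    by apply: (can_inj qK); rewrite Kq pK.
move=> f hf; apply: cm_ext => y.
have [P hP] := regular_funP f.
(* By transitivity the closure contains every point of M, so an f that vanishes on the image
   vanishes on M. *)
have [phi [hphi <-]] := trans (Phi 0) y.
have := stabS phi hphi (Phi 0) (image_closure_in (Phi := Phi) 0) => /image_closureP h.
by rewrite hP; apply: h => v; rewrite -hP hf.
Qed.

End FlowMaps.

(** * Extension of derivations *)

Section DualSubrings.
Variable A : idomainType.
Hypothesis char0 : forall k, k.+1%:R != 0 :> A.
Implicit Types (D : A -> A -> Prop) (p q : {poly A}).

(* A subring of the dual numbers A[eps], as the set of the pairs (a, a') with a + a' eps
   in it. When it is functional, it is the graph of a derivation from a subring of A
   to A. *)
Record dual_subring D : Prop := DualSubring {
  dual0 : D 0 0;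
  dual1 : D 1 0;
  dualD : forall a a' b b', D a a' -> D b b' -> D (a + b) (a' + b');
  dualN : forall a a', D a a' -> D (- a) (- a');
  dualM : forall a a' b b', D a a' -> D b b' -> D (a * b) (a * b' + a' * b) }.

Definition functional_dual D := forall a', D 0 a' -> a' = 0.

Definition poly_dual D p q := forall i, D p`_i q`_i.

Section PolyDual.
Variable D : A -> A -> Prop.
Hypothesis hD : dual_subring D.

Lemma dual_sum (I : Type) (r : seq I) (F F' : I -> A) :
  (forall i, D (F i) (F' i)) -> D (\sum_(i <- r) F i) (\sum_(i <- r) F' i).
Proof.
by move=> h; elim/big_rec2: _ => [|i y y' _ hy]; [exact: dual0|apply: dualD].
Qed.

Lemma dual_natmul a a' k : D a a' -> D (a *+ k) (a' *+ k).
Proof.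
by move=> h; elim: k => [|k IH]; rewrite ?mulr0n ?mulrS; [exact: dual0|apply: dualD].
Qed.

Lemma poly_dualC a a' : D a a' -> poly_dual D a%:P a'%:P.
Proof. by move=> h i; rewrite !coefC; case: eqP => // _; exact: dual0. Qed.

Lemma poly_dualD p q p' q' : poly_dual D p q -> poly_dual D p' q' ->
  poly_dual D (p + p') (q + q').
Proof. by move=> h h' i; rewrite !coefD; apply: dualD. Qed.

Lemma poly_dualN p q : poly_dual D p q -> poly_dual D (- p) (- q).
Proof. by move=> h i; rewrite !coefN; apply: dualN. Qed.

Lemma poly_dualM p q p' q' : poly_dual D p q -> poly_dual D p' q' ->
  poly_dual D (p * p') (p * q' + q * p').
Proof.
by move=> h h' i; rewrite coefD !coefM -big_split; apply: dual_sum => j; apply: dualM.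
Qed.

Lemma poly_dualXn k : poly_dual D 'X^k 0.
Proof.
move=> i; rewrite coefXn coef0; case: eqP => _; [exact: dual1|exact: dual0].
Qed.

Lemma poly_dual_deriv p q : poly_dual D p q -> poly_dual D p^`() q^`().
Proof. by move=> h i; rewrite !coef_deriv; apply: dual_natmul. Qed.

(** The graph of e D, extended to polynomials in u by sending u to v. It is only a relation until
    consistency is proved. *)
Definition dual_adjoin (u e v : A) (x y : A) := exists p q,
  [/\ poly_dual D p q, x = p.[u] & y = e * q.[u] + p^`().[u] * v].

Lemma dual_adjoin_subring u e v : dual_subring (dual_adjoin u e v).
Proof.
split.
- exists 0, 0; split; rewrite ?deriv0 ?horner0 ?mulr0 ?mul0r ?addr0 //.
  by move=> i; rewrite !coef0; exact: dual0.
- exists 1, 0; split; rewrite ?derivC ?hornerC ?horner0 ?mulr0 ?mul0r ?addr0 //.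
  by rewrite -(expr0 'X); exact: poly_dualXn.
- move=> a a' b b' [p [q [h -> ->]]] [p' [q' [h' -> ->]]].
  exists (p + p'), (q + q'); split; rewrite ?derivD ?hornerD //; first exact: poly_dualD.
  ring.
- move=> a a' [p [q [h -> ->]]]; exists (- p), (- q).
  split; rewrite ?derivN ?hornerN //; first exact: poly_dualN.
  ring.
- move=> a a' b b' [p [q [h -> ->]]] [p' [q' [h' -> ->]]].
  exists (p * p'), (p * q' + q * p').
  split; rewrite ?derivM ?(hornerD, hornerM) //; first exact: poly_dualM.
  ring.
Qed.

Lemma dual_adjoin_in u e v a a' : D a a' -> dual_adjoin u e v a (e * a').
Proof.
move=> h; exists a%:P, a'%:P; split; rewrite ?derivC ?hornerC ?horner0 ?mul0r ?addr0 //.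
exact: poly_dualC.
Qed.

Lemma dual_adjoin_gen u e v : dual_adjoin u e v u v.
Proof.
exists 'X, 0; split; rewrite ?derivX ?hornerX ?hornerC ?horner0 ?mulr0 ?mul1r ?add0r //.
by rewrite -['X]expr1; exact: poly_dualXn.
Qed.

(* A derivation of a subring extends to the adjunction of u, up to a factor e: if u is
   algebraic, with minimal equation m(u) = 0, then e = m'(u) and e u' = - m^D(u). *)
Lemma dual_extend u : functional_dual D ->
  exists2 e, e != 0 & exists v, functional_dual (dual_adjoin u e v).
Proof.
move=> fD.
have zero q : poly_dual D 0 q -> q = 0.
  by move=> h; apply/polyP => i; rewrite coef0; apply: fD; have := h i; rewrite coef0.
pose root_pair k := exists p q, [/\ poly_dual D p q, p != 0, p.[u] = 0 & size p = k].
have [alg|tr] := pselect (exists k, root_pair k); last first.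
  (* u is transcendental over the domain of D, so its image is free; 0 is chosen. *)
  exists 1; first exact: oner_neq0.
  exists 0 => a' [p [q [h p0 ->]]].
  have [e|pn0] := eqVneq p 0; last by case: tr; exists (size p), p, q.
  by rewrite e in h *; rewrite (zero q h) deriv0 !horner0 mulr0 mulr0 addr0.
have ex : exists k, `[< root_pair k >] by have [k hk] := alg; exists k; apply/asboolP.
case: (ex_minnP ex) => K /asboolP[m [mu [hm m0 mu0 sm]]] Kmin.
have {}Kmin p q : poly_dual D p q -> p.[u] = 0 -> p != 0 -> (K <= size p)%N.
  by move=> h pu pn0; apply: Kmin; apply/asboolP; exists p, q.
pose e := m^`().[u].
(* By minimality of the degree and characteristic 0, u is a simple root of m. *)
have e0 : e != 0.
  apply/eqP => e0; have dm0 : m^`() = 0.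
    apply/eqP; apply: contraT => dm.
    have := Kmin _ _ (poly_dual_deriv hm) e0 dm.
    by rewrite leqNgt -sm lt_size_deriv.
  have cm i : m`_i.+1 = 0.
    have /eqP := congr1 (fun p : {poly A} => p`_i) dm0.
    rewrite coef_deriv coef0 -mulr_natr mulf_eq0 (negPf (char0 i)) orbF => /eqP //.
  have mC : m = (m`_0)%:P.
    by apply/polyP => -[|i]; rewrite coefC //= cm.
  have m00 : m`_0 = 0 by rewrite -[RHS]mu0 [in RHS]mC hornerC.
  by case/eqP: m0; rewrite mC m00.
exists e => //; exists (- mu.[u]) => a' [p [q [h p0 ->]]].
have H : forall k p q, (size p <= k)%N -> poly_dual D p q -> p.[u] = 0 ->
    e * q.[u] + p^`().[u] * - mu.[u] = 0.
  elim=> [p1 q1|k IH p1 q1 sp hpq p1u].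
    rewrite leqn0 size_poly_eq0 => /eqP -> /zero -> _.
    by rewrite deriv0 !horner0 mulr0 mul0r addr0.
  have [p10|pn0] := eqVneq p1 0.
    by rewrite p10 in hpq *; rewrite (zero _ hpq) deriv0 !horner0 mulr0 mul0r addr0.
  have Kp := Kmin _ _ hpq p1u pn0.
  set c := lead_coef m; set l := mu`_(size m).-1.
  set b := lead_coef p1; set l' := q1`_(size p1).-1.
  set j := (size p1 - size m)%N.
  have hc : poly_dual D c%:P l%:P by apply: poly_dualC; exact: hm.
  have hb : poly_dual D b%:P l'%:P by apply: poly_dualC; exact: hpq.
  have h1 := poly_dualM hc hpq.
  have h2 := poly_dualM (poly_dualM hb (poly_dualXn j)) hm.
  (* Pseudo-division by m: lead(m) p1 - lead(p1) X^j m has smaller size, and still has u as a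
     root. *)
  have h3 := poly_dualD h1 (poly_dualN h2).
  set p2 := _ + _ in h3; set q2 := (X in poly_dual D p2 X) in h3.
  have c0 : c != 0 by rewrite lead_coef_eq0.
  have b0 : b != 0 by rewrite lead_coef_eq0.
  have sj : (size p1 = size m + j)%N by rewrite /j subnKC // sm.
  have sm1 : (0 < size m)%N by rewrite lt0n size_poly_eq0.
  have s2 : (size p2 <= k)%N.
    apply: (@leq_trans (size p1).-1); last by move: sp; case: (size p1).
    apply/leq_sizeP => i hi; rewrite /p2 coefB coefCM -mulrA coefCM coefXnM.
    move: hi; rewrite sj leq_eqVlt => /orP[/eqP <-|hi].
      rewrite ifF; last by apply/negbTE; rewrite -leqNgt; move: sm1; lia.
      have -> : ((size m + j).-1 - j = (size m).-1)%N by move: sm1; lia.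
      by rewrite -sj -/(lead_coef p1) -/(lead_coef m) -/b -/c mulrC subrr.
    have hi1 : (size p1 <= i)%N by rewrite sj; move: hi; case: (size m + j)%N.
    have hi2 : (size m <= i - j)%N.
      move: hi1; rewrite sj => hi1; rewrite leq_subRL; first by rewrite addnC.
      exact: leq_trans (leq_addl _ _) hi1.
    rewrite [p1`_i]nth_default // [m`__]nth_default // mulr0 sub0r.
    by case: ifP => _; rewrite ?mulr0 oppr0.
  have p2u : p2.[u] = 0.
    by rewrite /p2 hornerD hornerN !hornerM p1u mu0 !mulr0 subrr.
  have := IH _ _ s2 h3 p2u.
  rewrite /p2 /q2 !(derivD, derivN, derivM, derivC) !(hornerD, hornerN, hornerM, hornerC).
  rewrite p1u mu0 ?horner0 => E; apply: (mulfI c0); rewrite mulr0 -[RHS]E /e; ring.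
by apply: (H _ _ _ (leqnn _) h).
Qed.

End PolyDual.

Lemma dual_extend_seq (s : seq A) D : dual_subring D -> functional_dual D ->
  exists2 e, e != 0 & exists D', [/\ dual_subring D', functional_dual D',
    forall a a', D a a' -> D' a (e * a') & forall u, u \in s -> exists v, D' u v].
Proof.
elim: s D => [|u s IH] D hD fD.
  by exists 1; [exact: oner_neq0|exists D; split => // a a'; rewrite mul1r].
have [e e0 [v fD1]] := dual_extend hD u fD.
have [e' e0' [D' [hD' fD' sub mem]]] := IH _ (dual_adjoin_subring hD u e v) fD1.
exists (e' * e); first exact: mulf_neq0.
exists D'; split => //.
  by move=> a a' h; rewrite -mulrA; apply: sub; exact: dual_adjoin_in.
move=> w; rewrite inE => /orP[/eqP ->|]; last exact: mem.
by exists (e' * v); apply: sub; exact: dual_adjoin_gen.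
Qed.

End DualSubrings.

(** * A common denominator for all vector fields *)

Section Conductor.
Context {R : realType} {n : nat} {M : set 'rV[R[i]]_n}.
Local Notation C := R[i].
Local Notation CM := (coord_ring M).
Implicit Types (f g h : CM) (V W Y : CM -> CM) (x y : M).
Hypothesis irr : irreducible M.
Hypothesis M_closed : zariski_closed M.
Hypothesis core : exists2 V : CM -> CM, lie_core V & V <> 0.

Lemma mpoly_char0 N k : k.+1%:R != 0 :> mpoly.mpoly N C.
Proof.
apply/eqP => /(congr1 (mpoly.meval (fun=> 0))).
by rewrite mpoly.mevalMn mpoly.meval1 mpoly.meval0 => /eqP; rewrite pnatr_eq0.
Qed.

(* Along a dominant flow map Phi every vector field V, viewed as a derivation of C[M]
   into C[t], extends up to a factor to a derivation of C[t], hence is a combination of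
   the d/dt_k o Phi^*, which are tangent to the Lie core. *)
Lemma core_conductor d : has_dimension M d -> SAut_transitive M ->
  exists2 c : CM, c <> 0 & forall V, vector_field V -> lie_core (fmul c V).
Proof.
move=> dimM trans.
have [N [Phi [reg tan] dom]] := dominant_flow_map irr core M_closed dimM trans.
have [k [sg [B [c c0 [hB cramer]]]]] := @cramer_core R n M irr.
exists c => // V vV.
suff H : forall h, c * V h = \sum_j V (coordf (sg j)) * B j h.
  apply: (@lie_core_ext _ _ _ (fun h => \sum_j V (coordf (sg j)) * B j h)); last exact: H.
  by apply: lie_core_sum => j; exact: lie_core_fmul.
have reg' f : exists p : mpoly.mpoly N C, forall v : 'rV[C]_N, f (Phi v) = mpoly.meval (v 0) p.
  exact: (cm_morphism f reg).
(* The graph of V carried to C[t] by Phi^*; it is functional because Phi^* is injective. *)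
pose D0 (p q : mpoly.mpoly N C) := exists h,
  (forall v : 'rV[C]_N, mpoly.meval (v 0) p = h (Phi v)) /\
  (forall v : 'rV[C]_N, mpoly.meval (v 0) q = V h (Phi v)).
have hD0 : dual_subring D0.
  split.
  - by exists 0; split=> v; rewrite mpoly.meval0 ?(vf0 vV).
  - by exists 1; split=> v; rewrite ?mpoly.meval1 ?mpoly.meval0 ?(vf1 vV).
  - move=> p p' q q' [h [h1 h2]] [g [g1 g2]]; exists (h + g).
    by split=> v; rewrite mpoly.mevalD ?(vfD vV) cmD ?h1 ?h2 ?g1 ?g2.
  - move=> p p' [h [h1 h2]]; exists (- h).
    by split=> v; rewrite mpoly.mevalN ?(vfN vV) cmN ?h1 ?h2.
  - move=> p p' q q' [h [h1 h2]] [g [g1 g2]]; exists (h * g); split=> v.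
      by rewrite mpoly.mevalM cmM h1 g1.
    by rewrite mpoly.mevalD !mpoly.mevalM (vfM vV) cmD !cmM h1 h2 g1 g2 addrC.
have fD0 : functional_dual D0.
  move=> q [h [h1 h2]].
  have h0 : h = 0 by apply: dom => v; rewrite -h1 mpoly.meval0.
  by apply: mpoly_eq => v; rewrite h2 h0 (vf0 vV) mpoly.meval0.
have [e e0 [D [hD fD sub gen]]] := dual_extend_seq (@mpoly_char0 N)
  [seq mpoly.mpolyX C (mpoly.mnm1 k) | k <- enum 'I_N] hD0 fD0.
have /choice[w hw] : forall l : 'I_N, exists w, D (mpoly.mpolyX C (mpoly.mnm1 l)) w.
  by move=> l; apply: gen; apply/mapP; exists l; rewrite ?mem_enum.
(* With all variables adjoined, D is defined on the whole of C[t], as the derivation with components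
   w_k. *)
pose G p := D p (\sum_k mpoly.mderiv k p * w k).
have GC a : G (mpoly.mpolyC N a).
  rewrite /G big1 => [|l _]; last by rewrite mpoly.mderivC mul0r.
  rewrite -(mulr0 e); apply: sub; exists (a *: (1 : CM)).
  by split=> v; rewrite ?mpoly.mevalC ?mpoly.meval0 ?(vfZ vV) ?(vf1 vV) ?scaler0 // cmZ mulr1.
have GD p q : G p -> G q -> G (p + q).
  rewrite /G => hp hq; under eq_bigr => l _ do rewrite mpoly.mderivD mulrDl.
  by rewrite big_split; apply: dualD.
have GM p q : G p -> G q -> G (p * q).
  rewrite /G => hp hq; have := dualM hD hp hq; congr (D _ _).
  rewrite mulr_sumr mulr_suml -big_split; apply: eq_bigr => l _ /=.
  rewrite mpoly.mderivM; ring.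
have GX l : G (mpoly.mpolyX C (mpoly.mnm1 l)).
  rewrite /G (bigD1 l) //= big1 ?addr0 => [|j jl].
    rewrite mpoly.mderivX mpoly.mnm1E eqxx scale1r (_ : mpoly.mnm_sub _ _ = mpoly.mnm0).
      by rewrite mpoly.mpolyX0 mul1r.
    by apply/mpoly.mnmP => j; rewrite mpoly.mnmBE subnn mpoly.mnm0E.
  by rewrite mpoly.mderivX mpoly.mnm1E eq_sym (negPf jl) scale0r mul0r.
have GXm mm : G (mpoly.mpolyX C mm).
  rewrite mpoly.mpolyXE_id; elim/big_ind: _ => [|p q|l _]; first exact: (GC 1).
    exact: GM.
  elim: (mm l) => [|j IH]; first by rewrite expr0; exact: (GC 1).
  by rewrite exprS; exact: GM (GX l) IH.
have GG p : G p.
  elim/mpoly.mpolyind: p => [|a mm p _ _ IH].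
    by have := GC 0; rewrite mpoly.mpolyC0.
  apply: GD; last exact: IH.
  by rewrite -mpoly.mul_mpolyC; apply: GM; [exact: GC|exact: GXm].
(* e V = sum_k w_k (d/dt_k o Phi^* ) *)
have key (v : 'rV[C]_N) : exists Y : 'I_N -> CM -> CM, (forall k, lie_core_sat (Y k)) /\
    forall h, mpoly.meval (v 0) e * V h (Phi v) =
      \sum_k Y k h (Phi v) * mpoly.meval (v 0) (w k).
  have /choice[Y hY] : forall l : 'I_N, exists Y, lie_core_sat Y /\
      forall h, isd (fun s => h (Phi (update v l s))) (v 0 l) (Y h (Phi v)).
    by move=> l; have [Y h1 h2] := tan v l; exists Y.
  exists Y; split=> [l|h]; first by case: (hY l).
  have [p hp] := reg' h; have [q hq] := reg' (V h).
  have D0pq : D0 p q by exists h; split=> u; rewrite -?hp -?hq.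
  have epq : e * q = \sum_k mpoly.mderiv k p * w k.
    apply/eqP; rewrite -subr_eq0; apply/eqP; apply: fD.
    by have := dualD hD (sub _ _ D0pq) (dualN hD (GG p)); rewrite subrr.
  rewrite hq -mpoly.mevalM epq (raddf_sum (mpoly.meval (v 0))) /=.
  apply: eq_bigr => l _; rewrite mpoly.mevalM; congr (_ * _).
  apply: (@isd_unique _ _ _ _ _ (isd_mderiv p (v 0) l)).
  have := (hY l).2 h; congr isd; apply/funext => s; rewrite hp; apply: mpoly.meval_eq => j.
  by rewrite mxE.
(* The identity is tested after Phi^* and multiplication by e, where V becomes a combination of the
   Y_k. That these depend on the point is harmless: [c] and [B] in [cramer] serve all fields at
   once. *)
move=> h; pose Psi := c * V h - \sum_j V (coordf (sg j)) * B j h.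
suff : Psi = 0 by move/eqP; rewrite subr_eq0 => /eqP.
apply: dom => v0; have [p hp] := reg' Psi.
suff p0 : p = 0 by rewrite hp p0 mpoly.meval0.
apply: (mulfI e0); rewrite mulr0; apply: mpoly_eq => v.
rewrite mpoly.mevalM mpoly.meval0 -hp /Psi cmD cmN cmM cm_sum mulrBr mulrCA.
have [Y [hY eY]] := key v.
rewrite eY mulr_sumr mulr_sumr.
under [X in _ - X]eq_bigr => j _ do rewrite cmM mulrA eY mulr_suml.
rewrite [X in _ - X]exchange_big -sumrB big1 // => l _.
have := congr1 (fun f : CM => f (Phi v)) (cramer _ (hY l) h).
rewrite cmM cm_sum => E; rewrite mulrA E mulr_suml -sumrB big1 // => j _.
by rewrite cmM; ring.
Qed.

End Conductor.

(** * Nullstellensatz and conclusion *)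

Section Nullstellensatz.
Context {R : realType} {n : nat} {M : set 'rV[R[i]]_n}.
Local Notation C := R[i].
Local Notation CM := (coord_ring M).
Implicit Types (f g h : CM) (J : set CM).

Record is_ideal J : Prop := IsIdeal {
  ideal0 : J 0;
  idealD : forall f g, J f -> J g -> J (f + g);
  idealM : forall f g, J g -> J (f * g) }.

Lemma ideal_sum J (I : Type) (r : seq I) (F : I -> CM) : is_ideal J ->
  (forall i, J (F i)) -> J (\sum_(i <- r) F i).
Proof.
by move=> hJ h; elim/big_rec: _ => [|i x _ hx]; [exact: ideal0|apply: idealD].
Qed.

Definition ideal_adjoin J (u : CM) : set CM :=
  [set f | exists g b, J g /\ f = g + b * u].

Lemma ideal_adjoin_ideal J u : is_ideal J -> is_ideal (ideal_adjoin J u).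
Proof.
move=> hJ; split.
- by exists 0, 0; split; [exact: ideal0|rewrite mul0r addr0].
- move=> f g [f1 [b [Jf ->]]] [g1 [b' [Jg ->]]]; exists (f1 + g1), (b + b').
  by split; [exact: idealD|ring].
- move=> f g [g1 [b [Jg ->]]]; exists (f * g1), (f * b).
  by split; [exact: idealM|ring].
Qed.

Lemma ideal_adjoin_sub J u : J `<=` ideal_adjoin J u.
Proof. by move=> f Jf; exists f, 0; split; rewrite ?mul0r ?addr0. Qed.

Lemma ideal_adjoin_gen J u : is_ideal J -> ideal_adjoin J u u.
Proof. by move=> hJ; exists 0, 1; split; [exact: ideal0|rewrite mul1r add0r]. Qed.

(** Countable sets have Lebesgue measure 0, but [0, 1] has measure 1. *)
Lemma real_uncountable : ~ countable [set: R].
Proof.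
move=> cR.
have c01 : countable ([set` `[(0 : R), 1]]).
  by apply: sub_countable cR; exact: subset_card_le.
have := countable_lebesgue_measure0 c01; rewrite lebesgue_measure_itv /=.
rewrite constructive_ereal.lte_fin ltr01 => /(congr1 (@constructive_ereal.fine R)) /= /eqP.
by rewrite subr0 oner_eq0.
Qed.

Lemma complex_uncountable : ~ countable [set: C].
Proof.
move=> /countable_injP[f finj]; apply: real_uncountable.
apply/countable_injP; exists (fun x : R => f (x%:C%C)) => x y _ _ e.
by apply: (@complexI R); apply: finj; rewrite ?in_setE.
Qed.

Lemma wide_matrix_kernel p (A : 'M[C]_(p.+1, p)) : exists2 v : 'rV[C]_p.+1, v != 0 & v *m A = 0.
Proof.
exists (nz_row (kermx A)); last by apply/sub_kermxP; exact: nz_row_sub.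
rewrite nz_row_eq0 -mxrank_eq0 mxrank_ker -lt0n subn_gt0 ltnS.
exact: rank_leq_col.
Qed.

(* Otherwise every x_j - c is invertible modulo J, and as C is uncountable infinitely many
   of the inverses lie in one finite-dimensional space: a linear relation between them
   puts a nonzero polynomial in x_j into J, and this polynomial splits. *)
Lemma proper_adjoin J (j : 'I_n) : is_ideal J -> ~ J 1 ->
  exists c : C, ~ ideal_adjoin J (coordf j - c *: (1 : CM)) 1.
Proof.
move=> hJ J1; apply: contrapT => no.
pose u (c : C) : CM := coordf j - c *: (1 : CM).
have inv c : exists P : mpoly.mpoly n C, exists e g : CM,
    [/\ forall x, e x = mpoly.meval (val x 0) P, J g & 1 = g + e * u c].
  have [g [b [Jg e]]] : ideal_adjoin J (u c) 1.
    by apply: contrapT => h; apply: no; exists c.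
  by have [P hP] := regular_funP b; exists P, b, g.
have [P hP] := choice inv.
have [e he] := choice hP; have [g hg] := choice he.
(* Countably many finite sets, one for each bound K, cannot exhaust C. *)
have [K infK] : exists K, infinite_set [set c | (mpoly.msize (P c) <= K)%N].
  apply: contrapT => nK; apply: complex_uncountable.
  have -> : [set: C] = \bigcup_K [set c | (mpoly.msize (P c) <= K)%N].
    by apply/seteqP; split=> // c _; exists (mpoly.msize (P c)) => /=.
  apply: bigcup_countable => // K _; apply: finite_set_countable.
  by apply: contrapT => h; apply: nK; exists K.
pose p := #|{: mpoly.bmultinom n K}|.
have [F FK sF] := infinite_set_fset p.+1 infK.
pose c (i : 'I_p.+1) : C := nth 0 (finmap.enum_fset F) i.
have c_inj : injective c.
  move=> i i' /eqP; rewrite nth_uniq ?finmap.fset_uniq //; last 2 first.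
    by apply: leq_trans sF; exact: ltn_ord.
    by apply: leq_trans sF; exact: ltn_ord.
  by move/eqP/val_inj.
have cK i : (mpoly.msize (P (c i)) <= K)%N.
  apply: (FK (c i)); rewrite /= /c; apply: mem_nth.
  by apply: leq_trans sF; exact: ltn_ord.
pose A : 'M[C]_(p.+1, p) := \matrix_(i, l) mpoly.mcoeff (enum_val l : mpoly.bmultinom n K) (P (c i)).
have [v v0 vA] := wide_matrix_kernel A.
have sumP : \sum_i v 0 i *: P (c i) = 0.
  under eq_bigr => i _ do rewrite (mpoly.mpolywE (cK i)) scaler_sumr.
  rewrite exchange_big big1 // => m _.
  under eq_bigr => i _ do rewrite scalerA.
  rewrite -scaler_suml.
  have /rowP/(_ (enum_rank m)) := vA; rewrite !mxE => E.
  rewrite (_ : \sum_i _ = 0) ?scale0r // -[RHS]E; apply: eq_bigr => i _.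
  by rewrite mxE enum_rankK.
have sume : \sum_i v 0 i *: e (c i) = 0.
  apply: cm_ext => x; rewrite cm_sum.
  have := congr1 (mpoly.meval (val x 0)) sumP.
  rewrite (raddf_sum (mpoly.meval (val x 0))) mpoly.meval0 /= => E.
  rewrite -[RHS]E; apply: eq_bigr => i _; rewrite mpoly.mevalZ.
  by have [h _ _] := hg (c i); rewrite -h.
pose ev (q : {poly C}) : CM := cm_of (fun x => q.[val x 0 j]).
have evE q x : ev q x = q.[val x 0 j].
  apply: cm_ofE; elim/poly_ind: q => [|q a IH].
    by apply: regular_ext (regular_cst _ 0) => t; rewrite horner0.
  apply: regular_ext (regularD (regularM IH (regular_coord _ j)) (regular_cst _ a)) => t.
  by rewrite hornerMXaddC.
(* The numerator of the sum of v_i / (X - c_i). At c_i it takes the value v_i times a product of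
   nonzero differences. *)
pose Q : {poly C} := \sum_i v 0 i *: \prod_(l | l != i) ('X - (c l)%:P).
have Q0 : Q != 0.
  have [i vi] : exists i, v 0 i != 0.
    by apply/rV0Pn.
  apply/eqP => /(congr1 (horner^~ (c i))); rewrite horner0 horner_sum [X in X = _](bigD1 i) //=.
  rewrite [X in _ + X]big1 ?addr0 => [|l li].
    rewrite hornerZ horner_prod => /eqP; rewrite mulf_eq0 (negPf vi) /= => /prodf_eq0[l li].
    by rewrite hornerXsubC subr_eq0 => /eqP/c_inj e'; rewrite e' eqxx in li.
  by rewrite hornerZ horner_prod (bigD1 i) 1?eq_sym //= hornerXsubC subrr mul0r mulr0.
have evX a : ev ('X - a%:P) = u a.
  by apply: cm_ext => x; rewrite evE hornerXsubC /u cmD cmN cmZ mulr1 coordfE.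
(* Insert 1 = g + e u in each summand: the parts with e u add up to the product of all u (c_l) times
   the relation [sume], and the others lie in J. *)
have JQ : J (ev Q).
  have -> : ev Q = \sum_i (v 0 i *: ev (\prod_(l | l != i) ('X - (c l)%:P))) * g (c i).
    have tot : \sum_i (v 0 i *: ev (\prod_(l | l != i) ('X - (c l)%:P))) * (e (c i) * u (c i)) = 0.
      transitivity (ev (\prod_l ('X - (c l)%:P)) * \sum_i v 0 i *: e (c i)); last by rewrite sume mulr0.
      rewrite mulr_sumr; apply: eq_bigr => i _; rewrite -evX; apply: cm_ext => x.
      rewrite !(cmM, cmZ, evE) [in RHS](bigD1 i) //= hornerM; ring.
    have E : ev Q = \sum_i (v 0 i *: ev (\prod_(l | l != i) ('X - (c l)%:P))) * 1.
      apply: cm_ext => x; rewrite evE /Q horner_sum cm_sum; apply: eq_bigr => i _.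
      by rewrite mulr1 cmZ evE hornerZ.
    rewrite E; pose b i : CM := v 0 i *: ev (\prod_(l | l != i) ('X - (c l)%:P)).
    have -> : \sum_i b i * 1 = \sum_i b i * g (c i) + \sum_i b i * (e (c i) * u (c i)).
      rewrite -big_split; apply: eq_bigr => i _ /=.
      by have [_ _ h] := hg (c i); rewrite {1}h mulrDr.
    by rewrite tot addr0.
  by apply: ideal_sum => // i; apply: idealM => //; have [] := hg (c i).
have [r Qr] := closed_field_poly_normal Q.
have lc0 : lead_coef Q != 0 by rewrite lead_coef_eq0.
have {JQ} : J (ev (\prod_(z <- r) ('X - z%:P))).
  have := idealM hJ ((lead_coef Q)^-1 *: (1 : CM)) JQ; congr J.
  have QE t : Q.[t] = lead_coef Q * (\prod_(z <- r) ('X - z%:P)).[t].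
    by rewrite [in LHS]Qr hornerZ.
  by apply: cm_ext => x; rewrite cmM cmZ mulr1 !evE QE mulrA mulVf ?mul1r.
(* Each linear factor is invertible modulo J and can be stripped off, until 1 would lie in J. *)
elim: r {Qr} => [|z r IH].
  rewrite big_nil (_ : ev 1 = 1) //; apply: cm_ext => x.
  by rewrite evE hornerC.
rewrite big_cons => Jz; apply: IH.
have [_ Jg h] := hg z.
have -> : ev (\prod_(z <- r) ('X - z%:P)) = ev (\prod_(z <- r) ('X - z%:P)) * g z +
    e z * ev (('X - z%:P) * \prod_(z <- r) ('X - z%:P)).
  rewrite -{1}[ev (\prod_(z <- r) _)]mulr1 {1}h mulrDr; congr (_ + _).
  rewrite -evX; apply: cm_ext => x; rewrite !(cmM, evE) hornerM; ring.
by apply: idealD => //; exact: idealM.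
Qed.

Theorem weak_nullstellensatz J : zariski_closed M -> is_ideal J ->
  (forall x : M, exists2 f, J f & f x <> 0) -> J 1.
Proof.
move=> [S MS] hJ nozero; apply: contrapT => J1.
(* One coordinate after the other is fixed modulo the ideal, which stays proper; the c_j are the
   coordinates of a common zero. *)
have [c [J' [hJ' sub J1' mem]]] : exists c : 'I_n -> C, exists J',
    [/\ is_ideal J', J `<=` J', ~ J' 1 & forall j, J' (coordf j - c j *: (1 : CM))].
  suff [c [J' [h1 h2 h3 h4]]] : exists c : 'I_n -> C, exists J',
    [/\ is_ideal J', J `<=` J', ~ J' 1 &
        forall j, j \in enum 'I_n -> J' (coordf j - c j *: (1 : CM))].
    by exists c, J'; split=> // j; apply: h4; rewrite mem_enum.
  elim: (enum 'I_n) => [|k s [c [J' [h1 h2 h3 h4]]]].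
    by exists (fun=> 0), J; split.
  have [a ha] := proper_adjoin k h1 h3.
  exists (update_fun c k a), (ideal_adjoin J' (coordf k - a *: (1 : CM))); split => //.
  - exact: ideal_adjoin_ideal.
  - by apply: subset_trans h2 _; exact: ideal_adjoin_sub.
  - move=> j; rewrite inE /update_fun; case: eqP => [-> _|_ /= js]; first exact: ideal_adjoin_gen.
    by apply: ideal_adjoin_sub; exact: h4.
have J'C a : J' (a *: (1 : CM)) -> a = 0.
  move=> h; apply: contrapT => /eqP a0; apply: J1'.
  have := idealM hJ' (a^-1 *: (1 : CM)) h; congr J'.
  by apply: cm_ext => x; rewrite cmM !cmZ !mulr1 mulVf.
pose z : 'rV[C]_n := \row_j c j.
(* evaluation at z, represented by None, is reduction modulo J' *)
have red P : exists f : CM, (forall x, f x = mpoly.meval (val x 0) P) /\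
    J' (f - mpoly.meval (z 0) P *: (1 : CM)).
  pose T (F : option M -> C) := exists f : CM, (forall x, f x = F (Some x)) /\
    J' (f - F None *: (1 : CM)).
  have := @meval_closed _ _ (option M) T P
    (fun j o => if o is Some x then val x 0 j else z 0 j).
  apply.
  - move=> a; exists (a *: (1 : CM)); split; first by move=> x; rewrite cmZ mulr1.
    by rewrite subrr; exact: ideal0.
  - move=> F G [f [f1 f2]] [g [g1 g2]]; exists (f + g); split.
      by move=> x; rewrite cmD f1 g1.
    have := idealD hJ' f2 g2; congr J'; apply: cm_ext => x; rewrite !(cmD, cmN, cmZ); ring.
  - move=> F G [f [f1 f2]] [g [g1 g2]]; exists (f * g); split.
      by move=> x; rewrite cmM f1 g1.
    have := idealD hJ' (idealM hJ' (G None *: (1 : CM)) f2) (idealM hJ' f g2); congr J'.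
    by apply: cm_ext => x; rewrite !(cmD, cmM, cmN, cmZ, cm1); ring.
  - move=> j; exists (coordf j); split; first by move=> x; rewrite coordfE.
    by rewrite mxE; exact: mem.
(* An equation P of M is zero as a function on M, so the constant P(z) lies in J' and vanishes. *)
have Mz : M z.
  rewrite MS => P SP; apply: J'C.
  have [f [f1 f2]] := red P.
  have f0 : f = 0.
    apply: cm_ext => x; rewrite f1.
    have : M (val x) by exact/set_mem/(valP x).
    by rewrite {1}MS; apply.
  have := idealM hJ' (- 1) f2; congr J'; rewrite f0 sub0r mulrN mulN1r opprK //.
pose x : M := exist _ z (mem_set Mz).
have [f Jf fx] := nozero x; apply: fx.
have [P hP] := regular_funP f.
rewrite hP; apply: J'C.
have [f' [f1 f2]] := red P.
have ff : f' = f by apply: cm_ext => y; rewrite f1 hP.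
have := idealD hJ' (sub _ Jf) (idealM hJ' (- 1) f2); congr J'.
by rewrite ff mulN1r opprB addrC subrK.
Qed.

End Nullstellensatz.

Theorem theorem5p3 (R : realType) (n : nat) (M : set 'rV[R[i]%C]_n)
    (M_variety : affine_variety M) (M_smooth : smooth M)
    (M_flexible : SAut_transitive M)
    (M_SL2 : exists (a : SL2 R -> M -> M) (D U : coord_ring M -> coord_ring M),
       [/\ SL2_action a, nontrivial_action a, induced_pair a D U &
           highest_weight_space D U 1%Z <> [set 0%R]%classic \/
           highest_weight_space D U 2%Z <> [set 0%R]%classic]) :
  algebraic_density_property M.
Proof.
have [M_closed irr] := M_variety.
have [a [_ [_ [ha nta _ _]]]] := M_SL2.
have core : exists2 V : coord_ring M -> coord_ring M, lie_core V & V <> 0.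
  by have [V V0 hV] := sl2_action_submodule ha irr nta; exists V.
have [d [dimM _]] := M_smooth.
have [c c0 hc] := core_conductor irr M_closed core dimM M_flexible.
have hL := @complete_lie_subalgebra R n M.
pose J : set (coord_ring M) := [set f | forall V, vector_field V -> lie_core (fmul f V)].
have hJ : is_ideal J.
  split=> [V vV|f g hf hg V vV|f g hg V vV].
  - by apply: lie_core_ext lie_core0 _ => h; rewrite /fmul mul0r.
  - by apply: lie_core_ext (lie_coreD (hf V vV) (hg V vV)) _ => h; rewrite /fmul mulrDl.
  - by apply: lie_core_ext (lie_core_fmul f (hg V vV)) _ => h; rewrite /fmul mulrA.
have [x cx] : exists x : M, c x <> 0.
  by apply: contrapT => no; apply: c0; apply: cm_ext => x; apply: contrapT => cx; apply: no; exists x.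
have J1 : J 1.
  apply: weak_nullstellensatz => // y.
  have [phi [/SAut_automorphism[rphi [psi [rpsi phiK psiK]]] phiy]] := M_flexible y x.
  (* phi moves y to a point where c does not vanish. If W is the push-forward of V, then c W is in
     the core, and transporting it back gives (c o phi) V. *)
  exists (pull phi c); last by rewrite pullE // phiy.
  move=> V vV; pose W := pushforward phi psi V.
  have vW : vector_field W by exact: pushforward_vf.
  apply: lie_core_ext (pushforward_lie_core rpsi rphi psiK phiK (hc W vW)) _ => h.
  apply: cm_ext => z; rewrite -(phiK z) pushforwardE // /fmul !cmM pullE // psiK; congr (_ * _).
  rewrite /W; have := @pushforwardE _ _ _ phi psi rpsi phiK V (pull psi h) z.
  by rewrite phiK => ->; rewrite pullK.
apply/seteqP; split=> V hV; first exact: (lie_vf hL hV).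
have vV : vector_field V := hV.
by apply: lie_ext (lie_core_lie (J1 V vV)) _ => h; rewrite /fmul mul1r.
Qed.
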